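(* The divisor $D$ of any $f\in{\cal AE}$ is almost periodic. Moreover, for every $\varepsilon>0$ the set of numbers $\tau\in\mathbb{C}$ that are simultaneously $\varepsilon$-almost periods of $f$ and of $D$ is relatively dense in $\mathbb{C}$.
   Context: $\rho_S$ is the spherical metric. $\tau$ is an $\varepsilon$-almost period of a meromorphic $f$ if $\rho_S(f(z+\tau),f(z))<\varepsilon$ for all $z\in\mathbb{C}$; a nonconstant meromorphic $f$ is in ${\cal AE}$ if for every $\varepsilon>0$ its $\varepsilon$-almost periods form a relatively dense set. A set $E\subset\mathbb{C}$ is relatively dense if there is $L<\infty$ such that every disc of radius $L$ meets $E$. The divisor $D=((a_n),(b_n))$ of $f$ lists the zeros $a_n$ and poles $b_n$ with multiplicity. $\tau$ is an $\varepsilon$-almost period of $D$ if there are bijections $\sigma,\sigma':\mathbb{N}\to\mathbb{N}$ with $|a_n+\tau-a_{\sigma(n)}|<\varepsilon$ and $|b_n+\tau-b_{\sigma'(n)}|<\varepsilon$ for all $n$; $D$ is almost periodic if for every $\varepsilon>0$ its $\varepsilon$-almost periods form a relatively dense set. *)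

(* Defs.v *)
(* classical real numbers.  Complex numbers are modelled as
   pairs of reals, the Riemann sphere as [option Cplx] (None = infinity). *)
From Stdlib Require Import Reals.
Open Scope R_scope.

Definition Cplx : Type := (R * R)%type.
Definition Cre (z : Cplx) : R := fst z.
Definition Cim (z : Cplx) : R := snd z.
Definition C0 : Cplx := (0, 0).
Definition C1 : Cplx := (1, 0).
Definition Cadd (z w : Cplx) : Cplx := (Cre z + Cre w, Cim z + Cim w).
Definition Copp (z : Cplx) : Cplx := (- Cre z, - Cim z).
Definition Csub (z w : Cplx) : Cplx := Cadd z (Copp w).
Definition Cmul (z w : Cplx) : Cplx :=
  (Cre z * Cre w - Cim z * Cim w, Cre z * Cim w + Cim z * Cre w).
Definition Cinv (z : Cplx) : Cplx :=
  (Cre z / (Cre z ^ 2 + Cim z ^ 2), - Cim z / (Cre z ^ 2 + Cim z ^ 2)).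
Definition Cdiv (z w : Cplx) : Cplx := Cmul z (Cinv w).
Fixpoint Cpow (z : Cplx) (n : nat) : Cplx :=
  match n with O => C1 | S k => Cmul z (Cpow z k) end.
Definition Cnorm (z : Cplx) : R := sqrt (Cre z ^ 2 + Cim z ^ 2).

Definition C_differentiable_at (h : Cplx -> Cplx) (z : Cplx) : Prop :=
  exists l : Cplx, forall eps : R, eps > 0 -> exists delta : R, delta > 0 /\
    forall w : Cplx, 0 < Cnorm (Csub w z) < delta ->
      Cnorm (Csub (Cdiv (Csub (h w) (h z)) (Csub w z)) l) < eps.

Definition holomorphic_on_disc (h : Cplx -> Cplx) (z0 : Cplx) (r : R) : Prop :=
  forall z : Cplx, Cnorm (Csub z z0) < r -> C_differentiable_at h z.

(** * Meromorphic functions on Cplx, as maps into the Riemann sphere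
    [option Cplx] (None = the point at infinity).  Locally, f is either
    holomorphic (finite valued), or has a pole at z0: f = 1/g near z0 with
    g holomorphic, g z0 = 0 and g nonvanishing on the punctured disc. *)
Definition meromorphic (f : Cplx -> option Cplx) : Prop :=
  forall z0 : Cplx, exists r : R, r > 0 /\
    ( (exists h : Cplx -> Cplx, holomorphic_on_disc h z0 r /\
         forall z, Cnorm (Csub z z0) < r -> f z = Some (h z))
    \/ (f z0 = None /\
        exists g : Cplx -> Cplx, holomorphic_on_disc g z0 r /\ g z0 = C0 /\
         forall z, 0 < Cnorm (Csub z z0) < r ->
           g z <> C0 /\ f z = Some (Cinv (g z)))).

Definition nonconstant (f : Cplx -> option Cplx) : Prop :=
  exists z1 z2 : Cplx, f z1 <> f z2.

Definition rho_S (a b : option Cplx) : R :=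
  match a, b with
  | Some x, Some y =>
      2 * Cnorm (Csub x y) /
        sqrt ((1 + Cnorm x ^ 2) * (1 + Cnorm y ^ 2))
  | Some x, None => 2 / sqrt (1 + Cnorm x ^ 2)
  | None, Some y => 2 / sqrt (1 + Cnorm y ^ 2)
  | None, None => 0
  end.

Definition relatively_dense (E : Cplx -> Prop) : Prop :=
  exists L : R, L > 0 /\
    forall c : Cplx, exists tau : Cplx, E tau /\ Cnorm (Csub tau c) < L.

Definition almost_period_f (f : Cplx -> option Cplx) (eps : R) (tau : Cplx) : Prop :=
  forall z : Cplx, rho_S (f (Cadd z tau)) (f z) < eps.

Definition in_AE (f : Cplx -> option Cplx) : Prop :=
  meromorphic f /\ nonconstant f /\
  forall eps : R, eps > 0 -> relatively_dense (almost_period_f f eps).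

Definition zero_order (f : Cplx -> option Cplx) (z0 : Cplx) (m : nat) : Prop :=
  (1 <= m)%nat /\
  exists r : R, r > 0 /\ exists h : Cplx -> Cplx,
    holomorphic_on_disc h z0 r /\ h z0 <> C0 /\
    forall z, Cnorm (Csub z z0) < r ->
      f z = Some (Cmul (Cpow (Csub z z0) m) (h z)).

Definition pole_order (f : Cplx -> option Cplx) (z0 : Cplx) (m : nat) : Prop :=
  (1 <= m)%nat /\ f z0 = None /\
  exists r : R, r > 0 /\ exists h : Cplx -> Cplx,
    holomorphic_on_disc h z0 r /\ h z0 <> C0 /\
    forall z, 0 < Cnorm (Csub z z0) < r ->
      f z = Some (Cdiv (h z) (Cpow (Csub z z0) m)).

(** The divisor D = ((a_n),(b_n)): zeros / poles listed with multiplicity.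
    A zero a of order m contributes the m entries (a,1),...,(a,m); the
    index types below are exactly the "listings with multiplicity". *)
Definition zero_list (f : Cplx -> option Cplx) : Type :=
  { p : Cplx * nat | exists m, zero_order f (fst p) m /\
                   (1 <= snd p)%nat /\ (snd p <= m)%nat }.
Definition pole_list (f : Cplx -> option Cplx) : Type :=
  { p : Cplx * nat | exists m, pole_order f (fst p) m /\
                   (1 <= snd p)%nat /\ (snd p <= m)%nat }.

Definition zero_pt {f} (x : zero_list f) : Cplx := fst (proj1_sig x).
Definition pole_pt {f} (x : pole_list f) : Cplx := fst (proj1_sig x).

Definition bijective {A B : Type} (s : A -> B) : Prop :=
  exists t : B -> A, (forall x, t (s x) = x) /\ (forall y, s (t y) = y).

Definition almost_period_div (f : Cplx -> option Cplx) (eps : R) (tau : Cplx) : Prop :=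
  (exists sigma : zero_list f -> zero_list f, bijective sigma /\
     forall n, Cnorm (Csub (Cadd (zero_pt n) tau) (zero_pt (sigma n))) < eps)
  /\
  (exists sigma' : pole_list f -> pole_list f, bijective sigma' /\
     forall n, Cnorm (Csub (Cadd (pole_pt n) tau) (pole_pt (sigma' n))) < eps).

Definition div_almost_periodic (f : Cplx -> option Cplx) : Prop :=
  forall eps : R, eps > 0 -> relatively_dense (almost_period_div f eps).

(* Main.v *)
Require Import Defs.
From Stdlib Require Import Reals Lra Lia List Wf_nat Compare_dec.
From Stdlib Require Import Classical ClassicalEpsilon FunctionalExtensionality PropExtensionality.
From Coquelicot Require Import Coquelicot.
Open Scope R_scope.

(** Write [g] for the translate [f (. + tau)].  A [delta]-almost period of [f],
    with [delta] small, makes [f] and [g] uniformly close, and the claim is that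
    it is then an [eps]-almost period of the divisor.  Three uniformities drive
    the proof: [f] is uniformly continuous, so on every disc of a fixed radius
    [f] or [1/f] is holomorphic and bounded by 2; by almost periodicity it is
    uniformly nonconstant on discs; hence its Taylor expansions have a
    coefficient of bounded index and size bounded below.  Around each zero one
    of finitely many radii [rho <= eps] is such that a single Taylor term
    [a_k (z - c)^k] dominates, and Rouche's theorem gives the same number [k]
    of zeros of [f] and of [g] in [|z - c| <= rho / 4] and none in the
    remaining annulus up to [rho].  These clusters are therefore nested or
    disjoint, and matching the zeros inside the maximal ones gives a bijection
    moving points by at most [rho / 2].  Poles are zeros of [1/f]. *)

(** The obstacle is that nothing separates distinct zeros uniformly: a disc of fixed radius about a
    zero may have other zeros near its rim, where the comparison needed for Rouche's theorem breaks
    down. So the radius must depend on the zero. It is drawn from the geometric family [s0 * q ^ j]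
    with [j] bounded, hence one tolerance [delta] serves every centre. The radius and the count [k]
    are fixed by [f] alone, and [f] and [g] are then compared with the same Taylor term, which is
    why the counts agree.

    No normal families are used: each uniformity is an explicit estimate. The function theory behind
    it (Goursat, Cauchy, Taylor, Rouche) is derived from the bare definition of the derivative by
    integrating over rectangles. Its constants are lossy, such as [64 / r] where the sharp one is
    [1 / r], and [rho_S] is given a triangle inequality only up to a factor 2; what matters is that
    no constant depends on the centre. *)

(** * Complex continuity and differentiability *)

Lemma Cmod_minus_sym (z w : C) : Cmod (z - w) = Cmod (w - z).
Proof. rewrite <- Cmod_opp. f_equal. ring. Qed.

Lemma Cmod_minus_triangle (a b c : C) : Cmod (a - c) <= Cmod (a - b) + Cmod (b - c).
Proof. replace (a - c)%C with ((a - b) + (b - c))%C by ring. apply Cmod_triangle. Qed.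

Lemma Cmod_reverse_triangle (a b : C) : Cmod a - Cmod b <= Cmod (a - b).
Proof.
  assert (H := Cmod_triangle (a - b) b).
  replace (a - b + b)%C with a in H by ring. lra.
Qed.

Lemma Cmod_minus_0 (z w : C) : Cmod (z - w) = 0 -> z = w.
Proof.
  intro H. apply Cmod_eq_0 in H.
  replace z with (z - w + w)%C by ring. rewrite H. ring.
Qed.

Lemma Cminus_neq_0 (z w : C) : z <> w -> (z - w)%C <> 0%C.
Proof. intros H E. apply H. apply Cmod_minus_0. rewrite E. apply Cmod_0. Qed.

Lemma Cmod_minus_gt_0 (z w : C) : z <> w -> 0 < Cmod (z - w).
Proof. intro H. apply Cmod_gt_0. now apply Cminus_neq_0. Qed.

Lemma Cmod_minus_diag (z : C) : Cmod (z - z) = 0.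
Proof. replace (z - z)%C with (RtoC 0) by ring. apply Cmod_0. Qed.

Lemma Cinv_neq_0 (z : C) : z <> 0%C -> (/ z)%C <> 0%C.
Proof.
  intros N E. apply N. replace z with (z * (z * / z))%C by (field; auto). rewrite E. ring.
Qed.

Definition cont_at (h : C -> C) (z : C) : Prop :=
  forall eps, eps > 0 -> exists d, d > 0 /\
    forall w, Cmod (w - z) < d -> Cmod (h w - h z) < eps.

(* [Cplx] and its operations are convertible to Coquelicot's [C], which shadows
   them; the [change] steps of later proofs rely on this. *)
Definition diff_at (h : C -> C) (z : C) : Prop := C_differentiable_at h z.

Lemma cont_at_const (k z : C) : cont_at (fun _ => k) z.
Proof. intros e He. exists 1. split; [lra|]. intros w _. now rewrite Cmod_minus_diag. Qed.

Lemma cont_at_id (z : C) : cont_at (fun w => w) z.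
Proof. intros e He. exists e. auto. Qed.

Lemma cont_at_plus (f g : C -> C) (z : C) :
  cont_at f z -> cont_at g z -> cont_at (fun w => f w + g w)%C z.
Proof.
  intros Hf Hg e He.
  destruct (Hf (e / 2)) as [d1 [Hd1 H1]]; [lra|].
  destruct (Hg (e / 2)) as [d2 [Hd2 H2]]; [lra|].
  exists (Rmin d1 d2). split; [now apply Rmin_glb_lt|].
  intros w Hw.
  assert (A := H1 w (Rlt_le_trans _ _ _ Hw (Rmin_l _ _))).
  assert (B := H2 w (Rlt_le_trans _ _ _ Hw (Rmin_r _ _))).
  replace (f w + g w - (f z + g z))%C with ((f w - f z) + (g w - g z))%C by ring.
  eapply Rle_lt_trans; [apply Cmod_triangle|]. lra.
Qed.

Lemma cont_at_mult (f g : C -> C) (z : C) :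
  cont_at f z -> cont_at g z -> cont_at (fun w => f w * g w)%C z.
Proof.
  intros Hf Hg e He.
  set (m := 1 + Cmod (f z) + Cmod (g z)).
  assert (P1 := Cmod_ge_0 (f z)). assert (P2 := Cmod_ge_0 (g z)).
  assert (Hm : 0 < m) by (unfold m; lra).
  set (e' := Rmin 1 (e / m)).
  assert (Hem : 0 < e / m) by (apply Rdiv_lt_0_compat; lra).
  assert (He' : e' > 0) by (apply Rmin_glb_lt; lra).
  assert (E1 : e' <= 1) by apply Rmin_l.
  assert (E2 : e' * m <= e).
  { apply Rle_trans with (e / m * m).
    - apply Rmult_le_compat_r; [lra | apply Rmin_r].
    - right. field. lra. }
  destruct (Hf e' He') as [d1 [Hd1 H1]].
  destruct (Hg e' He') as [d2 [Hd2 H2]].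
  exists (Rmin d1 d2). split; [now apply Rmin_glb_lt|].
  intros w Hw.
  assert (A := H1 w (Rlt_le_trans _ _ _ Hw (Rmin_l _ _))).
  assert (B := H2 w (Rlt_le_trans _ _ _ Hw (Rmin_r _ _))).
  replace (f w * g w - f z * g z)%C
    with ((f w - f z) * (g w - g z) + (f z * (g w - g z) + (f w - f z) * g z))%C by ring.
  eapply Rle_lt_trans; [apply Cmod_triangle|].
  eapply Rle_lt_trans; [apply Rplus_le_compat_l, Cmod_triangle|].
  rewrite !Cmod_mult.
  assert (Q1 := Cmod_ge_0 (f w - f z)). assert (Q2 := Cmod_ge_0 (g w - g z)).
  unfold m in E2. nra.
Qed.

Lemma cont_at_minus (f g : C -> C) (z : C) :
  cont_at f z -> cont_at g z -> cont_at (fun w => f w - g w)%C z.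
Proof.
  intros Hf Hg.
  assert (H : cont_at (fun w => f w + (RtoC (-1)) * g w)%C z).
  { apply cont_at_plus; auto. apply cont_at_mult; auto. apply cont_at_const. }
  intros e He. destruct (H e He) as [d [Hd H']]. exists d. split; auto.
  intros w Hw. specialize (H' w Hw).
  replace (f w - g w - (f z - g z))%C
    with (f w + RtoC (-1) * g w - (f z + RtoC (-1) * g z))%C by ring. exact H'.
Qed.

Lemma cont_at_inv (f : C -> C) (z : C) :
  f z <> 0%C -> cont_at f z -> cont_at (fun w => / f w)%C z.
Proof.
  intros H0 Hf e He.
  assert (Hp : 0 < Cmod (f z)) by now apply Cmod_gt_0.
  set (m := Cmod (f z)) in *.
  destruct (Hf (Rmin (m / 2) (e * m * m / 2))) as [d [Hd H]].
  { apply Rmin_glb_lt; [lra|]. assert (0 < e * m * m) by (repeat apply Rmult_lt_0_compat; lra). lra. }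
  exists d. split; auto. intros w Hw. specialize (H w Hw).
  assert (A := Rlt_le_trans _ _ _ H (Rmin_l _ _)).
  assert (B := Rlt_le_trans _ _ _ H (Rmin_r _ _)).
  assert (G : m / 2 <= Cmod (f w)).
  { assert (T := Cmod_reverse_triangle (f z) (f w)). rewrite Cmod_minus_sym in T. fold m in T. lra. }
  assert (Nw : f w <> 0%C) by (apply Cmod_gt_0; lra).
  replace (/ f w - / f z)%C with ((f z - f w) / (f w * f z))%C by (field; auto).
  rewrite Cmod_div by now apply Cmult_neq_0. rewrite Cmod_mult, Cmod_minus_sym. fold m.
  apply Rlt_div_l. { apply Rmult_lt_0_compat; lra. }
  eapply Rlt_le_trans; [exact B|].
  assert (e * (m / 2) * m <= e * Cmod (f w) * m).
  { apply Rmult_le_compat_r; [lra|]. apply Rmult_le_compat_l; lra. }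
  lra.
Qed.

Lemma cont_at_ext_loc (f g : C -> C) (z : C) (r : R) :
  r > 0 -> (forall w, Cmod (w - z) < r -> f w = g w) -> cont_at f z -> cont_at g z.
Proof.
  intros Hr E Hf e He. destruct (Hf e He) as [d [Hd H]].
  exists (Rmin d r). split; [now apply Rmin_glb_lt|]. intros w Hw.
  rewrite <- (E w), <- (E z).
  - apply H. eapply Rlt_le_trans; [exact Hw | apply Rmin_l].
  - now rewrite Cmod_minus_diag.
  - eapply Rlt_le_trans; [exact Hw | apply Rmin_r].
Qed.

Lemma cont_at_limit_unique (f g : C -> C) (z : C) (r : R) :
  r > 0 -> (forall w, 0 < Cmod (w - z) < r -> f w = g w) ->
  cont_at f z -> cont_at g z -> f z = g z.
Proof.
  intros Hr E Hf Hg. apply NNPP. intro N.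
  assert (P := Cmod_minus_gt_0 _ _ N).
  set (e := Cmod (f z - g z)) in *.
  destruct (Hf (e / 2)) as [d1 [Hd1 H1]]; [lra|].
  destruct (Hg (e / 2)) as [d2 [Hd2 H2]]; [lra|].
  set (d := Rmin r (Rmin d1 d2) / 2).
  assert (Hd : 0 < Rmin r (Rmin d1 d2)) by (repeat apply Rmin_glb_lt; lra).
  assert (L1 := Rmin_l r (Rmin d1 d2)). assert (L2 := Rmin_r r (Rmin d1 d2)).
  assert (L3 := Rmin_l d1 d2). assert (L4 := Rmin_r d1 d2).
  set (w := (z + RtoC d)%C).
  assert (Hw : Cmod (w - z) = d).
  { unfold w. replace (z + RtoC d - z)%C with (RtoC d) by ring.
    rewrite Cmod_R. apply Rabs_pos_eq. unfold d. lra. }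
  specialize (E w). specialize (H1 w). specialize (H2 w). rewrite Hw in E, H1, H2.
  assert (A := H1 ltac:(unfold d; lra)). assert (B := H2 ltac:(unfold d; lra)).
  rewrite E in A by (unfold d; lra).
  assert (T := Cmod_minus_triangle (f z) (g w) (g z)).
  rewrite (Cmod_minus_sym (f z) (g w)) in T. fold e in T. lra.
Qed.

(* Caratheodory's form of differentiability makes the product and quotient
   rules consequences of those for continuity. *)
Lemma diff_at_iff (h : C -> C) (z : C) :
  diff_at h z <-> exists q, cont_at q z /\ forall w, h w = (h z + (w - z) * q w)%C.
Proof.
  split.
  - intros [l Hl].
    exists (fun w => if excluded_middle_informative (w = z) then l
                     else ((h w - h z) / (w - z))%C). split.
    + intros e He. destruct (Hl e He) as [d [Hd H]]. exists d. split; auto.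
      intros w Hw.
      destruct (excluded_middle_informative (z = z)) as [_|N]; [|now destruct N].
      destruct (excluded_middle_informative (w = z)) as [->|N].
      * now rewrite Cmod_minus_diag.
      * apply (H w). split; auto. now apply Cmod_minus_gt_0.
    + intro w. destruct (excluded_middle_informative (w = z)) as [->|N].
      * ring.
      * field. now apply Cminus_neq_0.
  - intros [q [Hq E]]. exists (q z). intros e He.
    destruct (Hq e He) as [d [Hd H]]. exists d. split; auto.
    intros w [Hw1 Hw2].
    change (Cmod ((h w - h z) / (w - z) - q z) < e).
    replace ((h w - h z) / (w - z))%C with (q w); [now apply H|].
    rewrite (E w). field. apply Cmod_gt_0. exact Hw1.
Qed.

Lemma diff_at_cont (h : C -> C) (z : C) : diff_at h z -> cont_at h z.
Proof.
  rewrite diff_at_iff. intros [q [Hq E]].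
  apply (cont_at_ext_loc (fun w => h z + (w - z) * q w)%C h z 1).
  - lra.
  - intros; now rewrite <- E.
  - apply cont_at_plus; [apply cont_at_const|]. apply cont_at_mult; auto.
    apply cont_at_minus; [apply cont_at_id | apply cont_at_const].
Qed.

Lemma diff_at_const (k z : C) : diff_at (fun _ => k) z.
Proof.
  apply diff_at_iff. exists (fun _ => 0%C). split; [apply cont_at_const | intros; ring].
Qed.

Lemma diff_at_id (z : C) : diff_at (fun w => w) z.
Proof.
  apply diff_at_iff. exists (fun _ => 1%C). split; [apply cont_at_const | intros; ring].
Qed.

Lemma diff_at_plus (f g : C -> C) (z : C) :
  diff_at f z -> diff_at g z -> diff_at (fun w => f w + g w)%C z.
Proof.
  rewrite !diff_at_iff. intros [q [Hq E]] [q' [Hq' E']].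
  exists (fun w => q w + q' w)%C. split; [now apply cont_at_plus|].
  intro w. rewrite E, E'. ring.
Qed.

Lemma diff_at_mult (f g : C -> C) (z : C) :
  diff_at f z -> diff_at g z -> diff_at (fun w => f w * g w)%C z.
Proof.
  intros Hf Hg. assert (Cg := diff_at_cont g z Hg). revert Hf Hg.
  rewrite !diff_at_iff. intros [q [Hq E]] [q' [Hq' E']].
  exists (fun w => q w * g w + f z * q' w)%C. split.
  - apply cont_at_plus; apply cont_at_mult; auto using cont_at_const.
  - intro w. rewrite (E w), (E' w). ring.
Qed.

Lemma diff_at_ext (f g : C -> C) (z : C) :
  (forall w, f w = g w) -> diff_at f z -> diff_at g z.
Proof. intros E H. replace g with f; auto. now apply functional_extensionality. Qed.

Lemma diff_at_minus (f g : C -> C) (z : C) :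
  diff_at f z -> diff_at g z -> diff_at (fun w => f w - g w)%C z.
Proof.
  intros Hf Hg. apply (diff_at_ext (fun w => f w + RtoC (-1) * g w)%C).
  - intro; ring.
  - apply diff_at_plus; auto. apply diff_at_mult; auto using diff_at_const.
Qed.

Lemma diff_at_inv (f : C -> C) (z : C) :
  f z <> 0%C -> diff_at f z -> diff_at (fun w => / f w)%C z.
Proof.
  intros H0 Hf. assert (Cf := diff_at_cont f z Hf).
  destruct Hf as [l Hl].
  assert (Hf : diff_at f z) by now exists l. clear l Hl.
  rewrite diff_at_iff in Hf. destruct Hf as [q [Hq E]].
  destruct (Cf (Cmod (f z))) as [d [Hd H]]; [now apply Cmod_gt_0|].
  apply diff_at_iff.
  (* The product formula for the slope needs [f w <> 0]. At other zeros of [f] the literal quotient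
     keeps the identity true for every [w]; by continuity none of them lies within [d] of [z]. *)
  exists (fun w => if excluded_middle_informative (f w = 0%C) then (/ f w - / f z) / (w - z)
               else - (q w * / (f w * f z)))%C. split.
  - apply (cont_at_ext_loc (fun w => RtoC (-1) * (q w * / (f w * f z)))%C _ z d Hd).
    + intros w Hw. destruct (excluded_middle_informative (f w = 0%C)) as [N|N].
      * specialize (H w Hw). rewrite N in H.
        replace (0 - f z)%C with (- f z)%C in H by ring. rewrite Cmod_opp in H. lra.
      * ring.
    + apply cont_at_mult; [apply cont_at_const|]. apply cont_at_mult; auto.
      apply cont_at_inv; [now apply Cmult_neq_0|]. apply cont_at_mult; auto using cont_at_const.
  - intro w. destruct (excluded_middle_informative (f w = 0%C)) as [N|N].
    + assert (N' : (w - z)%C <> 0%C) by (apply Cminus_neq_0; now intros ->).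
      (* Here [/ f w] is an inverse of zero, so it is treated as an arbitrary number. *)
      generalize (/ f w)%C (/ f z)%C. intros a b. field. exact N'.
    + assert (X : ((w - z) * q w = f w - f z)%C). { rewrite (E w). ring. }
      replace ((w - z) * - (q w * / (f w * f z)))%C
        with (- (((w - z) * q w) * / (f w * f z)))%C by ring.
      rewrite X. field. auto.
Qed.

Lemma diff_at_ext_loc (f g : C -> C) (z : C) (r : R) :
  r > 0 -> (forall w, Cmod (w - z) < r -> f w = g w) -> diff_at f z -> diff_at g z.
Proof.
  intros Hr E [l Hl]. exists l. intros e He. destruct (Hl e He) as [d [Hd H]].
  exists (Rmin d r). split; [now apply Rmin_glb_lt|]. intros w [Hw1 Hw2].
  rewrite <- (E w), <- (E z).
  - apply H. split; auto. eapply Rlt_le_trans; [exact Hw2 | apply Rmin_l].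
  - now rewrite Cmod_minus_diag.
  - eapply Rlt_le_trans; [exact Hw2 | apply Rmin_r].
Qed.

Lemma diff_at_pow (f : C -> C) (z : C) (n : nat) :
  diff_at f z -> diff_at (fun w => f w ^ n)%C z.
Proof.
  intro H. induction n as [|n IH].
  - exact (diff_at_const (RtoC 1) z).
  - exact (diff_at_mult f (fun w => f w ^ n)%C z H IH).
Qed.

(** * Integrals over rectangles *)

Definition curve_cont (g : R -> C) (t : R) : Prop :=
  continuous (fun s => fst (g s)) t /\ continuous (fun s => snd (g s)) t.

Definition cint (g : R -> C) (a b : R) : C :=
  (RInt (fun t => fst (g t)) a b, RInt (fun t => snd (g t)) a b).

Lemma fst_le_Cmod (z : C) : Rabs (fst z) <= Cmod z.
Proof. eapply Rle_trans; [apply Rmax_l | apply Rmax_Cmod]. Qed.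

Lemma snd_le_Cmod (z : C) : Rabs (snd z) <= Cmod z.
Proof. eapply Rle_trans; [apply Rmax_r | apply Rmax_Cmod]. Qed.

Lemma Cmod_le_sum (z : C) : Cmod z <= Rabs (fst z) + Rabs (snd z).
Proof.
  replace z with (RtoC (fst z) + Ci * RtoC (snd z))%C at 1
    by (destruct z as [x y]; apply injective_projections; simpl; ring).
  eapply Rle_trans; [apply Cmod_triangle|].
  rewrite Cmod_mult, Cmod_Ci, !Cmod_R. lra.
Qed.

Lemma cont_at_curve (h : C -> C) (k : R -> C) (t : R) :
  (forall s, Cmod (k s - k t) <= Rabs (s - t)) ->
  cont_at h (k t) -> curve_cont (fun s => h (k s)) t.
Proof.
  intros Hk Hc. split; apply (proj2 (filterlim_locally _ _)); intros e;
    destruct (Hc e (cond_pos e)) as [d [Hd H]]; exists (mkposreal d Hd);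
    intros s Hs; change (Rabs (s - t) < d) in Hs;
    specialize (H (k s) (Rle_lt_trans _ _ _ (Hk s) Hs)).
  - change (Rabs (fst (h (k s)) - fst (h (k t))) < e).
    eapply Rle_lt_trans; [|exact H]. apply (fst_le_Cmod (h (k s) - h (k t))%C).
  - change (Rabs (snd (h (k s)) - snd (h (k t))) < e).
    eapply Rle_lt_trans; [|exact H]. apply (snd_le_Cmod (h (k s) - h (k t))%C).
Qed.

Lemma cont_at_horizontal (h : C -> C) (x y : R) :
  cont_at h (x, y) -> curve_cont (fun t => h (t, y)) x.
Proof.
  apply (cont_at_curve h (fun t => (t, y)) x). intro s.
  eapply Rle_trans; [apply Cmod_le_sum|]. simpl.
  replace (y + - y) with 0 by ring. rewrite Rabs_R0. unfold Rminus. lra.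
Qed.

Lemma cont_at_vertical (h : C -> C) (x y : R) :
  cont_at h (x, y) -> curve_cont (fun t => h (x, t)) y.
Proof.
  apply (cont_at_curve h (fun t => (x, t)) y). intro s.
  eapply Rle_trans; [apply Cmod_le_sum|]. simpl.
  replace (x + - x) with 0 by ring. rewrite Rabs_R0. unfold Rminus. lra.
Qed.

Lemma curve_cont_ex_RInt (g : R -> C) (a b : R) :
  a <= b -> (forall t, a <= t <= b -> curve_cont g t) ->
  ex_RInt (fun t => fst (g t)) a b /\ ex_RInt (fun t => snd (g t)) a b.
Proof.
  intros Hab H. split; apply (ex_RInt_continuous (V := R_CompleteNormedModule)); intros t Ht;
    rewrite Rmin_left, Rmax_right in Ht by lra; apply (H t Ht).
Qed.

Lemma cint_Chasles (g : R -> C) (a b c : R) :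
  a <= b -> b <= c -> (forall t, a <= t <= c -> curve_cont g t) ->
  cint g a c = (cint g a b + cint g b c)%C.
Proof.
  intros Hab Hbc H.
  destruct (curve_cont_ex_RInt g a b Hab) as [A1 A2]. { intros; apply H; lra. }
  destruct (curve_cont_ex_RInt g b c Hbc) as [B1 B2]. { intros; apply H; lra. }
  unfold cint. apply injective_projections; simpl; symmetry;
    now apply (RInt_Chasles (V := R_CompleteNormedModule)).
Qed.

Lemma cint_ext (g h : R -> C) (a b : R) :
  a <= b -> (forall t, a <= t <= b -> g t = h t) -> cint g a b = cint h a b.
Proof.
  intros Hab H. unfold cint. f_equal; apply RInt_ext; intros t Ht;
    rewrite Rmin_left, Rmax_right in Ht by lra; rewrite H; auto; lra.
Qed.

Lemma cint_linear (g h : R -> C) (k : C) (a b : R) :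
  a <= b -> (forall t, a <= t <= b -> curve_cont g t) ->
  (forall t, a <= t <= b -> curve_cont h t) ->
  cint (fun t => g t + k * h t)%C a b = (cint g a b + k * cint h a b)%C.
Proof.
  intros Hab Hg Hh.
  destruct (curve_cont_ex_RInt g a b Hab Hg) as [A1 A2].
  destruct (curve_cont_ex_RInt h a b Hab Hh) as [B1 B2].
  apply (RInt_correct (V := R_CompleteNormedModule)) in A1, A2, B1, B2.
  destruct k as [p q]. unfold cint. apply injective_projections; simpl;
    apply (is_RInt_unique (V := R_CompleteNormedModule)).
  - apply (is_RInt_plus (V := R_CompleteNormedModule)); auto.
    apply (is_RInt_minus (V := R_CompleteNormedModule));
      now apply (is_RInt_scal (V := R_CompleteNormedModule)).
  - apply (is_RInt_plus (V := R_CompleteNormedModule)); auto.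
    apply (is_RInt_plus (V := R_CompleteNormedModule));
      now apply (is_RInt_scal (V := R_CompleteNormedModule)).
Qed.

(** Estimating the two components separately costs the factor 2. *)
Lemma cint_bound (g : R -> C) (a b M : R) :
  a <= b -> (forall t, a <= t <= b -> curve_cont g t) ->
  (forall t, a <= t <= b -> Cmod (g t) <= M) ->
  Cmod (cint g a b) <= 2 * M * (b - a).
Proof.
  intros Hab Hg HM.
  destruct (curve_cont_ex_RInt g a b Hab Hg) as [A1 A2].
  eapply Rle_trans; [apply Cmod_le_sum|].
  assert (H1 : Rabs (RInt (fun t => fst (g t)) a b) <= (b - a) * M).
  { apply abs_RInt_le_const; auto. intros t Ht.
    eapply Rle_trans; [apply fst_le_Cmod | auto]. }
  assert (H2 : Rabs (RInt (fun t => snd (g t)) a b) <= (b - a) * M).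
  { apply abs_RInt_le_const; auto. intros t Ht.
    eapply Rle_trans; [apply snd_le_Cmod | auto]. }
  simpl. lra.
Qed.

(** The counterclockwise contour integral of [h dz]: [dz] is [dx] on the horizontal sides and [i dy]
    on the vertical ones. *)
Definition rect_int (h : C -> C) (a b c d : R) : C :=
  (cint (fun x => h (x, c)) a b - cint (fun x => h (x, d)) a b
   + Ci * (cint (fun y => h (b, y)) c d - cint (fun y => h (a, y)) c d))%C.

Definition rect_boundary (a b c d : R) (w : C) : Prop :=
  (a <= fst w <= b /\ (snd w = c \/ snd w = d)) \/
  (c <= snd w <= d /\ (fst w = a \/ fst w = b)).

Lemma rect_int_ext (h k : C -> C) (a b c d : R) :
  a <= b -> c <= d -> (forall w, rect_boundary a b c d w -> h w = k w) ->
  rect_int h a b c d = rect_int k a b c d.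
Proof.
  intros Hab Hcd H. unfold rect_int.
  f_equal; [|f_equal]; f_equal; apply cint_ext; auto; intros t Ht; apply H; unfold rect_boundary;
    simpl; tauto.
Qed.

Lemma rect_int_linear (h k : C -> C) (m : C) (a b c d : R) :
  a <= b -> c <= d -> (forall w, rect_boundary a b c d w -> cont_at h w) ->
  (forall w, rect_boundary a b c d w -> cont_at k w) ->
  rect_int (fun w => h w + m * k w)%C a b c d = (rect_int h a b c d + m * rect_int k a b c d)%C.
Proof.
  intros Hab Hcd Hh Hk. unfold rect_int.
  rewrite (cint_linear (fun x => h (x, c)) (fun x => k (x, c)));
  [rewrite (cint_linear (fun x => h (x, d)) (fun x => k (x, d)));
  [rewrite (cint_linear (fun x => h (b, x)) (fun x => k (b, x)));
  [rewrite (cint_linear (fun x => h (a, x)) (fun x => k (a, x))); [ring|..]|..]|..]|..];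
  auto; intros t Ht; (apply cont_at_horizontal || apply cont_at_vertical);
  (apply Hh || apply Hk); unfold rect_boundary; simpl; tauto.
Qed.

Lemma rect_int_bound (h : C -> C) (a b c d M : R) :
  a <= b -> c <= d -> (forall w, rect_boundary a b c d w -> cont_at h w) ->
  (forall w, rect_boundary a b c d w -> Cmod (h w) <= M) ->
  Cmod (rect_int h a b c d) <= 4 * M * ((b - a) + (d - c)).
Proof.
  intros Hab Hcd Hh HM. unfold rect_int, Cminus.
  eapply Rle_trans; [apply Cmod_triangle|]. rewrite Cmod_mult, Cmod_Ci.
  assert (T1 := Cmod_triangle (cint (fun x => h (x, c)) a b) (- cint (fun x => h (x, d)) a b)).
  assert (T2 := Cmod_triangle (cint (fun y => h (b, y)) c d) (- cint (fun y => h (a, y)) c d)).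
  rewrite Cmod_opp in T1, T2.
  assert (B1 : Cmod (cint (fun x => h (x, c)) a b) <= 2 * M * (b - a)).
  { apply cint_bound; auto; intros t Ht; [apply cont_at_horizontal, Hh | apply HM];
    unfold rect_boundary; simpl; tauto. }
  assert (B2 : Cmod (cint (fun x => h (x, d)) a b) <= 2 * M * (b - a)).
  { apply cint_bound; auto; intros t Ht; [apply cont_at_horizontal, Hh | apply HM];
    unfold rect_boundary; simpl; tauto. }
  assert (B3 : Cmod (cint (fun y => h (b, y)) c d) <= 2 * M * (d - c)).
  { apply cint_bound; auto; intros t Ht; [apply cont_at_vertical, Hh | apply HM];
    unfold rect_boundary; simpl; tauto. }
  assert (B4 : Cmod (cint (fun y => h (a, y)) c d) <= 2 * M * (d - c)).
  { apply cint_bound; auto; intros t Ht; [apply cont_at_vertical, Hh | apply HM];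
    unfold rect_boundary; simpl; tauto. }
  lra.
Qed.

Lemma rect_int_split_x (h : C -> C) (a m b c d : R) :
  a <= m -> m <= b ->
  (forall x, a <= x <= b -> cont_at h (x, c) /\ cont_at h (x, d)) ->
  rect_int h a b c d = (rect_int h a m c d + rect_int h m b c d)%C.
Proof.
  intros H1 H2 H. unfold rect_int.
  rewrite (cint_Chasles (fun x => h (x, c)) a m b), (cint_Chasles (fun x => h (x, d)) a m b);
    auto; try (intros; apply cont_at_horizontal, H; auto). ring.
Qed.

Lemma rect_int_split_y (h : C -> C) (a b c m d : R) :
  c <= m -> m <= d ->
  (forall y, c <= y <= d -> cont_at h (a, y) /\ cont_at h (b, y)) ->
  rect_int h a b c d = (rect_int h a b c m + rect_int h a b m d)%C.
Proof.
  intros H1 H2 H. unfold rect_int.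
  rewrite (cint_Chasles (fun x => h (a, x)) c m d), (cint_Chasles (fun x => h (b, x)) c m d);
    auto; try (intros; apply cont_at_vertical, H; auto). ring.
Qed.

Lemma RInt_affine (p q a b : R) :
  RInt (fun x => p + q * x) a b = p * (b - a) + q * (b ^ 2 - a ^ 2) / 2.
Proof.
  apply is_RInt_unique.
  replace (p * (b - a) + q * (b ^ 2 - a ^ 2) / 2)
    with (minus (p * b + q * b ^ 2 / 2) (p * a + q * a ^ 2 / 2))
    by (unfold minus, plus, opp; simpl; field).
  apply (is_RInt_derive (fun x => p * x + q * x ^ 2 / 2)).
  - intros x _. auto_derive; auto. field.
  - intros x _. apply continuity_pt_filterlim. reg.
Qed.

(** Goursat's argument subtracts the first-order approximation of [h]; its contour integral is
    computed side by side here, so that no theory of primitives is needed. *)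
Lemma rect_int_affine (p q : C) (a b c d : R) :
  rect_int (fun w => p + q * w)%C a b c d = 0%C.
Proof.
  destruct p as [p1 p2], q as [q1 q2]. unfold rect_int, cint.
  rewrite (RInt_ext (fun t => fst ((p1, p2) + (q1, q2) * (t, c))%C) (fun t => (p1 - q2 * c) + q1 * t))
    by (intros; simpl; ring).
  rewrite (RInt_ext (fun t => snd ((p1, p2) + (q1, q2) * (t, c))%C) (fun t => (p2 + q1 * c) + q2 * t))
    by (intros; simpl; ring).
  rewrite (RInt_ext (fun t => fst ((p1, p2) + (q1, q2) * (t, d))%C) (fun t => (p1 - q2 * d) + q1 * t))
    by (intros; simpl; ring).
  rewrite (RInt_ext (fun t => snd ((p1, p2) + (q1, q2) * (t, d))%C) (fun t => (p2 + q1 * d) + q2 * t))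
    by (intros; simpl; ring).
  rewrite (RInt_ext (fun t => fst ((p1, p2) + (q1, q2) * (b, t))%C) (fun t => (p1 + q1 * b) + (- q2) * t))
    by (intros; simpl; ring).
  rewrite (RInt_ext (fun t => snd ((p1, p2) + (q1, q2) * (b, t))%C) (fun t => (p2 + q2 * b) + q1 * t))
    by (intros; simpl; ring).
  rewrite (RInt_ext (fun t => fst ((p1, p2) + (q1, q2) * (a, t))%C) (fun t => (p1 + q1 * a) + (- q2) * t))
    by (intros; simpl; ring).
  rewrite (RInt_ext (fun t => snd ((p1, p2) + (q1, q2) * (a, t))%C) (fun t => (p2 + q2 * a) + q1 * t))
    by (intros; simpl; ring).
  rewrite !RInt_affine. apply injective_projections; simpl; field.
Qed.

(** * Goursat's theorem *)

Lemma nested_intervals (u v : nat -> R) :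
  (forall n, u n <= u (S n)) -> (forall n, v (S n) <= v n) -> (forall n, u n <= v n) ->
  exists x, forall n, u n <= x <= v n.
Proof.
  intros Hu Hv Huv.
  assert (Mu : forall k n, u n <= u (n + k)%nat).
  { induction k as [|k IH]; intro n.
    - rewrite Nat.add_0_r. lra.
    - rewrite Nat.add_succ_r. eapply Rle_trans; [apply IH | apply Hu]. }
  assert (Mv : forall k n, v (n + k)%nat <= v n).
  { induction k as [|k IH]; intro n.
    - rewrite Nat.add_0_r. lra.
    - rewrite Nat.add_succ_r. eapply Rle_trans; [apply Hv | apply IH]. }
  assert (B : forall m n, u m <= v n).
  { intros m n. apply Rle_trans with (u (m + n)%nat); [apply Mu|].
    apply Rle_trans with (v (m + n)%nat); [apply Huv|].
    rewrite Nat.add_comm. apply Mv. }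
  destruct (completeness (fun r => exists n, r = u n)) as [x [Hx1 Hx2]].
  - exists (v O). intros r [n ->]. apply B.
  - exists (u O). now exists O.
  - exists x. intro n. split.
    + apply Hx1. now exists n.
    + apply Hx2. intros r [m ->]. apply B.
Qed.

Lemma div_pow2_small (K e : R) : e > 0 -> exists n, K / 2 ^ n < e.
Proof.
  intro He. destruct (pow_lt_1_zero (/ 2)) with (y := e / (Rabs K + 1)) as [N HN].
  - rewrite Rabs_pos_eq; lra.
  - apply Rdiv_lt_0_compat; auto. assert (T := Rabs_pos K). lra.
  - exists N. specialize (HN N (Nat.le_refl N)). assert (T := Rabs_pos K).
    assert (P : 0 < (/ 2) ^ N) by (apply pow_lt; lra).
    rewrite Rabs_pos_eq in HN by lra.
    apply Rlt_div_r in HN; [|lra].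
    unfold Rdiv. rewrite <- pow_inv.
    assert (T2 := Rle_abs K). nra.
Qed.

(** A rectangle where [P] fails has a quarter where [P] fails; iterating yields nested bad
    rectangles that shrink to a point, against the local hypothesis there. This serves as the
    compactness argument both in Goursat's theorem and for uniform continuity on a square. *)
Lemma rect_bisection (P : R -> R -> R -> R -> Prop) (A B C D : R) :
  A <= B -> C <= D ->
  (forall a b c d, A <= a -> a <= b -> b <= B -> C <= c -> c <= d -> d <= D ->
     P a ((a + b) / 2) c ((c + d) / 2) -> P ((a + b) / 2) b c ((c + d) / 2) ->
     P a ((a + b) / 2) ((c + d) / 2) d -> P ((a + b) / 2) b ((c + d) / 2) d -> P a b c d) ->
  (forall x y, A <= x <= B -> C <= y <= D -> exists e, e > 0 /\
     forall a b c d, A <= a -> b <= B -> C <= c -> d <= D -> a <= x <= b -> c <= y <= d ->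
       b - a < e -> d - c < e -> P a b c d) ->
  P A B C D.
Proof.
  intros HAB HCD Hsplit Hloc. apply NNPP. intro N0.
  set (bad := fun q : (R * R) * (R * R) =>
    let '((a, b), (c, d)) := q in
    A <= a /\ a <= b /\ b <= B /\ C <= c /\ c <= d /\ d <= D /\ ~ P a b c d).
  set (half := fun q q' : (R * R) * (R * R) =>
    let '((a, b), (c, d)) := q in let '((a', b'), (c', d')) := q' in
    a <= a' /\ b' <= b /\ c <= c' /\ d' <= d /\ b' - a' = (b - a) / 2 /\ d' - c' = (d - c) / 2).
  (* The implication stands under the existential so that [next] is a total function. *)
  assert (step : forall q, exists q', bad q -> bad q' /\ half q q').
  { intros [[a b] [c d]]. apply NNPP. intro N.
    assert (Hb : bad ((a, b), (c, d))).
    { apply NNPP. intro Nb. apply N. exists ((a, b), (c, d)). intro; contradiction. }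
    destruct Hb as (H1 & H2 & H3 & H4 & H5 & H6 & H7).
    apply H7. apply Hsplit; auto; apply NNPP; intro Q; apply N;
    [ exists ((a, (a + b) / 2), (c, (c + d) / 2)) | exists (((a + b) / 2, b), (c, (c + d) / 2))
    | exists ((a, (a + b) / 2), ((c + d) / 2, d)) | exists (((a + b) / 2, b), ((c + d) / 2, d))];
    intros _; unfold bad, half; repeat split; auto; lra. }
  set (next := fun q => proj1_sig (constructive_indefinite_description _ (step q))).
  assert (Hnext : forall q, bad q -> bad (next q) /\ half q (next q)).
  { intros q. unfold next. now destruct (constructive_indefinite_description _ (step q)). }
  set (s := fun n => Nat.iter n next ((A, B), (C, D))).
  assert (Hbad : forall n, bad (s n)).
  { induction n as [|n IH].
    - unfold s, bad. simpl. repeat split; auto; lra.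
    - apply (Hnext (s n) IH). }
  assert (Hhalf : forall n, half (s n) (s (S n))) by (intro n; apply (Hnext (s n) (Hbad n))).
  assert (Hlen : forall n, snd (fst (s n)) - fst (fst (s n)) = (B - A) / 2 ^ n /\
                           snd (snd (s n)) - fst (snd (s n)) = (D - C) / 2 ^ n).
  { induction n as [|n [I1 I2]].
    - simpl. split; field.
    - specialize (Hhalf n). destruct (s n) as [[a b] [c d]], (s (S n)) as [[a' b'] [c' d']].
      simpl in *. destruct Hhalf as (_ & _ & _ & _ & E1 & E2). rewrite E1, E2, I1, I2.
      split; field; apply pow_nonzero; lra. }
  destruct (nested_intervals (fun n => fst (fst (s n))) (fun n => snd (fst (s n)))) as [x Hx].
  { intro n. specialize (Hhalf n). destruct (s n) as [[a b] [c d]], (s (S n)) as [[a' b'] [c' d']].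
    simpl in *. tauto. }
  { intro n. specialize (Hhalf n). destruct (s n) as [[a b] [c d]], (s (S n)) as [[a' b'] [c' d']].
    simpl in *. tauto. }
  { intro n. specialize (Hbad n). destruct (s n) as [[a b] [c d]]. simpl in *. tauto. }
  destruct (nested_intervals (fun n => fst (snd (s n))) (fun n => snd (snd (s n)))) as [y Hy].
  { intro n. specialize (Hhalf n). destruct (s n) as [[a b] [c d]], (s (S n)) as [[a' b'] [c' d']].
    simpl in *. tauto. }
  { intro n. specialize (Hhalf n). destruct (s n) as [[a b] [c d]], (s (S n)) as [[a' b'] [c' d']].
    simpl in *. tauto. }
  { intro n. specialize (Hbad n). destruct (s n) as [[a b] [c d]]. simpl in *. tauto. }
  destruct (Hloc x y (Hx O) (Hy O)) as [e [He H]].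
  destruct (div_pow2_small (Rmax (B - A) (D - C)) e He) as [n Hn].
  assert (P2 : 0 < 2 ^ n) by (apply pow_lt; lra).
  destruct (Hlen n) as [L1 L2]. specialize (Hx n). specialize (Hy n). specialize (Hbad n).
  assert (M1 : (B - A) / 2 ^ n <= Rmax (B - A) (D - C) / 2 ^ n).
  { apply Rmult_le_compat_r; [left; now apply Rinv_0_lt_compat | apply Rmax_l]. }
  assert (M2 : (D - C) / 2 ^ n <= Rmax (B - A) (D - C) / 2 ^ n).
  { apply Rmult_le_compat_r; [left; now apply Rinv_0_lt_compat | apply Rmax_r]. }
  destruct (s n) as [[a b] [c d]]. simpl in *.
  destruct Hbad as (H1 & H2 & H3 & H4 & H5 & H6 & H7).
  apply H7. apply H; auto; lra.
Qed.

Lemma Goursat (h : C -> C) (a b c d : R) :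
  a <= b -> c <= d ->
  (forall w, a <= fst w <= b -> c <= snd w <= d -> diff_at h w) ->
  rect_int h a b c d = 0%C.
Proof.
  intros Hab Hcd Hd.
  assert (Hc : forall x y, a <= x <= b -> c <= y <= d -> cont_at h (x, y)).
  { intros x y Hx Hy. apply diff_at_cont, Hd; auto. }
  set (K := (b - a) ^ 2 + (d - c) ^ 2).
  assert (HK : 0 <= K) by (unfold K; nra).
  assert (Main : forall e, e > 0 -> Cmod (rect_int h a b c d) <= e * K).
  { intros e He.
    (* The bound is quadratic in the sides, so each quarter has a quarter of it and the four bounds
       add up exactly. *)
    apply (rect_bisection (fun a b c d => Cmod (rect_int h a b c d) <= e * ((b - a) ^ 2 + (d - c) ^ 2)));
      auto.
    - intros a' b' c' d' Ha Hab' Hb Hc1 Hcd' Hd1 H1 H2 H3 H4.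
      rewrite (rect_int_split_x h a' ((a' + b') / 2) b' c' d') by
        (try lra; intros; split; apply Hc; lra).
      rewrite (rect_int_split_y h a' ((a' + b') / 2) c' ((c' + d') / 2) d') by
        (try lra; intros; split; apply Hc; lra).
      rewrite (rect_int_split_y h ((a' + b') / 2) b' c' ((c' + d') / 2) d') by
        (try lra; intros; split; apply Hc; lra).
      eapply Rle_trans; [apply Cmod_triangle|].
      eapply Rle_trans; [apply Rplus_le_compat; apply Cmod_triangle|].
      eapply Rle_trans; [apply Rplus_le_compat; apply Rplus_le_compat; eassumption|].
      right. field.
    - intros x y Hx Hy. specialize (Hd (x, y) Hx Hy).
      apply diff_at_iff in Hd. destruct Hd as [q [Hq E]].
      (* With [s] the sum of the two sides, the integrand is at most [e / 8 * s] and
         [rect_int_bound] gives [e / 2 * s ^ 2]; finally [(x + y) ^ 2 <= 2 * (x ^ 2 + y ^ 2)]. *)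
      destruct (Hq (e / 8)) as [r [Hr H]]; [lra|].
      exists (r / 2). split; [lra|].
      intros a' b' c' d' Ha Hb Hc1 Hd1 Hx' Hy' L1 L2.
      set (p := (x, y)) in *.
      set (k := fun w : C => ((h p - p * q p) + q p * w)%C).
      assert (Bd : forall w, rect_boundary a' b' c' d' w ->
        (a <= fst w <= b) /\ (c <= snd w <= d) /\ Cmod (w - p) <= (b' - a') + (d' - c')).
      { intros w Hw. unfold rect_boundary in Hw. split; [lra|]. split; [lra|].
        eapply Rle_trans; [apply Cmod_le_sum|]. unfold p. simpl.
        assert (Rabs (fst w + - x) <= b' - a') by (apply Rabs_le; lra).
        assert (Rabs (snd w + - y) <= d' - c') by (apply Rabs_le; lra). lra. }
      assert (Ck : forall w, cont_at k w).
      { intro w. apply cont_at_plus; [apply cont_at_const|].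
        apply cont_at_mult; [apply cont_at_const | apply cont_at_id]. }
      assert (Ch : forall w, rect_boundary a' b' c' d' w -> cont_at h w).
      { intros [u v] Hw. apply Bd in Hw. apply Hc; simpl in Hw; tauto. }
      replace (rect_int h a' b' c' d')
        with (rect_int (fun w => h w + RtoC (-1) * k w)%C a' b' c' d').
      2:{ rewrite rect_int_linear; auto; try lra. unfold k. rewrite rect_int_affine. ring. }
      set (s := (b' - a') + (d' - c')).
      assert (Hs : 0 <= s) by (unfold s; lra).
      eapply Rle_trans.
      { apply (rect_int_bound _ _ _ _ _ (e / 8 * s)); try lra.
        - intros w Hw. apply cont_at_plus; auto. apply cont_at_mult; auto using cont_at_const.
        - intros w Hw. destruct (Bd w Hw) as (_ & _ & Hn).
          replace (h w + RtoC (-1) * k w)%C with ((w - p) * (q w - q p))%C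
            by (rewrite (E w); unfold k; ring).
          rewrite Cmod_mult, Rmult_comm. apply Rmult_le_compat; auto using Cmod_ge_0.
          left. apply H. lra. }
      unfold s. assert (T := pow2_ge_0 ((b' - a') - (d' - c'))). nra. }
  apply Cmod_eq_0. apply Rle_antisym; [|apply Cmod_ge_0].
  apply le_epsilon. intros e He.
  specialize (Main (e / (K + 1))).
  assert (P : e / (K + 1) > 0) by (apply Rdiv_lt_0_compat; lra).
  specialize (Main P). eapply Rle_trans; [exact Main|].
  assert (X : e / (K + 1) * (K + 1) = e) by (field; lra).
  nra.
Qed.

(** * Cauchy's formula *)

(** Cutting along the sides of the square leaves four further rectangles. They avoid the point
    [(x, y)], so their integrals vanish by Goursat. *)
Lemma rect_int_shrink (h : C -> C) (a b c d x y s : R) :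
  s > 0 -> a < x - s -> x + s < b -> c < y - s -> y + s < d ->
  (forall w, a <= fst w <= b -> c <= snd w <= d -> w <> (x, y) -> diff_at h w) ->
  rect_int h a b c d = rect_int h (x - s) (x + s) (y - s) (y + s).
Proof.
  intros Hs H1 H2 H3 H4 Hd.
  assert (Hne : forall u v, u <> x \/ v <> y -> (u, v) <> (x, y)).
  { intros u v H E. injection E as E1 E2. destruct H; contradiction. }
  assert (Hc : forall u v, a <= u <= b -> c <= v <= d -> u <> x \/ v <> y -> cont_at h (u, v)).
  { intros. apply diff_at_cont, Hd; auto. }
  assert (Hg : forall a' b' c' d', a <= a' <= b' -> b' <= b -> c <= c' <= d' -> d' <= d ->
    x < a' \/ b' < x \/ y < c' \/ d' < y -> rect_int h a' b' c' d' = 0%C).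
  { intros. apply Goursat; try lra. intros [u v] Hu Hv; simpl in *.
    apply Hd; simpl; try lra. apply Hne. lra. }
  rewrite (rect_int_split_x h a (x - s) b c d) by (try lra; intros; split; apply Hc; lra).
  rewrite (rect_int_split_x h (x - s) (x + s) b c d) by (try lra; intros; split; apply Hc; lra).
  rewrite (rect_int_split_y h (x - s) (x + s) c (y - s) d) by (try lra; intros; split; apply Hc; lra).
  rewrite (rect_int_split_y h (x - s) (x + s) (y - s) (y + s) d)
    by (try lra; intros; split; apply Hc; lra).
  rewrite (Hg a (x - s)), (Hg (x + s) b), (Hg _ _ c (y - s)), (Hg _ _ (y + s) d) by lra.
  ring.
Qed.

Lemma sum_sqr_pos (u s : R) : s > 0 -> 0 < u ^ 2 + s ^ 2.
Proof. intro Hs. assert (H := pow2_ge_0 u). assert (K := pow_lt s 2 Hs). lra. Qed.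

Lemma RInt_atan (x s : R) :
  s > 0 -> RInt (fun t => s / ((t - x) ^ 2 + s ^ 2)) (x - s) (x + s) = PI / 2.
Proof.
  intro Hs. apply is_RInt_unique.
  assert (Hp : forall t, 0 < (t - x) ^ 2 + s ^ 2) by (intro; now apply sum_sqr_pos).
  replace (PI / 2) with (minus (atan ((x + s - x) / s)) (atan ((x - s - x) / s))).
  - apply (is_RInt_derive (fun t => atan ((t - x) / s))).
    + intros t _. specialize (Hp t). auto_derive; [auto|]. field.
      split; lra.
    + intros t _. specialize (Hp t). apply continuity_pt_filterlim. reg. simpl in *; lra.
  - replace ((x + s - x) / s) with 1 by (field; lra).
    replace ((x - s - x) / s) with (- (1)) by (field; lra).
    unfold minus, plus, opp; simpl. rewrite atan_opp, atan_1. field.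
Qed.

(** Each side contributes [i * PI / 2], an arctangent integral; the other components on opposite
    sides are equal and cancel. *)
Lemma rect_int_inv (x y s : R) :
  s > 0 ->
  rect_int (fun w => / (w - (x, y)))%C (x - s) (x + s) (y - s) (y + s) = (Ci * RtoC (2 * PI))%C.
Proof.
  intro Hs. assert (Hp : forall t u, 0 < (t - u) ^ 2 + s ^ 2) by (intros; now apply sum_sqr_pos).
  unfold rect_int, cint.
  rewrite (RInt_ext (fun t => snd (/ ((t, y - s)%R - (x, y)))%C)
             (fun t => s / ((t - x) ^ 2 + s ^ 2))).
  2:{ intros t _. specialize (Hp t x). simpl. field; repeat split; apply Rgt_not_eq; nra. }
  rewrite (RInt_ext (fun t => snd (/ ((t, y + s)%R - (x, y)))%C)
             (fun t => scal (-1) (s / ((t - x) ^ 2 + s ^ 2)))).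
  2:{ intros t _. specialize (Hp t x). simpl. unfold scal; simpl; unfold mult; simpl.
      field; repeat split; apply Rgt_not_eq; nra. }
  rewrite (RInt_ext (fun t => fst (/ ((x + s, t)%R - (x, y)))%C)
             (fun t => s / ((t - y) ^ 2 + s ^ 2))).
  2:{ intros t _. specialize (Hp t y). simpl. field; repeat split; apply Rgt_not_eq; nra. }
  rewrite (RInt_ext (fun t => fst (/ ((x - s, t)%R - (x, y)))%C)
             (fun t => scal (-1) (s / ((t - y) ^ 2 + s ^ 2)))).
  2:{ intros t _. specialize (Hp t y). simpl. unfold scal; simpl; unfold mult; simpl.
      field; repeat split; apply Rgt_not_eq; nra. }
  rewrite (RInt_ext (fun t => fst (/ ((t, y + s)%R - (x, y)))%C)
             (fun t => fst (/ ((t, y - s)%R - (x, y)))%C)).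
  2:{ intros t _. specialize (Hp t x). simpl. field; repeat split; apply Rgt_not_eq; nra. }
  rewrite (RInt_ext (fun t => snd (/ ((x + s, t)%R - (x, y)))%C)
             (fun t => snd (/ ((x - s, t)%R - (x, y)))%C)).
  2:{ intros t _. specialize (Hp t y). simpl. field; repeat split; apply Rgt_not_eq; nra. }
  assert (Hex : forall u, ex_RInt (fun t => s / ((t - u) ^ 2 + s ^ 2)) (u - s) (u + s)).
  { intro u. apply (ex_RInt_continuous (V := R_CompleteNormedModule)). intros t _.
    specialize (Hp t u). apply continuity_pt_filterlim. reg. simpl in *; lra. }
  rewrite !(RInt_scal (V := R_CompleteNormedModule)) by apply Hex.
  rewrite !RInt_atan by auto.
  apply injective_projections; simpl; unfold scal; simpl; unfold mult; simpl; field.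
Qed.

Lemma Cmod_sqr (z : C) : Cmod z ^ 2 = fst z ^ 2 + snd z ^ 2.
Proof. apply Cmod2_alt. Qed.

Lemma Cmod_two_pi_i_bound : 4 <= Cmod (Ci * RtoC (2 * PI)).
Proof.
  rewrite Cmod_mult, Cmod_Ci, Cmod_R. assert (H := PI2_1). rewrite Rabs_pos_eq; lra.
Qed.

Lemma two_pi_i_neq_0 : (Ci * RtoC (2 * PI))%C <> 0%C.
Proof. apply Cmod_gt_0. assert (H := Cmod_two_pi_i_bound). lra. Qed.

Lemma rect_boundary_neq (a b c d : R) (z w : C) :
  a < fst z < b -> c < snd z < d -> rect_boundary a b c d w -> w <> z.
Proof. intros H1 H2 Hw ->. unfold rect_boundary in Hw. lra. Qed.

Lemma diff_at_inv_sub (z w : C) : w <> z -> diff_at (fun u => / (u - z))%C w.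
Proof.
  intro H. apply (diff_at_inv (fun u => u - z)%C); [now apply Cminus_neq_0|].
  apply (diff_at_minus (fun u => u) (fun _ => z)); [apply diff_at_id | apply diff_at_const].
Qed.

Lemma diff_at_quotient (F q : C -> C) (z w : C) :
  (forall u, F u = F z + (u - z) * q u)%C -> w <> z -> diff_at F w -> diff_at q w.
Proof.
  intros E N Hd.
  apply (diff_at_ext_loc (fun u => (F u - F z) * / (u - z))%C q w (Cmod (w - z))).
  - now apply Cmod_minus_gt_0.
  - intros u Hu. rewrite (E u). field. apply Cminus_neq_0. intros ->.
    rewrite Cmod_minus_sym in Hu. lra.
  - apply diff_at_mult; [|now apply diff_at_inv_sub].
    apply (diff_at_minus F (fun _ => F z)); auto. apply diff_at_const.
Qed.

(** Write [F w = F z + (w - z) * q w]. The slope [q] is differentiable off [z] and bounded near [z],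
    so shrinking the contour around [z] shows that its integral is zero. What remains is [F z] times
    the integral of [1 / (w - z)]. *)
Lemma Cauchy_formula (F : C -> C) (a b c d : R) (z : C) :
  a < fst z < b -> c < snd z < d ->
  (forall w, a <= fst w <= b -> c <= snd w <= d -> diff_at F w) ->
  rect_int (fun w => F w * / (w - z))%C a b c d = (Ci * RtoC (2 * PI) * F z)%C.
Proof.
  intros Hx Hy Hd. destruct z as [x y]. simpl in Hx, Hy. set (z := (x, y)) in *.
  assert (Hdz : diff_at F z) by (apply Hd; simpl; lra).
  apply diff_at_iff in Hdz. destruct Hdz as [q [Hq E]].
  assert (Dq : forall w, a <= fst w <= b -> c <= snd w <= d -> w <> z -> diff_at q w).
  { intros w H1 H2 N. apply (diff_at_quotient F q z); auto. }
  assert (Di : forall w, w <> z -> diff_at (fun u => / (u - z))%C w) by apply diff_at_inv_sub.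
  set (g := Rmin (Rmin (x - a) (b - x)) (Rmin (y - c) (d - y))).
  assert (Hg : 0 < g) by (unfold g; repeat apply Rmin_glb_lt; lra).
  assert (G1 := Rmin_l (Rmin (x - a) (b - x)) (Rmin (y - c) (d - y))).
  assert (G2 := Rmin_r (Rmin (x - a) (b - x)) (Rmin (y - c) (d - y))).
  assert (G3 := Rmin_l (x - a) (b - x)). assert (G4 := Rmin_r (x - a) (b - x)).
  assert (G5 := Rmin_l (y - c) (d - y)). assert (G6 := Rmin_r (y - c) (d - y)).
  fold g in G1, G2.
  assert (I1 : rect_int (fun w => / (w - z))%C a b c d = (Ci * RtoC (2 * PI))%C).
  { rewrite (rect_int_shrink _ a b c d x y (g / 2)); try lra.
    - apply rect_int_inv. lra.
    - intros; apply Di; auto. }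
  assert (I2 : rect_int q a b c d = 0%C).
  { apply Cmod_eq_0. apply Rle_antisym; [|apply Cmod_ge_0].
    apply le_epsilon. intros e He.
    destruct (Hq 1) as [r [Hr Hq1]]; [lra|].
    set (M := Cmod (q z) + 1). assert (HM : 0 < M) by (unfold M; assert (T := Cmod_ge_0 (q z)); lra).
    (* The square of half-side [s] gives the bound [4 * M * (4 * s)], hence the divisor 16. *)
    set (s := Rmin (Rmin g r) (e / M) / 16).
    assert (HeM : 0 < e / M) by now apply Rdiv_lt_0_compat.
    assert (Hs : 0 < Rmin (Rmin g r) (e / M)) by (repeat apply Rmin_glb_lt; lra).
    assert (S1 := Rmin_l (Rmin g r) (e / M)). assert (S2 := Rmin_r (Rmin g r) (e / M)).
    assert (S3 := Rmin_l g r). assert (S4 := Rmin_r g r).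
    assert (Hs0 : s > 0) by (unfold s; lra).
    rewrite (rect_int_shrink q a b c d x y s); try (unfold s; lra); [|exact Dq].
    eapply Rle_trans.
    { apply (rect_int_bound _ _ _ _ _ M); try lra.
      - intros w Hw. apply diff_at_cont.
        assert (w <> z) by (apply (rect_boundary_neq _ _ _ _ z w) in Hw; simpl; auto; lra).
        unfold rect_boundary in Hw. apply Dq; auto; unfold s in *; lra.
      - intros w Hw. replace (q w) with (q z + (q w - q z))%C by ring.
        eapply Rle_trans; [apply Cmod_triangle|]. unfold M. apply Rplus_le_compat_l.
        left. apply Hq1. eapply Rle_lt_trans; [apply Cmod_le_sum|]. unfold z. simpl.
        unfold rect_boundary in Hw.
        assert (Rabs (fst w + - x) <= s) by (apply Rabs_le; lra).
        assert (Rabs (snd w + - y) <= s) by (apply Rabs_le; lra). unfold s in *. lra. }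
    assert (X : s * M <= e / 16).
    { replace (e / 16) with (e / M / 16 * M) by (field; lra).
      apply Rmult_le_compat_r; unfold s; lra. }
    nra. }
  rewrite (rect_int_ext _ (fun w => q w + F z * / (w - z))%C); try lra.
  - rewrite rect_int_linear; try lra.
    + rewrite I1, I2. ring.
    + intros w Hw. apply diff_at_cont, Dq.
      * unfold rect_boundary in Hw; lra.
      * unfold rect_boundary in Hw; lra.
      * eapply rect_boundary_neq; [..|exact Hw]; simpl; lra.
    + intros w Hw. apply diff_at_cont, Di.
      eapply rect_boundary_neq; [..|exact Hw]; simpl; lra.
  - intros w Hw. rewrite (E w). field. apply Cminus_neq_0.
    eapply rect_boundary_neq; [..|exact Hw]; simpl; lra.
Qed.

(** Differentiation under the integral sign. By [1 / (w - u) - 1 / (w - z) = (u - z) / ((w - u) * (w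
    - z))] the slope of the integral at [z] is [Q], and the same identity applied once more shows
    that [Q] satisfies a Lipschitz estimate at [z]. *)
Lemma Cauchy_integral_diff (p : C -> C) (a b c d M m : R) (z : C) :
  a <= b -> c <= d -> m > 0 ->
  (forall w, rect_boundary a b c d w -> cont_at p w /\ Cmod (p w) <= M /\ m <= Cmod (w - z)) ->
  diff_at (fun u => rect_int (fun w => p w * / (w - u))%C a b c d) z.
Proof.
  intros Hab Hcd Hm H.
  set (G := fun u => rect_int (fun w => p w * / (w - u))%C a b c d).
  set (Q := fun u => rect_int (fun w => p w * (/ (w - u) * / (w - z)))%C a b c d).
  assert (HM : forall w, rect_boundary a b c d w -> 0 <= M).
  { intros w Hw. destruct (H w Hw) as (_ & H1 & _). assert (T := Cmod_ge_0 (p w)). lra. }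
  assert (HM0 : 0 <= M).
  { apply (HM (a, c)). unfold rect_boundary. simpl. lra. }
  assert (Far : forall u w, Cmod (u - z) < m / 2 -> rect_boundary a b c d w ->
    m / 2 <= Cmod (w - u)).
  { intros u w Hu Hw. destruct (H w Hw) as (_ & _ & H1).
    assert (T := Cmod_minus_triangle w u z). lra. }
  assert (Zz : Cmod (z - z) < m / 2) by (rewrite Cmod_minus_diag; lra).
  assert (Ne : forall u w, Cmod (u - z) < m / 2 -> rect_boundary a b c d w -> w <> u).
  { intros u w Hu Hw ->. assert (T := Far u u Hu Hw). rewrite Cmod_minus_diag in T. lra. }
  assert (Ci : forall u w, Cmod (u - z) < m / 2 -> rect_boundary a b c d w ->
     cont_at (fun w => / (w - u))%C w).
  { intros u w Hu Hw. apply diff_at_cont, diff_at_inv_sub. now apply Ne. }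
  assert (E : forall u, Cmod (u - z) < m / 2 -> G u = (G z + (u - z) * Q u)%C).
  { intros u Hu. unfold G, Q. rewrite <- rect_int_linear; auto.
    - apply rect_int_ext; auto. intros w Hw.
      assert (N1 := Cminus_neq_0 _ _ (Ne u w Hu Hw)). assert (N2 := Cminus_neq_0 _ _ (Ne z w Zz Hw)).
      field. split; assumption.
    - intros w Hw. apply cont_at_mult; [apply H | apply Ci]; auto.
    - intros w Hw. apply cont_at_mult; [apply H; auto|]. apply cont_at_mult; apply Ci; auto. }
  set (K := 4 * (M * (2 / m * (/ m * / m))) * (b - a + (d - c))).
  assert (Him : 0 < / m) by now apply Rinv_0_lt_compat.
  assert (HK : 0 <= K).
  { unfold K. apply Rmult_le_pos; [|lra]. apply Rmult_le_pos; [lra|].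
    apply Rmult_le_pos; [lra|]. unfold Rdiv. repeat apply Rmult_le_pos; lra. }
  assert (B : forall u, Cmod (u - z) < m / 2 -> Cmod (Q u - Q z) <= Cmod (u - z) * K).
  { intros u Hu.
    set (T := rect_int (fun w => p w * (/ (w - u) * (/ (w - z) * / (w - z))))%C a b c d).
    assert (ET : Q u = (Q z + (u - z) * T)%C).
    { unfold Q, T. rewrite <- rect_int_linear; auto.
      - apply rect_int_ext; auto. intros w Hw.
        assert (N1 := Cminus_neq_0 _ _ (Ne u w Hu Hw)). assert (N2 := Cminus_neq_0 _ _ (Ne z w Zz Hw)).
        field. split; assumption.
      - intros w Hw. apply cont_at_mult; [apply H; auto|]. apply cont_at_mult; apply Ci; auto.
      - intros w Hw. apply cont_at_mult; [apply H; auto|].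
        apply cont_at_mult; [apply Ci; auto|]. apply cont_at_mult; apply Ci; auto. }
    rewrite ET. replace (Q z + (u - z) * T - Q z)%C with ((u - z) * T)%C by ring.
    rewrite Cmod_mult. apply Rmult_le_compat_l; [apply Cmod_ge_0|].
    apply rect_int_bound; auto.
    - intros w Hw. apply cont_at_mult; [apply H; auto|].
      apply cont_at_mult; [apply Ci; auto|]. apply cont_at_mult; apply Ci; auto.
    - intros w Hw.
      assert (N1 := Cminus_neq_0 _ _ (Ne u w Hu Hw)). assert (N2 := Cminus_neq_0 _ _ (Ne z w Zz Hw)).
      destruct (H w Hw) as (_ & HMw & Hmw).
      assert (Iu : Cmod (/ (w - u)) <= 2 / m).
      { rewrite Cmod_inv by auto. replace (2 / m) with (/ (m / 2)) by (field; lra).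
        apply Rinv_le_contravar; [lra | now apply Far]. }
      assert (Iz : Cmod (/ (w - z)) <= / m).
      { rewrite Cmod_inv by auto. now apply Rinv_le_contravar. }
      rewrite !Cmod_mult.
      repeat first [assumption | apply Rmult_le_compat | apply Rmult_le_pos | apply Cmod_ge_0]. }
  apply diff_at_iff.
  (* The identity [E] holds only for [u] away from the contour; elsewhere the plain difference
     quotient serves. *)
  exists (fun u => if Rlt_dec (Cmod (u - z)) (m / 2) then Q u else ((G u - G z) / (u - z))%C).
  split.
  - apply (cont_at_ext_loc Q _ z (m / 2)); [lra| |].
    + intros u Hu. now destruct (Rlt_dec (Cmod (u - z)) (m / 2)).
    + intros e He. exists (Rmin (m / 2) (e / (K + 1))).
      assert (P : 0 < e / (K + 1)) by (apply Rdiv_lt_0_compat; lra).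
      split; [apply Rmin_glb_lt; lra|]. intros u Hu.
      assert (H1 := Rlt_le_trans _ _ _ Hu (Rmin_l _ _)).
      assert (H2 := Rlt_le_trans _ _ _ Hu (Rmin_r _ _)).
      eapply Rle_lt_trans; [now apply B|]. apply Rlt_div_r in H2; [|lra].
      assert (T := Cmod_ge_0 (u - z)). nra.
  - intro u. destruct (Rlt_dec (Cmod (u - z)) (m / 2)) as [Hu|Hu]; [now apply E|].
    fold (G u) (G z). field. apply Cminus_neq_0. intros ->. contradiction.
Qed.

(** * Difference quotients and Taylor expansions *)

Lemma square_in_disc (c w : C) (r : R) :
  r > 0 -> fst c - r / 2 <= fst w <= fst c + r / 2 ->
  snd c - r / 2 <= snd w <= snd c + r / 2 -> Cmod (w - c) < r.
Proof.
  intros Hr H1 H2. apply Rsqr_incrst_0; [|apply Cmod_ge_0|lra].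
  rewrite !Rsqr_pow2, Cmod_sqr. simpl (fst _). simpl (snd _).
  assert (A : (fst w + - fst c) ^ 2 <= (r / 2) ^ 2).
  { rewrite <- !Rsqr_pow2. apply Rsqr_le_abs_1. rewrite (Rabs_pos_eq (r / 2)) by lra.
    apply Rabs_le. lra. }
  assert (B : (snd w + - snd c) ^ 2 <= (r / 2) ^ 2).
  { rewrite <- !Rsqr_pow2. apply Rsqr_le_abs_1. rewrite (Rabs_pos_eq (r / 2)) by lra.
    apply Rabs_le. lra. }
  assert (0 < r ^ 2) by (apply pow_lt; lra). nra.
Qed.

(** The square of side [r] contains the disc of radius [r / 2] and lies in that of radius [r], so
    contour integrals can be used under hypotheses on discs. *)
Definition on_square (c : C) (r : R) (w : C) : Prop :=
  rect_boundary (fst c - r / 2) (fst c + r / 2) (snd c - r / 2) (snd c + r / 2) w.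

Definition square_int (h : C -> C) (c : C) (r : R) : C :=
  rect_int h (fst c - r / 2) (fst c + r / 2) (snd c - r / 2) (snd c + r / 2).

Lemma on_square_dist (c w : C) (r : R) :
  r > 0 -> on_square c r w -> r / 2 <= Cmod (w - c) < r.
Proof.
  intros Hr Hw. unfold on_square, rect_boundary in Hw. split.
  - assert (A := fst_le_Cmod (w - c)). assert (B := snd_le_Cmod (w - c)).
    simpl in A, B. apply Rabs_le_between in A. apply Rabs_le_between in B. lra.
  - apply square_in_disc; auto; lra.
Qed.

Lemma half_disc_in_square (c z : C) (r : R) :
  Cmod (z - c) < r / 2 ->
  fst c - r / 2 < fst z < fst c + r / 2 /\ snd c - r / 2 < snd z < snd c + r / 2.
Proof.
  intro H. assert (A := fst_le_Cmod (z - c)). assert (B := snd_le_Cmod (z - c)).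
  simpl in A, B. apply Rabs_le_between in A. apply Rabs_le_between in B. lra.
Qed.

Lemma Cauchy_formula_square (F : C -> C) (c z : C) (r : R) :
  (forall w, Cmod (w - c) < r -> diff_at F w) -> Cmod (z - c) < r / 2 ->
  square_int (fun w => F w * / (w - z))%C c r = (Ci * RtoC (2 * PI) * F z)%C.
Proof.
  intros Hd Hz. assert (T := Cmod_ge_0 (z - c)).
  destruct (half_disc_in_square c z r Hz) as [H1 H2].
  apply Cauchy_formula; auto. intros w A B. apply Hd. apply square_in_disc; lra.
Qed.

Lemma square_int_bound (h : C -> C) (c : C) (r M : R) :
  r > 0 -> (forall w, on_square c r w -> cont_at h w) ->
  (forall w, on_square c r w -> Cmod (h w) <= M) -> Cmod (square_int h c r) <= 8 * M * r.
Proof.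
  intros Hr Hc HM. eapply Rle_trans; [apply (rect_int_bound _ _ _ _ _ M); auto; lra|].
  right. field.
Qed.

(** A maximum principle with a lossy constant: the square contour lies in the annulus, and its
    integral, at most [16 * M], is divided by [2 * PI >= 4]. Applied to [1 / F] it will force [F] to
    have a zero. *)
Lemma mean_value_bound (G : C -> C) (c : C) (r M : R) :
  r > 0 -> (forall z, Cmod (z - c) < r -> diff_at G z) ->
  (forall z, r / 2 <= Cmod (z - c) < r -> Cmod (G z) <= M) -> Cmod (G c) <= 4 * M.
Proof.
  intros Hr Hd HM.
  assert (E := Cauchy_formula_square G c c r Hd).
  rewrite Cmod_minus_diag in E. specialize (E ltac:(lra)).
  assert (Ne : forall w, on_square c r w -> w <> c).
  { intros w Hw ->. apply on_square_dist in Hw; auto. rewrite Cmod_minus_diag in Hw. lra. }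
  assert (B : Cmod (square_int (fun w => G w * / (w - c))%C c r) <= 8 * (M * (2 / r)) * r).
  { apply square_int_bound; auto.
    - intros w Hw. apply cont_at_mult; apply diff_at_cont.
      + apply Hd. now apply on_square_dist.
      + apply diff_at_inv_sub. auto.
    - intros w Hw. destruct (on_square_dist c w r Hr Hw) as [H1 H2].
      rewrite Cmod_mult. apply Rmult_le_compat; auto using Cmod_ge_0.
      rewrite Cmod_inv by (apply Cminus_neq_0; auto).
      replace (2 / r) with (/ (r / 2)) by (field; lra). apply Rinv_le_contravar; lra. }
  rewrite E, Cmod_mult in B. assert (P := Cmod_two_pi_i_bound).
  replace (8 * (M * (2 / r)) * r) with (16 * M) in B by (field; lra).
  assert (T := Cmod_ge_0 (G c)). nra.
Qed.

(** The equation determines the quotient off [a], continuity determines it at [a]. Being total, the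
    operation can be iterated to produce Taylor coefficients. *)
Definition dquot (F : C -> C) (a : C) : C -> C :=
  epsilon (inhabits (fun _ => RtoC 0))
    (fun q => cont_at q a /\ forall w, F w = (F a + (w - a) * q w)%C).

Lemma dquot_spec (F : C -> C) (a : C) :
  diff_at F a -> cont_at (dquot F a) a /\ forall w, F w = (F a + (w - a) * dquot F a w)%C.
Proof.
  intro H. apply diff_at_iff in H. exact (epsilon_spec (inhabits (fun _ : C => RtoC 0)) _ H).
Qed.

Lemma dquot_eq (F : C -> C) (a : C) :
  diff_at F a -> forall w, F w = (F a + (w - a) * dquot F a w)%C.
Proof. intro H. now apply dquot_spec. Qed.

(* Off [a] the quotient is an honest quotient; near [a] it equals the Cauchy
   integral of [F w / (w - a)], which is differentiable. *)
Lemma dquot_diff_bound (F : C -> C) (c a : C) (r M : R) :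
  r > 0 -> Cmod (a - c) <= r / 4 ->
  (forall z, Cmod (z - c) < r -> diff_at F z) ->
  (forall z, Cmod (z - c) < r -> Cmod (F z) <= M) ->
  forall z, Cmod (z - c) < r -> diff_at (dquot F a) z /\ Cmod (dquot F a z) <= M * (64 / r).
Proof.
  intros Hr Ha Hd HM.
  assert (Da : diff_at F a) by (apply Hd; lra).
  destruct (dquot_spec F a Da) as [Cq E]. set (q := dquot F a) in *.
  assert (HM0 : 0 <= M).
  { eapply Rle_trans; [apply Cmod_ge_0 | apply (HM a)]. lra. }
  assert (Sq : forall w, on_square c r w -> r / 4 <= Cmod (w - a)).
  { intros w Hw. apply on_square_dist in Hw; auto.
    assert (T := Cmod_minus_triangle w a c). lra. }
  assert (Na : forall w, on_square c r w -> w <> a).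
  { intros w Hw ->. apply Sq in Hw. rewrite Cmod_minus_diag in Hw. lra. }
  set (p := fun w => (F w * / (w - a))%C).
  assert (Cp : forall w, on_square c r w -> cont_at p w).
  { intros w Hw. apply cont_at_mult; apply diff_at_cont.
    - apply Hd. now apply on_square_dist.
    - apply diff_at_inv_sub. auto. }
  assert (Bp : forall w, on_square c r w -> Cmod (p w) <= M * (4 / r)).
  { intros w Hw. unfold p. rewrite Cmod_mult. apply Rmult_le_compat; auto using Cmod_ge_0.
    - apply HM. now apply on_square_dist.
    - rewrite Cmod_inv by (apply Cminus_neq_0; auto).
      replace (4 / r) with (/ (r / 4)) by (field; lra). apply Rinv_le_contravar; auto; lra. }
  set (J := (Ci * RtoC (2 * PI))%C). assert (NJ : J <> 0%C) by apply two_pi_i_neq_0.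
  assert (BJ : 4 <= Cmod J) by apply Cmod_two_pi_i_bound.
  set (G := fun z => (/ J * square_int (fun w => p w * / (w - z)) c r)%C).
  assert (Far : forall z w, Cmod (z - c) < r / 2 -> on_square c r w ->
     r / 2 - Cmod (z - c) <= Cmod (w - z) /\ w <> z).
  { intros z w Hz Hw. apply on_square_dist in Hw; auto.
    assert (T := Cmod_minus_triangle w z c). split; [lra|].
    intros ->. rewrite Cmod_minus_diag in T. lra. }
  assert (DG : forall z, Cmod (z - c) < r / 2 -> diff_at G z).
  { intros z Hz. apply diff_at_mult; [apply diff_at_const|].
    apply (Cauchy_integral_diff p _ _ _ _ (M * (4 / r)) (r / 2 - Cmod (z - c))); try lra.
    intros w Hw. repeat split; [now apply Cp | now apply Bp | now apply Far]. }
  assert (Eq : forall z, Cmod (z - c) < r / 2 -> z <> a -> q z = G z).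
  { intros z Hz Nz. assert (Nz' := Cminus_neq_0 _ _ Nz).
    assert (X : square_int (fun w => p w * / (w - z))%C c r = (J * q z)%C).
    (* Cauchy's formula at [z] and at [a], combined through the partial fractions [1 / (w - z) = 1 /
       (w - a) + (z - a) / ((w - a) * (w - z))]. *)
    { assert (Y : (J * F z = J * F a
                   + (z - a) * square_int (fun w => p w * / (w - z)) c r)%C).
      { unfold J. rewrite <- (Cauchy_formula_square F c z r), <- (Cauchy_formula_square F c a r)
          by (auto; lra).
        unfold square_int. rewrite <- rect_int_linear; try lra.
        - apply rect_int_ext; try lra. intros w Hw. unfold p.
          destruct (Far z w Hz Hw) as [_ N1]. assert (N2 := Na w Hw).
          apply Cminus_neq_0 in N1. apply Cminus_neq_0 in N2. field. auto.
        - intros w Hw. apply (Cp w Hw).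
        - intros w Hw. apply cont_at_mult; [now apply Cp|].
          apply diff_at_cont, diff_at_inv_sub. now apply (Far z w). }
      rewrite (E z) in Y.
      assert (Y' : ((z - a) * (J * q z) = (z - a) * square_int (fun w => p w * / (w - z)) c r)%C).
      { replace ((z - a) * (J * q z))%C with (J * (F a + (z - a) * q z) - J * F a)%C by ring.
        rewrite Y. ring. }
      replace (square_int (fun w => p w * / (w - z))%C c r)
        with (/ (z - a) * ((z - a) * square_int (fun w => p w * / (w - z)) c r))%C by (field; auto).
      rewrite <- Y'. field. auto. }
    unfold G. rewrite X. field. auto. }
  assert (Ha2 : Cmod (a - c) < r / 2) by lra.
  assert (Ea : q a = G a).
  { apply (cont_at_limit_unique q G a (r / 4)); [lra| |auto|].
    - intros w Hw. apply Eq.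
      + assert (T := Cmod_minus_triangle w a c). lra.
      + intros ->. rewrite Cmod_minus_diag in Hw. lra.
    - apply diff_at_cont. auto. }
  assert (Eq' : forall z, Cmod (z - c) < r / 2 -> q z = G z).
  { intros z Hz. destruct (classic (z = a)) as [->|N]; auto. }
  intros z Hz. split.
  - destruct (classic (z = a)) as [->|N].
    + apply (diff_at_ext_loc G q a (r / 4)); auto; [lra|].
      intros w Hw. symmetry. apply Eq'. assert (T := Cmod_minus_triangle w a c). lra.
    + apply (diff_at_quotient F q a z); auto.
  (* Inside this radius [z] is at least [r / 8] from the contour and the Cauchy integral is
     estimated; outside it [z] is at least [r / 8] from [a] and the quotient itself is. *)
  - destruct (Rlt_dec (Cmod (z - c)) (3 * r / 8)) as [H|H].
    + rewrite Eq' by lra. unfold G. rewrite Cmod_mult, Cmod_inv by auto.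
      assert (B : Cmod (square_int (fun w => p w * / (w - z))%C c r)
                  <= 8 * (M * (4 / r) * (8 / r)) * r).
      { apply square_int_bound; auto.
        - intros w Hw. apply cont_at_mult; [now apply Cp|].
          apply diff_at_cont, diff_at_inv_sub. apply (Far z w); auto; lra.
        - intros w Hw. destruct (Far z w ltac:(lra) Hw) as [H1 H2].
          rewrite Cmod_mult. apply Rmult_le_compat; auto using Cmod_ge_0.
          rewrite Cmod_inv by (apply Cminus_neq_0; auto).
          replace (8 / r) with (/ (r / 8)) by (field; lra). apply Rinv_le_contravar; lra. }
      replace (8 * (M * (4 / r) * (8 / r)) * r) with (4 * (M * (64 / r))) in B by (field; lra).
      apply Rle_trans with (/ 4 * (4 * (M * (64 / r)))); [|right; field; lra].
      apply Rmult_le_compat; auto using Cmod_ge_0.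
      * left. apply Rinv_0_lt_compat. lra.
      * apply Rinv_le_contravar; lra.
    + assert (T := Cmod_minus_triangle z a c).
      assert (Nz : z <> a) by (intros ->; lra).
      assert (X : q z = ((F z - F a) / (z - a))%C).
      { rewrite (E z). field. now apply Cminus_neq_0. }
      rewrite X. rewrite Cmod_div by now apply Cminus_neq_0.
      assert (T2 := Cmod_triangle (F z) (- F a)). rewrite Cmod_opp in T2.
      assert (M1 := HM z Hz). assert (M2 := HM a ltac:(lra)).
      unfold Rdiv at 1.
      apply Rle_trans with (2 * M * (8 / r)).
      * apply Rmult_le_compat; auto using Cmod_ge_0.
        -- left. apply Rinv_0_lt_compat. lra.
        -- unfold Cminus. lra.
        -- replace (8 / r) with (/ (r / 8)) by (field; lra). apply Rinv_le_contravar; lra.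
      * assert (0 < / r) by now apply Rinv_0_lt_compat. unfold Rdiv. nra.
Qed.

Fixpoint psum (a : nat -> C) (w : C) (N : nat) : C :=
  match N with O => 0%C | S n => (psum a w n + a n * w ^ n)%C end.

(** The coefficients are the values at [c] of the iterated difference quotients; each quotient costs
    a factor [64 / s] but no part of the disc. The estimates hold for every smaller [s] with the
    same coefficients: the oscillation argument bounds the coefficients on a small disc and the
    remainder on the large one. *)
Lemma Taylor (F : C -> C) (c : C) (r M0 : R) :
  r > 0 -> (forall z, Cmod (z - c) < r -> diff_at F z) ->
  (forall z, Cmod (z - c) < r -> Cmod (F z) <= M0) ->
  exists a : nat -> C, a O = F c /\ forall s M, 0 < s <= r ->
    (forall z, Cmod (z - c) < s -> Cmod (F z) <= M) ->
    (forall n, Cmod (a n) <= M * (64 / s) ^ n) /\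
    forall N z, Cmod (z - c) < s ->
      Cmod (F z - psum a (z - c) N) <= M * (64 / s * Cmod (z - c)) ^ N.
Proof.
  intros Hr Hd HM0.
  set (Fs := fun n => Nat.iter n (fun G => dquot G c) F).
  assert (Cc : Cmod (c - c) = 0) by apply Cmod_minus_diag.
  assert (B : forall n s M, 0 < s <= r -> (forall z, Cmod (z - c) < s -> Cmod (F z) <= M) ->
     forall z, Cmod (z - c) < s -> diff_at (Fs n) z /\ Cmod (Fs n z) <= M * (64 / s) ^ n).
  { induction n as [|n IH]; intros s M Hs HM z Hz.
    - split; [apply Hd; lra|]. simpl. rewrite Rmult_1_r. auto.
    - simpl. rewrite (Rmult_comm (64 / s)), <- Rmult_assoc.
      apply (dquot_diff_bound (Fs n) c c s (M * (64 / s) ^ n)); auto; try lra;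
        intros u Hu; apply (IH s M Hs HM u Hu). }
  exists (fun n => Fs n c). split; [reflexivity|]. intros s M Hs HM. split.
  - intro n. apply (B n s M Hs HM c). lra.
  - intros N z Hz.
    assert (E : forall n, F z = (psum (fun n => Fs n c) (z - c) n + (z - c) ^ n * Fs n z)%C).
    { induction n as [|n IH].
      - simpl. unfold Fs. simpl. ring.
      - rewrite IH at 1. simpl psum.
        assert (Dn : diff_at (Fs n) c) by (apply (B n r M0); auto; lra).
        rewrite (dquot_eq (Fs n) c Dn z) at 1.
        change (dquot (Fs n) c) with (Fs (S n)). rewrite Cpow_S. ring. }
    rewrite (E N) at 1.
    replace (psum (fun n => Fs n c) (z - c) N + (z - c) ^ N * Fs N z
             - psum (fun n => Fs n c) (z - c) N)%C with ((z - c) ^ N * Fs N z)%C by ring.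
    rewrite Cmod_mult, Cmod_pow, Rpow_mult_distr.
    destruct (B N s M Hs HM z Hz) as [_ H].
    assert (P : 0 <= Cmod (z - c) ^ N) by (apply pow_le, Cmod_ge_0). nra.
Qed.

(** * Factoring out zeros *)

Fixpoint lprod (l : list C) (z : C) : C :=
  match l with nil => 1%C | a :: l' => ((z - a) * lprod l' z)%C end.

Lemma pow_lt_compat_S (x y : R) (n : nat) : 0 <= x < y -> x ^ S n < y ^ S n.
Proof.
  intro H. induction n as [|n IH]; [simpl; lra|].
  change (x * x ^ S n < y * y ^ S n).
  apply Rmult_le_0_lt_compat; try lra. apply pow_le; lra.
Qed.

(** Without a zero, [1 / F] would be bounded on the outer annulus and hence at [c], where [F] is
    tiny. At a zero [a] the perturbation equals [(a - c) ^ S k] in modulus, which keeps [a] close to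
    [c]. *)
Lemma perturbed_power_has_zero (F : C -> C) (c : C) (r t : R) (k : nat) :
  r > 0 -> 0 < t <= 1 / 4 ->
  (forall z, Cmod (z - c) < r -> diff_at F z) ->
  (forall z, Cmod (z - c) < r -> Cmod (F z - (z - c) ^ S k) <= t ^ S k / 8 * r ^ S k) ->
  exists a, Cmod (a - c) <= t * r /\ F a = 0%C.
Proof.
  intros Hr Ht Hd HF.
  assert (Pt : 0 < t ^ S k) by (apply pow_lt; lra).
  assert (Pr : 0 < r ^ S k) by (apply pow_lt; lra).
  assert (Ph : 0 < (1 / 2) ^ S k) by (apply pow_lt; lra).
  assert (Hth : t ^ S k < (1 / 2) ^ S k) by (apply pow_lt_compat_S; lra).
  assert (Ex : exists a, Cmod (a - c) < r /\ F a = 0%C).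
  { apply NNPP. intro N.
    assert (NF : forall z, Cmod (z - c) < r -> F z <> 0%C).
    { intros z Hz E. apply N. now exists z. }
    (* A lower bound for [F] on the annulus: [(r / 2) ^ S k] minus the perturbation is still at
       least half of [(r / 2) ^ S k]. The denominator 8 of the hypothesis contradicts
       [m <= 4 * Cmod (F c)]. *)
    set (m := (1 / 2) ^ S k / 2 * r ^ S k).
    assert (Hm : 0 < m) by (unfold m; apply Rmult_lt_0_compat; lra).
    assert (B : Cmod (/ F c) <= 4 * (/ m)).
    { apply (mean_value_bound (fun z => / F z)%C c r); auto.
      - intros z Hz. apply diff_at_inv; auto.
      - intros z [Hz1 Hz2]. rewrite Cmod_inv by auto. apply Rinv_le_contravar; auto.
        assert (T := Cmod_reverse_triangle ((z - c) ^ S k) (F z)).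
        rewrite (Cmod_minus_sym _ (F z)) in T. assert (H := HF z Hz2). rewrite Cmod_pow in T.
        assert (P : (r / 2) ^ S k <= Cmod (z - c) ^ S k) by (apply pow_incr; lra).
        replace (r / 2) with (1 / 2 * r) in P by field. rewrite Rpow_mult_distr in P.
        unfold m. nra. }
    assert (Hc : Cmod (c - c) < r) by (rewrite Cmod_minus_diag; lra).
    assert (H := HF c Hc). replace (c - c)%C with (RtoC 0) in H by ring.
    rewrite Cpow_S in H. replace (F c - 0 * 0 ^ k)%C with (F c) in H by ring.
    rewrite Cmod_inv in B by auto.
    assert (P : 0 < Cmod (F c)) by now apply Cmod_gt_0, NF.
    assert (X : m <= 4 * Cmod (F c)).
    { apply Rmult_le_reg_l with (/ m * / Cmod (F c)).
      - apply Rmult_lt_0_compat; now apply Rinv_0_lt_compat.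
      - replace (/ m * / Cmod (F c) * m) with (/ Cmod (F c)) by (field; lra).
        replace (/ m * / Cmod (F c) * (4 * Cmod (F c))) with (4 * / m) by (field; lra). exact B. }
    unfold m in X. nra. }
  destruct Ex as [a [Ha E]]. exists a. split; auto.
  assert (H := HF a Ha). rewrite E in H.
  replace (0 - (a - c) ^ S k)%C with (- (a - c) ^ S k)%C in H by ring.
  rewrite Cmod_opp, Cmod_pow in H.
  apply Rnot_lt_le. intro L.
  assert (Ptr : 0 < t * r) by (apply Rmult_lt_0_compat; lra).
  assert (L' := pow_lt_compat_S (t * r) (Cmod (a - c)) k (conj (Rlt_le _ _ Ptr) L)).
  rewrite Rpow_mult_distr in L'. nra.
Qed.

(* Rouche's theorem against a power, by peeling off one zero at a time:
   if [F a = 0] then [F = (z - a) * ((z - c)^k + q)] with [q] small. *)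
Lemma perturbed_power_factor (k : nat) :
  exists th, 0 < th /\ forall F c r, r > 0 ->
    (forall z, Cmod (z - c) < r -> diff_at F z) ->
    (forall z, Cmod (z - c) < r -> Cmod (F z - (z - c) ^ k) <= th * r ^ k) ->
    exists l u, length l = k /\ (forall a, In a l -> Cmod (a - c) <= r / 4) /\
      forall z, Cmod (z - c) < r -> diff_at u z /\ u z <> 0%C /\ F z = (lprod l z * u z)%C.
Proof.
  induction k as [|k [th [Hth IH]]].
  - exists (1 / 2). split; [lra|]. intros F c r Hr Hd HF. exists nil, F.
    split; [reflexivity|]. split; [intros a []|]. intros z Hz. split; auto. split.
    + intro E. specialize (HF z Hz). rewrite E in HF. simpl in HF.
      replace (0 - 1)%C with (- (1))%C in HF by ring. rewrite Cmod_opp, Cmod_1 in HF. lra.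
    + simpl. ring.
  (* The error [2 * t * r ^ S k] of [E] becomes [128 * t * r ^ k] after the quotient by [z - a], and
     must stay below the threshold [th] for exponent [k]. *)
  - set (t := Rmin (1 / 4) (th / 128)).
    assert (T1 : t <= 1 / 4) by apply Rmin_l. assert (T2 : t <= th / 128) by apply Rmin_r.
    assert (T0 : 0 < t) by (apply Rmin_glb_lt; lra).
    assert (P : 0 < t ^ S k) by now apply pow_lt.
    assert (Q : t ^ S k <= t).
    { simpl. assert (t ^ k <= 1 ^ k) by (apply pow_incr; lra). rewrite pow1 in H. nra. }
    exists (t ^ S k / 8). split; [lra|]. intros F c r Hr Hd HF.
    destruct (perturbed_power_has_zero F c r t k Hr ltac:(lra) Hd HF) as [a [Ha Fa]].
    assert (Ha' : Cmod (a - c) <= r / 4) by nra.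
    assert (Pr : 0 < r ^ k) by now apply pow_lt.
    (* [E] vanishes at [a], so dividing it by [z - a] yields a holomorphic perturbation of
       [(z - c) ^ k]. *)
    set (E := fun z => (F z - (z - a) * (z - c) ^ k)%C).
    assert (DE : forall z, Cmod (z - c) < r -> diff_at E z).
    { intros z Hz. apply diff_at_minus; auto. apply diff_at_mult.
      - apply (diff_at_minus (fun w => w) (fun _ => a)); [apply diff_at_id | apply diff_at_const].
      - apply (diff_at_pow (fun w => w - c)%C).
        apply (diff_at_minus (fun w => w) (fun _ => c)); [apply diff_at_id | apply diff_at_const]. }
    assert (BE : forall z, Cmod (z - c) < r -> Cmod (E z) <= 2 * t * r ^ S k).
    { intros z Hz. unfold E.
      replace (F z - (z - a) * (z - c) ^ k)%C
        with ((F z - (z - c) ^ S k) + (a - c) * (z - c) ^ k)%C by (rewrite Cpow_S; ring).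
      eapply Rle_trans; [apply Cmod_triangle|]. rewrite Cmod_mult, Cmod_pow.
      assert (H1 := HF z Hz).
      assert (H2 : Cmod (a - c) * Cmod (z - c) ^ k <= t * r * r ^ k).
      { apply Rmult_le_compat; auto using Cmod_ge_0.
        - apply pow_le, Cmod_ge_0.
        - apply pow_incr. split; [apply Cmod_ge_0 | lra]. }
      simpl (r ^ S k) in *. assert (0 < r * r ^ k) by now apply Rmult_lt_0_compat. nra. }
    assert (DQ := dquot_diff_bound E c a r _ Hr Ha' DE BE).
    assert (EQ := dquot_eq E a (DE a ltac:(lra))).
    assert (Ea : E a = 0%C) by (unfold E; rewrite Fa; ring).
    set (F1 := fun z => ((z - c) ^ k + dquot E a z)%C).
    destruct (IH F1 c r Hr) as [l [u [Hl [Hin Hu]]]].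
    + intros z Hz. apply diff_at_plus; [|now apply DQ].
      apply (diff_at_pow (fun w => w - c)%C).
      apply (diff_at_minus (fun w => w) (fun _ => c)); [apply diff_at_id | apply diff_at_const].
    + intros z Hz. unfold F1.
      replace ((z - c) ^ k + dquot E a z - (z - c) ^ k)%C with (dquot E a z) by ring.
      eapply Rle_trans; [apply DQ; auto|].
      replace (2 * t * r ^ S k * (64 / r)) with (128 * t * r ^ k) by (simpl; field; lra).
      apply Rmult_le_compat_r; lra.
    + exists (a :: l), u. split; [simpl; congruence|]. split.
      * intros b [<-|Hb]; auto.
      * intros z Hz. destruct (Hu z Hz) as (U1 & U2 & U3). repeat split; auto. simpl.
        rewrite <- Cmult_assoc, <- U3. unfold F1.
        assert (X := EQ z). rewrite Ea in X. unfold E in X at 1.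
        replace ((z - a) * ((z - c) ^ k + dquot E a z))%C
          with ((z - a) * (z - c) ^ k + (0 + (z - a) * dquot E a z))%C by ring.
        rewrite <- X. ring.
Qed.

(** * Orders of zeros read off from a factorization *)

Definition Ceq_dec (x y : C) : {x = y} + {x <> y} := excluded_middle_informative (x = y).

Lemma lprod_neq_0 (l : list C) (z : C) : ~ In z l -> lprod l z <> 0%C.
Proof.
  induction l as [|a l IH]; simpl; intro H.
  - intro E. apply RtoC_inj in E. lra.
  - apply Cmult_neq_0; [apply Cminus_neq_0; intros ->; tauto | tauto].
Qed.

Lemma diff_at_lprod (l : list C) (z : C) : diff_at (lprod l) z.
Proof.
  induction l as [|a l IH]; [apply (diff_at_const 1%C)|].
  apply (diff_at_mult (fun w => w - a)%C (lprod l)); auto.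
  apply (diff_at_minus (fun w => w) (fun _ => a)); [apply diff_at_id | apply diff_at_const].
Qed.

Lemma lprod_factor (l : list C) (a z : C) :
  lprod l z = ((z - a) ^ count_occ Ceq_dec l a * lprod (remove Ceq_dec a l) z)%C.
Proof.
  induction l as [|b l IH]; [simpl; ring|]. simpl.
  destruct (Ceq_dec b a) as [->|N]; destruct (Ceq_dec a _) as [M|M]; try congruence;
    rewrite IH; simpl; ring.
Qed.

(** Cancelling [(z - a) ^ m] off [a] leaves [h z = (z - a) ^ (n - m) * k z], so by continuity
    [h a = 0]. *)
Lemma order_unique_aux (m n : nat) (h k : C -> C) (a : C) (r : R) :
  r > 0 -> (m < n)%nat -> cont_at h a -> cont_at k a -> h a <> 0%C ->
  ~ (forall z, 0 < Cmod (z - a) < r -> ((z - a) ^ m * h z = (z - a) ^ n * k z)%C).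
Proof.
  intros Hr Hmn Hh Hk H0 E. apply H0.
  destruct (Nat.le_exists_sub (S m) n) as [d [-> _]]; [lia|].
  rewrite (cont_at_limit_unique h (fun z => (z - a) ^ S d * k z)%C a r); auto.
  - simpl. ring.
  - intros z Hz. assert (Nz : (z - a)%C <> 0%C) by (apply Cmod_gt_0; lra).
    specialize (E z Hz). replace (d + S m)%nat with (m + S d)%nat in E by lia.
    rewrite Cpow_add_r in E. assert (Np := Cpow_nz _ m Nz).
    replace (h z) with (/ (z - a) ^ m * ((z - a) ^ m * h z))%C by (field; auto).
    rewrite E. field. auto.
  - apply cont_at_mult; auto. apply diff_at_cont. apply (diff_at_pow (fun z => z - a)%C).
    apply (diff_at_minus (fun w => w) (fun _ => a)); [apply diff_at_id | apply diff_at_const].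
Qed.

Lemma order_unique (m n : nat) (h k : C -> C) (a : C) (r : R) :
  r > 0 -> cont_at h a -> cont_at k a -> h a <> 0%C -> k a <> 0%C ->
  (forall z, 0 < Cmod (z - a) < r -> ((z - a) ^ m * h z = (z - a) ^ n * k z)%C) -> m = n.
Proof.
  intros Hr Hh Hk H0 K0 E. destruct (Nat.lt_trichotomy m n) as [L|[L|L]]; auto; exfalso.
  - now apply (order_unique_aux m n h k a r).
  - apply (order_unique_aux n m k h a r); auto. intros. symmetry. auto.
Qed.

(** The factors other than [z - a] do not vanish at [a], and orders are unique. The clause [1 <= m]
    covers the points that are not zeros, whose count is 0. *)
Lemma zero_order_of_factor (f : Cplx -> option Cplx) (c : C) (r : R) (l : list C) (u : C -> C) :
  (forall z, Cmod (z - c) < r -> diff_at u z /\ u z <> 0%C /\ f z = Some (lprod l z * u z)%C) ->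
  forall a m, Cmod (a - c) < r ->
    (zero_order f a m <-> (1 <= m)%nat /\ m = count_occ Ceq_dec l a).
Proof.
  intros H a m Ha.
  set (n := count_occ Ceq_dec l a).
  set (h := fun z => (lprod (remove Ceq_dec a l) z * u z)%C).
  set (s := r - Cmod (a - c)).
  assert (In_s : forall z, Cmod (z - a) < s -> Cmod (z - c) < r).
  { intros z Hz. assert (T := Cmod_minus_triangle z a c). unfold s in Hz. lra. }
  assert (Hs : s > 0) by (unfold s; lra).
  assert (Dh : forall z, Cmod (z - a) < s -> diff_at h z).
  { intros z Hz. apply diff_at_mult; [apply diff_at_lprod | now apply H, In_s]. }
  assert (Caa : Cmod (a - a) = 0) by apply Cmod_minus_diag.
  assert (Nh : h a <> 0%C).
  { apply Cmult_neq_0; [|apply H; auto]. apply lprod_neq_0, remove_In. }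
  assert (Eh : forall z, Cmod (z - a) < s -> f z = Some ((z - a) ^ n * h z)%C).
  { intros z Hz. destruct (H z (In_s z Hz)) as (_ & _ & E). rewrite E. f_equal.
    rewrite (lprod_factor l a). unfold h, n. ring. }
  split.
  - intros [Hm [r' [Hr' [k [Dk [Nk Ek]]]]]]. split; auto.
    apply (order_unique m n k h a (Rmin r' s)); auto.
    + now apply Rmin_glb_lt.
    + apply diff_at_cont, Dk. change (Cmod (a - a) < r'). lra.
    + apply diff_at_cont, Dh. lra.
    + intros z [_ Hz].
      assert (A := Ek z (Rlt_le_trans _ _ _ Hz (Rmin_l _ _))).
      rewrite (Eh z (Rlt_le_trans _ _ _ Hz (Rmin_r _ _))) in A. injection A as A1 A2.
      symmetry. apply injective_projections; assumption.
  - intros [Hm ->]. split; auto. exists s. split; auto. exists h. repeat split; auto.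
Qed.

(** * Dominant Taylor terms *)

Lemma argmax_below (g : nat -> R) (k : nat) :
  (0 < k)%nat -> exists n, (n < k)%nat /\ forall m, (m < k)%nat -> g m <= g n.
Proof.
  induction k as [|k IH]; [lia|]. intros _. destruct k as [|k].
  - exists O. split; [lia|]. intros m Hm. replace m with O by lia. lra.
  - destruct IH as [n [Hn H]]; [lia|].
    destruct (Rle_dec (g n) (g (S k))) as [L|L].
    + exists (S k). split; [lia|]. intros m Hm.
      destruct (Nat.eq_dec m (S k)) as [->|N]; [lra|]. specialize (H m ltac:(lia)). lra.
    + exists n. split; [lia|]. intros m Hm.
      destruct (Nat.eq_dec m (S k)) as [->|N]; [lra|]. apply H. lia.
Qed.

(** Shrinking the radius by [q] multiplies a term of index [m] by [q ^ m], so it loses at least one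
    factor [q] against a term of lower index. *)
Lemma shrink_scale (A B K s q : R) (m n : nat) :
  0 <= A -> 0 <= B -> 0 <= K -> 0 < s -> 0 < q <= 1 -> (n < m)%nat ->
  A * s ^ m <= K * (B * s ^ n) -> A * (s * q) ^ m <= q * K * (B * (s * q) ^ n).
Proof.
  intros HA HB HK Hs Hq Hnm H. rewrite !Rpow_mult_distr.
  assert (E : q ^ m <= q * q ^ n).
  { destruct (Nat.le_exists_sub (S n) m) as [d [-> _]]; [lia|].
    rewrite Nat.add_comm, pow_add. change (q ^ S n) with (q * q ^ n).
    assert (P : q ^ d <= 1 ^ d) by (apply pow_incr; lra). rewrite pow1 in P.
    assert (0 < q ^ n) by (apply pow_lt; lra). assert (0 < q * q ^ n) by (apply Rmult_lt_0_compat; lra).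
    nra. }
  assert (P0 : 0 < q ^ n) by (apply pow_lt; lra).
  assert (P1 : 0 < s ^ m) by (apply pow_lt; lra).
  assert (P2 : 0 < s ^ n) by (apply pow_lt; lra).
  assert (X : 0 <= A * s ^ m) by (apply Rmult_le_pos; lra).
  apply Rle_trans with (A * s ^ m * (q * q ^ n)).
  - rewrite <- Rmult_assoc. apply Rmult_le_compat_l; lra.
  - apply Rle_trans with (K * (B * s ^ n) * (q * q ^ n)).
    + apply Rmult_le_compat_r; [|lra]. apply Rmult_le_pos; lra.
    + right. ring.
Qed.

(* Each time the terms below the current dominant index [k] interfere, two
   further shrinkings make a smaller index dominate all larger ones. *)
Lemma dominant_scale (th : R) (N : nat) (a : nat -> R) :
  0 < th < 1 -> (forall n, 0 <= a n) -> forall k s, 0 < s ->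
  (forall n, (k < n < N)%nat -> a n * s ^ n <= th * (a k * s ^ k)) ->
  exists j k', (j <= 2 * k + 1)%nat /\ (k' <= k)%nat /\
    forall n, (n < N)%nat -> n <> k' ->
      a n * (s * (th ^ 2) ^ j) ^ n <= th * (a k' * (s * (th ^ 2) ^ j) ^ k').
Proof.
  intros Hth Ha. induction k as [k IH] using (well_founded_induction lt_wf). intros s Hs Hk.
  (* The square is needed because competing terms are only known to be within a factor [/ th]; one
     shrinking by [th ^ 2] turns that ratio into [th]. *)
  assert (Hq : 0 < th ^ 2 <= 1) by (simpl; nra).
  set (q := th ^ 2) in *. set (s1 := s * q).
  assert (Hs1 : 0 < s1) by (apply Rmult_lt_0_compat; lra).
  assert (T0 : forall n x, 0 < x -> 0 <= a n * x ^ n).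
  { intros n x Hx. apply Rmult_le_pos; auto. apply pow_le. lra. }
  assert (Up : forall n, (k < n < N)%nat -> a n * s1 ^ n <= th * (a k * s1 ^ k)).
  { intros n Hn.
    assert (X := shrink_scale (a n) (a k) th s q n k (Ha n) (Ha k) ltac:(lra) Hs Hq ltac:(lia) (Hk n Hn)).
    fold s1 in X. assert (Y := T0 k s1 Hs1). eapply Rle_trans; [exact X|].
      apply Rmult_le_compat_r; [exact Y | nra]. }
  destruct (classic (forall n, (n < k)%nat -> a n * s1 ^ n <= th * (a k * s1 ^ k))) as [D|D].
  - exists 1%nat, k. split; [lia|]. split; [lia|]. intros n Hn Nk. rewrite pow_1. fold s1.
    destruct (Nat.lt_total n k) as [L|[L|L]]; [auto | lia | apply Up; lia].
  - apply not_all_ex_not in D. destruct D as [n0 D]. apply imply_to_and in D.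
    destruct D as [Hn0 D]. apply Rnot_le_lt in D.
    (* The largest lower term becomes the new candidate. Since some lower term exceeds [th] times
       the term [k], all terms are at most [/ th] times this one. *)
    destruct (argmax_below (fun n => a n * s1 ^ n) k) as [n1 [Hn1 Hmax]]; [lia|].
    assert (H1 := Hmax n0 Hn0). simpl in H1.
    assert (Hit : 0 < / th) by (apply Rinv_0_lt_compat; lra).
    assert (Hi1 : 1 < / th) by (rewrite <- Rinv_1; apply Rinv_lt_contravar; lra).
    assert (Kk : a k * s1 ^ k <= / th * (a n1 * s1 ^ n1)).
    { apply Rmult_le_reg_l with th; [lra|].
      replace (th * (/ th * (a n1 * s1 ^ n1))) with (a n1 * s1 ^ n1) by (field; lra). lra. }
    set (s2 := s1 * q). assert (Hs2 : 0 < s2) by (apply Rmult_lt_0_compat; lra).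
    destruct (IH n1 Hn1 s2 Hs2) as [j [k' [Hj [Hk' H]]]].
    + intros m Hm.
      assert (X : a m * s1 ^ m <= / th * (a n1 * s1 ^ n1)).
      { destruct (Nat.lt_total m k) as [L|[->|L]]; auto.
        - assert (Y := Hmax m L). simpl in Y. assert (Z := T0 n1 s1 Hs1). nra.
        - assert (Y := Up m ltac:(lia)). assert (Z := T0 k s1 Hs1). nra. }
      assert (Y := shrink_scale (a m) (a n1) (/ th) s1 q m n1 (Ha m) (Ha n1) ltac:(lra) Hs1 Hq
                     ltac:(lia) X).
      fold s2 in Y. replace (q * / th) with th in Y by (unfold q; field; lra). exact Y.
    + exists (S (S j)), k'. split; [lia|]. split; [lia|].
      replace (s * q ^ S (S j)) with (s2 * q ^ j) by (unfold s2, s1; simpl; ring). exact H.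
Qed.

Lemma psum_minus_term (a : nat -> C) (w : C) (k N : nat) (B : R) :
  0 <= B -> (forall n, (n < N)%nat -> n <> k -> Cmod (a n) * Cmod w ^ n <= B) -> (k < N)%nat ->
  Cmod (psum a w N - a k * w ^ k) <= INR N * B.
Proof.
  intros HB.
  (* The term [k] is subtracted only once it has entered the sum, which lets the induction start at
     0. *)
  assert (G : forall N, (forall n, (n < N)%nat -> n <> k -> Cmod (a n) * Cmod w ^ n <= B) ->
    Cmod (psum a w N - (if lt_dec k N then a k * w ^ k else 0)) <= INR N * B).
  { clear N. induction N as [|N IH]; intro H.
    - destruct (lt_dec k 0); [lia|]. simpl. rewrite Cmod_minus_diag. lra.
    - rewrite S_INR. specialize (IH (fun n Hn => H n (Nat.lt_lt_succ_r _ _ Hn))).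
      simpl psum. destruct (Nat.eq_dec N k) as [<-|E].
      + destruct (lt_dec N N); [lia|]. destruct (lt_dec N (S N)); [|lia].
        replace (psum a w N + a N * w ^ N - a N * w ^ N)%C with (psum a w N - 0)%C by ring. lra.
      + assert (X : Cmod (a N * w ^ N) <= B).
        { rewrite Cmod_mult, Cmod_pow. apply H; lia. }
        destruct (lt_dec k N), (lt_dec k (S N)); try lia.
        * replace (psum a w N + a N * w ^ N - a k * w ^ k)%C
            with ((psum a w N - a k * w ^ k) + a N * w ^ N)%C by ring.
          eapply Rle_trans; [apply Cmod_triangle|]. lra.
        * replace (psum a w N + a N * w ^ N - 0)%C
            with ((psum a w N - 0) + a N * w ^ N)%C by ring.
          eapply Rle_trans; [apply Cmod_triangle|]. lra. }
  intros H Hk. specialize (G N H). destruct (lt_dec k N); [exact G | lia].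
Qed.

(** * Uniform radii for clusters of zeros *)

Definition factors_on (G : C -> C) (c : C) (s : R) (k : nat) : Prop :=
  exists l u, length l = k /\ (forall a, In a l -> Cmod (a - c) <= s / 4) /\
    forall z, Cmod (z - c) < s -> diff_at u z /\ u z <> 0%C /\ G z = (lprod l z * u z)%C.

Lemma perturbed_power_factor_uniform (N : nat) :
  exists th, 0 < th /\ forall k, (k < N)%nat -> forall F c r, r > 0 ->
    (forall z, Cmod (z - c) < r -> diff_at F z) ->
    (forall z, Cmod (z - c) < r -> Cmod (F z - (z - c) ^ k) <= th * r ^ k) -> factors_on F c r k.
Proof.
  induction N as [|N [th [Hth IH]]].
  - exists 1. split; [lra|]. lia.
  - destruct (perturbed_power_factor N) as [t [Ht H]].
    exists (Rmin th t). split; [now apply Rmin_glb_lt|]. intros k Hk F c r Hr Hd HF.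
    assert (P : 0 < r ^ k) by now apply pow_lt.
    destruct (Nat.eq_dec k N) as [->|E].
    + apply H; auto. intros z Hz. eapply Rle_trans; [now apply HF|].
      apply Rmult_le_compat_r; [lra | apply Rmin_r].
    + apply IH; auto; [lia|]. intros z Hz. eapply Rle_trans; [now apply HF|].
      apply Rmult_le_compat_r; [lra | apply Rmin_l].
Qed.

(** For [Cmod (z - c) < r / 128] the ratio in the remainder is at most [1 / 2], so the remainder is
    below [kap / 2]. Were all terms small, the partial sum would contribute at most another
    [kap / 2], and [F] could not vary by [kap]. *)
Lemma Taylor_large_coefficient (F : C -> C) (c : C) (r M kap : R) (N : nat) (a : nat -> C) (z : C) :
  r > 0 -> kap > 0 -> (0 < N)%nat -> M / 2 ^ N < kap / 2 -> 0 <= M ->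
  a O = F c ->
  (forall z, Cmod (z - c) < r ->
     Cmod (F z - psum a (z - c) N) <= M * (64 / r * Cmod (z - c)) ^ N) ->
  Cmod (z - c) < r / 128 -> kap <= Cmod (F z - F c) ->
  exists n, (n < N)%nat /\ kap / (2 * INR N) <= Cmod (a n) * (r / 128) ^ n.
Proof.
  intros Hr Hk HN HM HM0 Ha0 HT Hz Hkz. apply NNPP. intro Nx.
  assert (PN : 0 < INR N) by (now apply lt_0_INR).
  set (B := kap / (2 * INR N)). assert (HB : 0 < B) by (apply Rdiv_lt_0_compat; lra).
  assert (X : Cmod (psum a (z - c) N - a O * (z - c) ^ 0) <= INR N * B).
  { apply psum_minus_term; auto; [lra|]. intros n Hn _.
    apply Rnot_lt_le. intro L. apply Nx. exists n. split; auto. fold B.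
    left. eapply Rlt_le_trans; [exact L|]. apply Rmult_le_compat_l; [apply Cmod_ge_0|].
    apply pow_incr. split; [apply Cmod_ge_0 | lra]. }
  assert (E : INR N * B = kap / 2) by (unfold B; field; lra).
  assert (Y := HT z ltac:(lra)).
  assert (W : M * (64 / r * Cmod (z - c)) ^ N <= M / 2 ^ N).
  { unfold Rdiv. rewrite <- pow_inv. apply Rmult_le_compat_l; auto. apply pow_incr. split.
    - apply Rmult_le_pos; [|apply Cmod_ge_0]. left. apply Rdiv_lt_0_compat; lra.
    - apply Rle_trans with (64 / r * (r / 128)).
      + apply Rmult_le_compat_l; [left; apply Rdiv_lt_0_compat; lra | lra].
      + right. field. lra. }
  assert (T := Cmod_minus_triangle (F z) (psum a (z - c) N) (F c)).
  replace (psum a (z - c) N - F c)%C with (psum a (z - c) N - a O * (z - c) ^ 0)%C in T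
    by (rewrite Ha0; simpl; ring).
  lra.
Qed.

(** The order of quantifiers is the point: [m], [s0], [q], [J] do not depend on [c] and [F], and
    [j], [k] do not depend on [G]. So [F] and all functions near it have the same number of zeros at
    the same scale. *)
Lemma uniform_cluster (r M kap eta : R) :
  r > 0 -> M > 0 -> kap > 0 -> eta > 0 ->
  exists m s0 q J, m > 0 /\ 0 < s0 <= eta /\ s0 <= r /\ 0 < q < 1 /\
  forall c F, (forall z, Cmod (z - c) < r -> diff_at F z) ->
    (forall z, Cmod (z - c) < r -> Cmod (F z) <= M) ->
    (exists z, Cmod (z - c) < r / 128 /\ kap <= Cmod (F z - F c)) ->
    exists j k, (j <= J)%nat /\ forall G,
      (forall z, Cmod (z - c) < s0 * q ^ j -> diff_at G z) ->
      (forall z, Cmod (z - c) < s0 * q ^ j -> Cmod (G z - F z) <= m) ->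
      factors_on G c (s0 * q ^ j) k.
Proof.
  intros Hr HM Hk He.
  destruct (div_pow2_small M (kap / 2)) as [N' HN']; [lra|].
  set (N := S N').
  assert (HN : M / 2 ^ N < kap / 2).
  { eapply Rle_lt_trans; [|exact HN']. apply Rmult_le_compat_l; [lra|].
    apply Rinv_le_contravar; [apply pow_lt; lra|]. unfold N. simpl.
    assert (0 < 2 ^ N') by (apply pow_lt; lra). lra. }
  assert (N0 : (0 < N)%nat) by (unfold N; lia).
  assert (PN : 0 < INR N) by (now apply lt_0_INR).
  destruct (perturbed_power_factor_uniform N) as [th [Hth HF]].
  (* Chosen so that the at most [N] dominated terms together stay below [th / 4] of the dominant
     one. *)
  set (th' := Rmin (1 / 2) (th / (4 * INR N))).
  assert (Q1 : 0 < th / (4 * INR N)) by (apply Rdiv_lt_0_compat; lra).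
  assert (Hth' : 0 < th' < 1).
  { split; [apply Rmin_glb_lt; lra|]. eapply Rle_lt_trans; [apply Rmin_l|]. lra. }
  assert (Hth'2 : INR N * th' <= th / 4).
  { apply Rle_trans with (INR N * (th / (4 * INR N))).
    - apply Rmult_le_compat_l; [lra | apply Rmin_r].
    - right. field. lra. }
  set (q := th' ^ 2). assert (Hq : 0 < q < 1) by (unfold q; simpl; nra).
  set (J := (2 * N + 1)%nat).
  (* Solves [M * (128 * b / r) = th / 4 * (kap / (2 * INR N))], which makes the Taylor tail at most
     [th / 4] of the dominant term. *)
  set (b := r * th * kap / (1024 * INR N * M)).
  assert (Hb : 0 < b).
  { apply Rdiv_lt_0_compat; repeat apply Rmult_lt_0_compat; lra. }
  set (s0 := Rmin (Rmin eta b) (r / 128)).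
  assert (Hs0 : 0 < s0) by (unfold s0; repeat apply Rmin_glb_lt; lra).
  assert (B1 := Rmin_l (Rmin eta b) (r / 128)). assert (B2 := Rmin_r (Rmin eta b) (r / 128)).
  assert (B3 := Rmin_l eta b). assert (B4 := Rmin_r eta b). fold s0 in B1, B2.
  (* A lower bound for the dominant term at scale [s]: the large term at radius [r / 128], rescaled
     with the worst exponent. The tolerance [m] takes it at the smallest scale [s0 * q ^ J]. *)
  set (T0 := fun s => kap / (2 * INR N) * (128 * s / r) ^ N').
  set (m := th / 4 * T0 (s0 * q ^ J)).
  assert (Hir : 0 < / r) by now apply Rinv_0_lt_compat.
  assert (HkN : 0 < kap / (2 * INR N)) by (apply Rdiv_lt_0_compat; lra).
  exists m, s0, q, J. split.
  { unfold m, T0. apply Rmult_lt_0_compat; [lra|]. apply Rmult_lt_0_compat; auto. apply pow_lt.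
    unfold Rdiv. repeat apply Rmult_lt_0_compat; try lra. apply pow_lt. lra. }
  split; [lra|]. split; [lra|]. split; [lra|].
  intros c F Hd HFM [z0 [Hz0 Hkz]].
  destruct (Taylor F c r M Hr Hd HFM) as [a [Ha0 HT]].
  destruct (HT r M ltac:(lra) HFM) as [_ HT']. specialize (HT' N).
  destruct (Taylor_large_coefficient F c r M kap N a z0) as [n0 [Hn0 Hlarge]]; auto; try lra.
  (* Starting from the last index [N'], domination of the later terms is vacuous. *)
  destruct (dominant_scale th' N (fun n => Cmod (a n)) Hth' (fun n => Cmod_ge_0 _) N' s0 Hs0)
    as [j [k [Hj [Hk' Hdom]]]].
  { intros n Hn. unfold N in Hn. lia. }
  fold q in Hdom. set (s := s0 * q ^ j) in *.
  assert (Pj : 0 < q ^ j) by (apply pow_lt; lra).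
  assert (Pj1 : q ^ j <= 1). { rewrite <- (pow1 j). apply pow_incr. lra. }
  assert (Hs : 0 < s) by (apply Rmult_lt_0_compat; lra).
  assert (Hss0 : s <= s0) by (unfold s; nra).
  assert (HJ : s0 * q ^ J <= s).
  { unfold s. apply Rmult_le_compat_l; [lra|].
    destruct (Nat.le_exists_sub j J) as [d [-> _]]; [unfold J, N; lia|].
    rewrite pow_add. assert (q ^ d <= 1). { rewrite <- (pow1 d). apply pow_incr. lra. }
    nra. }
  set (T := Cmod (a k) * s ^ k).
  assert (Hx : 0 <= 128 * s / r <= 1).
  { split.
    - unfold Rdiv. apply Rmult_le_pos; lra.
    - apply Rle_trans with (128 * (r / 128) / r); [|right; field; lra].
      unfold Rdiv. apply Rmult_le_compat_r; lra. }
  assert (HT0 : T0 s <= Cmod (a n0) * s ^ n0).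
  { apply Rle_trans with (Cmod (a n0) * (r / 128) ^ n0 * (128 * s / r) ^ n0).
    - unfold T0. apply Rmult_le_compat; [lra | apply pow_le; lra | exact Hlarge |].
      destruct (Nat.le_exists_sub n0 N') as [d [-> _]]; [unfold N in *; lia|].
      rewrite pow_add. assert ((128 * s / r) ^ d <= 1). { rewrite <- (pow1 d). apply pow_incr. lra. }
      assert (0 <= (128 * s / r) ^ n0) by (apply pow_le; lra). nra.
    - right. rewrite Rmult_assoc, <- Rpow_mult_distr. f_equal. f_equal. field. lra. }
  assert (HTT : Cmod (a n0) * s ^ n0 <= T).
  { destruct (Nat.eq_dec n0 k) as [->|E]; [apply Rle_refl|].
    specialize (Hdom n0 Hn0 E). fold T in Hdom.
    assert (0 <= T) by (apply Rmult_le_pos; [apply Cmod_ge_0 | apply pow_le; lra]). nra. }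
  assert (HT0s : 0 < T0 s).
  { unfold T0. apply Rmult_lt_0_compat; auto. apply pow_lt. unfold Rdiv.
    repeat apply Rmult_lt_0_compat; lra. }
  assert (Pk : 0 < s ^ k) by now apply pow_lt.
  assert (Nak : a k <> 0%C).
  { intro E. unfold T in HTT. rewrite E, Cmod_0 in HTT. lra. }
  assert (Pak : 0 < Cmod (a k)) by now apply Cmod_gt_0.
  assert (Hm : m <= th / 4 * T).
  { unfold m. apply Rmult_le_compat_l; [lra|]. apply Rle_trans with (T0 s); [|lra].
    unfold T0. apply Rmult_le_compat_l; [lra|]. apply pow_incr. split.
    - unfold Rdiv. apply Rmult_le_pos; [|lra]. apply Rmult_le_pos; [lra|].
      apply Rmult_le_pos; [lra|]. apply pow_le; lra.
    - unfold Rdiv. apply Rmult_le_compat_r; lra. }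
  assert (Htail : M * (64 / r * s) ^ N <= th / 4 * T).
  { apply Rle_trans with (th / 4 * T0 s); [|apply Rmult_le_compat_l; lra].
    replace (64 / r * s) with (/ 2 * (128 * s / r)) by (field; lra).
    rewrite Rpow_mult_distr. unfold N at 2. simpl pow at 2.
    set (X := (128 * s / r) ^ N'). assert (PX : 0 <= X) by (apply pow_le; lra).
    unfold T0. fold X.
    assert (P2 : (/ 2) ^ N <= 1). { rewrite <- (pow1 N). apply pow_incr. lra. }
    assert (P3 : 0 <= (/ 2) ^ N) by (apply pow_le; lra).
    assert (Key : M * (128 * s / r) <= th / 4 * (kap / (2 * INR N))).
    { apply Rle_trans with (M * (128 * b / r)).
      - apply Rmult_le_compat_l; [lra|]. unfold Rdiv. apply Rmult_le_compat_r; lra.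
      - right. unfold b. field. lra. }
    apply Rle_trans with (M * (128 * s / r) * X).
    - assert (0 <= M * (128 * s / r) * X).
      { apply Rmult_le_pos; auto. apply Rmult_le_pos; lra. }
      replace (M * ((/ 2) ^ N * (128 * s / r * X))) with ((/ 2) ^ N * (M * (128 * s / r) * X)) by ring.
      nra.
    - rewrite <- Rmult_assoc. apply Rmult_le_compat_r; auto. }
  exists j, k. split; [unfold J, N; lia|]. intros G DG HG.
  assert (HTp : 0 < T) by lra.
  destruct (HF k ltac:(unfold N; lia) (fun z => / a k * G z)%C c s) as [l [u [Hl [Hin Hu]]]]; auto.
  - intros z Hz. apply diff_at_mult; [apply diff_at_const | auto].
  - intros z Hz.
    assert (E : (/ a k * G z - (z - c) ^ k
                 = / a k * ((G z - F z) + (F z - psum a (z - c) N)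
                            + (psum a (z - c) N - a k * (z - c) ^ k)))%C) by (field; auto).
    rewrite E, Cmod_mult, Cmod_inv by auto.
    assert (X1 := HG z Hz). assert (X2 := HT' z ltac:(lra)).
    assert (X2' : M * (64 / r * Cmod (z - c)) ^ N <= M * (64 / r * s) ^ N).
    { apply Rmult_le_compat_l; [lra|]. apply pow_incr. split.
      - apply Rmult_le_pos; [unfold Rdiv; apply Rmult_le_pos; lra | apply Cmod_ge_0].
      - apply Rmult_le_compat_l; [unfold Rdiv; apply Rmult_le_pos; lra | lra]. }
    assert (X3 : Cmod (psum a (z - c) N - a k * (z - c) ^ k) <= INR N * (th' * T)).
    { apply psum_minus_term; [apply Rmult_le_pos; lra| |unfold N; lia].
      intros n Hn Nk. eapply Rle_trans; [|apply (Hdom n Hn Nk)].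
      apply Rmult_le_compat_l; [apply Cmod_ge_0|]. apply pow_incr.
      split; [apply Cmod_ge_0 | lra]. }
    assert (X3' : INR N * (th' * T) <= th / 4 * T).
    { rewrite <- Rmult_assoc. apply Rmult_le_compat_r; lra. }
    assert (Y1 := Cmod_triangle ((G z - F z) + (F z - psum a (z - c) N))
                    (psum a (z - c) N - a k * (z - c) ^ k)).
    assert (Y2 := Cmod_triangle (G z - F z) (F z - psum a (z - c) N)).
    apply Rle_trans with (/ Cmod (a k) * (th * T)).
    + apply Rmult_le_compat_l; [left; now apply Rinv_0_lt_compat|]. nra.
    + right. unfold T. field. lra.
  - exists l, (fun z => a k * u z)%C. split; auto. split; auto.
    intros z Hz. destruct (Hu z Hz) as (U1 & U2 & U3). split.
    + apply diff_at_mult; [apply diff_at_const | auto].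
    + split; [now apply Cmult_neq_0|].
      replace (lprod l z * (a k * u z))%C with (a k * (lprod l z * u z))%C by ring.
      rewrite <- U3. field. auto.
Qed.

(** * The spherical metric *)

Definition nsq (x : C) : R := fst x ^ 2 + snd x ^ 2.

Lemma nsq_pos (x : C) : 0 <= nsq x.
Proof. unfold nsq. assert (A := pow2_ge_0 (fst x)). assert (B := pow2_ge_0 (snd x)). lra. Qed.

Lemma Cmod_nsq (x : C) : Cmod x ^ 2 = nsq x.
Proof. apply Cmod_sqr. Qed.

(** Inverse stereographic projection onto the unit sphere, under which [rho_S] becomes Euclidean
    chord length. The coordinates are rational in those of [x], so identities reduce to [field]. *)
Definition stereo (v : option Cplx) : R * R * R :=
  match v with
  | Some x => (2 * fst x / (1 + nsq x), 2 * snd x / (1 + nsq x), (nsq x - 1) / (1 + nsq x))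
  | None => (0, 0, 1)
  end.

Definition dist3_sqr (p q : R * R * R) : R :=
  let '(a, b, c) := p in let '(a', b', c') := q in (a - a') ^ 2 + (b - b') ^ 2 + (c - c') ^ 2.

Lemma rho_S_pos (a b : option Cplx) : 0 <= rho_S a b.
Proof.
  assert (P : forall u v, 0 < v -> 0 <= u -> 0 <= u / sqrt v).
  { intros u v Hv Hu. apply Rmult_le_pos; auto. left. now apply Rinv_0_lt_compat, sqrt_lt_R0. }
  assert (N : forall x : C, 0 < 1 + Cmod x ^ 2).
  { intro x. rewrite Cmod_nsq. assert (T := nsq_pos x). lra. }
  destruct a as [x|], b as [y|]; unfold rho_S.
  - apply P; [apply Rmult_lt_0_compat; apply N|].
    assert (T := Cmod_ge_0 (x - y)). change (0 <= 2 * Cmod (x - y)). lra.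
  - apply P; [apply N | lra].
  - apply P; [apply N | lra].
  - lra.
Qed.

Lemma rho_S_Some_sqr (x y : C) :
  rho_S (Some x) (Some y) ^ 2 = 4 * nsq (x - y) / ((1 + nsq x) * (1 + nsq y)).
Proof.
  assert (Hx := nsq_pos x). assert (Hy := nsq_pos y).
  change (rho_S (Some x) (Some y))
    with (2 * Cmod (x - y) / sqrt ((1 + Cmod x ^ 2) * (1 + Cmod y ^ 2))).
  rewrite !Cmod_nsq. unfold Rdiv. rewrite !Rpow_mult_distr, pow_inv, pow2_sqrt, Cmod_nsq.
  - ring.
  - apply Rmult_le_pos; lra.
Qed.

Lemma rho_S_sym (a b : option Cplx) : rho_S a b = rho_S b a.
Proof.
  destruct a as [x|], b as [y|]; try reflexivity.
  change (2 * Cmod (x - y) / sqrt ((1 + Cmod x ^ 2) * (1 + Cmod y ^ 2))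
        = 2 * Cmod (y - x) / sqrt ((1 + Cmod y ^ 2) * (1 + Cmod x ^ 2))).
  rewrite (Cmod_minus_sym x y), (Rmult_comm (1 + Cmod x ^ 2)). reflexivity.
Qed.

Lemma rho_S_stereo (a b : option Cplx) : rho_S a b ^ 2 = dist3_sqr (stereo a) (stereo b).
Proof.
  assert (S1 : forall x : C, (2 / sqrt (1 + Cmod x ^ 2)) ^ 2 = 4 / (1 + nsq x)).
  { intro x. assert (Hx := nsq_pos x). rewrite Cmod_nsq. unfold Rdiv.
    rewrite Rpow_mult_distr, pow_inv, pow2_sqrt by lra. field. lra. }
  assert (S2 : forall x : C,
    dist3_sqr (stereo (Some x)) (stereo None) = 4 / (1 + nsq x)).
  { intro x. assert (Hx := nsq_pos x). simpl. unfold nsq in *. field. lra. }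
  destruct a as [x|], b as [y|].
  - rewrite rho_S_Some_sqr. assert (Hx := nsq_pos x). assert (Hy := nsq_pos y).
    clear S1 S2. destruct x as [x1 x2], y as [y1 y2]. simpl stereo. unfold dist3_sqr.
    unfold nsq in *. simpl in *. field. lra.
  - rewrite S2. apply (S1 x).
  - rewrite rho_S_sym. rewrite (S1 y : rho_S (Some y) None ^ 2 = _), <- S2.
    simpl. ring.
  - simpl. ring.
Qed.

(** The factor 2 leaves only [(u - w) ^ 2 <= 2 * (u - v) ^ 2 + 2 * (v - w) ^ 2] to be used in each
    coordinate. *)
Lemma rho_S_quasi_triangle (a b c : option Cplx) :
  rho_S a c <= 2 * (rho_S a b + rho_S b c).
Proof.
  assert (H1 := rho_S_pos a b). assert (H2 := rho_S_pos b c).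
  apply Rsqr_incr_0_var; [|lra]. rewrite !Rsqr_pow2.
  assert (E : rho_S a c ^ 2 <= 2 * rho_S a b ^ 2 + 2 * rho_S b c ^ 2).
  { rewrite !rho_S_stereo.
    destruct (stereo a) as [[a1 a2] a3], (stereo b) as [[b1 b2] b3], (stereo c) as [[c1 c2] c3].
    simpl dist3_sqr.
    assert (K : forall u v w : R, (u - w) ^ 2 <= 2 * (u - v) ^ 2 + 2 * (v - w) ^ 2).
    { intros u v w. assert (T := pow2_ge_0 ((u - v) - (v - w))). nra. }
    assert (K1 := K a1 b1 c1). assert (K2 := K a2 b2 c2). assert (K3 := K a3 b3 c3). lra. }
  nra.
Qed.

Definition inv_S (v : option Cplx) : option Cplx :=
  match v with
  | Some w => if Ceq_dec w 0%C then None else Some (/ w)%C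
  | None => Some (RtoC 0)
  end.

Lemma inv_S_involutive (v : option Cplx) : inv_S (inv_S v) = v.
Proof.
  destruct v as [w|]; simpl.
  - destruct (Ceq_dec w (RtoC 0)) as [->|N]; [reflexivity|]. simpl.
    destruct (Ceq_dec (/ w) (RtoC 0)) as [E|_].
    + exfalso. now apply (Cinv_neq_0 w).
    + apply (f_equal (@Some C)). field. exact N.
  - destruct (Ceq_dec 0 (RtoC 0)); [reflexivity | contradiction].
Qed.

(** Inversion is the half turn of the sphere about the first axis, hence an isometry for [rho_S]. *)
Lemma stereo_inv (v : option Cplx) :
  stereo (inv_S v) = let '(a, b, c) := stereo v in (a, - b, - c).
Proof.
  destruct v as [w|]; simpl.
  - destruct (Ceq_dec w (RtoC 0)) as [->|N].
    + simpl. unfold nsq. simpl. f_equal; [f_equal|]; field.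
    + destruct w as [x y]. simpl. unfold nsq. simpl.
      assert (P : 0 < x * (x * 1) + y * (y * 1)).
      { assert (T := proj1 (Cmod_gt_0 (x, y)) N).
        assert (Q := pow_lt _ 2 T). rewrite Cmod_nsq in Q. exact Q. }
      f_equal; [f_equal|]; field; repeat split; nra.
  - unfold nsq. simpl. f_equal; [f_equal|]; field.
Qed.

Lemma rho_S_inv (a b : option Cplx) : rho_S (inv_S a) (inv_S b) = rho_S a b.
Proof.
  apply Rsqr_inj; try apply rho_S_pos. rewrite !Rsqr_pow2, !rho_S_stereo, !stereo_inv.
  destruct (stereo a) as [[a1 a2] a3], (stereo b) as [[b1 b2] b3]. simpl. ring.
Qed.

Lemma rho_S_gt_0 (a b : option Cplx) : a <> b -> 0 < rho_S a b.
Proof.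
  intro N. destruct (Rle_lt_or_eq_dec _ _ (rho_S_pos a b)) as [H|H]; auto. exfalso.
  assert (G : forall x : C, 0 < 2 / sqrt (1 + Cmod x ^ 2)).
  { intro x. apply Rdiv_lt_0_compat; [lra|]. apply sqrt_lt_R0. rewrite Cmod_nsq.
    assert (T := nsq_pos x). lra. }
  destruct a as [x|], b as [y|].
  - assert (E := rho_S_Some_sqr x y). change (rho_S (@Some Cplx x) (@Some Cplx y) ^ 2 = 4 * nsq (x - y) / ((1 + nsq x) * (1 + nsq y))) in E. rewrite <- H in E.
    assert (Hx := nsq_pos x). assert (Hy := nsq_pos y).
    apply N. f_equal. apply Cmod_minus_0. apply Rsqr_0_uniq. rewrite Rsqr_pow2, Cmod_nsq.
    assert (P : 0 < (1 + nsq x) * (1 + nsq y)) by (apply Rmult_lt_0_compat; lra).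
    replace (nsq (x - y)) with (4 * nsq (x - y) / ((1 + nsq x) * (1 + nsq y))
                                * ((1 + nsq x) * (1 + nsq y)) / 4) by (field; lra).
    rewrite <- E. simpl. field.
  - specialize (G x). change (2 / sqrt (1 + Cmod x ^ 2)) with (rho_S (Some x) None) in G. lra.
  - specialize (G y). change (2 / sqrt (1 + Cmod y ^ 2)) with (rho_S None (Some y)) in G. lra.
  - now apply N.
Qed.

Lemma rho_S_le (x y : C) : rho_S (Some x) (Some y) <= 2 * Cmod (x - y).
Proof.
  assert (Hx := nsq_pos x). assert (Hy := nsq_pos y). assert (T := Cmod_ge_0 (x - y)).
  apply Rsqr_incr_0_var; [|lra].
  rewrite !Rsqr_pow2, rho_S_Some_sqr, Rpow_mult_distr, Cmod_nsq.
  assert (Q := nsq_pos (x - y)).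
  apply Rle_div_l; [apply Rmult_lt_0_compat; lra|].
  assert (1 <= (1 + nsq x) * (1 + nsq y)) by nra. nra.
Qed.

Lemma rho_S_ge (x y : C) : Cmod x <= 2 -> Cmod y <= 2 ->
  Cmod (x - y) <= 5 / 2 * rho_S (Some x) (Some y).
Proof.
  intros Bx By. assert (Hx := nsq_pos x). assert (Hy := nsq_pos y).
  assert (T := rho_S_pos (Some x) (Some y)).
  assert (Bx2 : nsq x <= 2 ^ 2).
  { rewrite <- Cmod_nsq. apply pow_incr. split; [apply Cmod_ge_0 | auto]. }
  assert (By2 : nsq y <= 2 ^ 2).
  { rewrite <- Cmod_nsq. apply pow_incr. split; [apply Cmod_ge_0 | auto]. }
  apply Rsqr_incr_0_var; [|lra].
  rewrite !Rsqr_pow2, Rpow_mult_distr, rho_S_Some_sqr, Cmod_nsq.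
  assert (Q := nsq_pos (x - y)).
  assert (P : 0 < (1 + nsq x) * (1 + nsq y)) by (apply Rmult_lt_0_compat; lra).
  assert (P2 : (1 + nsq x) * (1 + nsq y) <= 25) by nra.
  replace ((5 / 2) ^ 2 * (4 * nsq (x - y) / ((1 + nsq x) * (1 + nsq y))))
    with (25 * nsq (x - y) / ((1 + nsq x) * (1 + nsq y))) by (field; lra).
  apply Rle_div_r; auto. nra.
Qed.

Definition small (v : option Cplx) : Prop := exists x : C, v = Some x /\ Cmod x <= 1.

Lemma small_or_inv_small (v : option Cplx) : small v \/ small (inv_S v).
Proof.
  destruct v as [x|].
  - destruct (Rle_dec (Cmod x) 1) as [H|H]; [left; now exists x|]. right.
    assert (N : x <> RtoC 0) by (apply Cmod_gt_0; lra).
    exists (/ x)%C. simpl. destruct (Ceq_dec x (RtoC 0)); [contradiction|]. split; auto.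
    rewrite Cmod_inv by auto. rewrite <- Rinv_1. apply Rinv_le_contravar; lra.
  - right. exists (RtoC 0). split; auto. rewrite Cmod_0. lra.
Qed.

(** A chord shorter than [1 / 4] cannot lead from the closed unit disc to modulus above 2. This is
    the source of the bound 2 in [charts]. *)
Lemma near_small (u v : option Cplx) (d : R) :
  small u -> d <= 1 / 4 -> rho_S u v < d -> exists y : C, v = Some y /\ Cmod y <= 2.
Proof.
  intros [x [-> Hx]] Hd H. assert (P := rho_S_pos (Some x) v).
  assert (Bx : nsq x <= 1 ^ 2).
  { rewrite <- Cmod_nsq. apply pow_incr. split; [apply Cmod_ge_0 | auto]. }
  assert (Px := nsq_pos x).
  assert (H2 : rho_S (Some x) v ^ 2 <= (1 / 4) ^ 2) by (apply pow_incr; lra).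
  destruct v as [y|].
  - exists y. split; auto. apply Rnot_lt_le. intro L.
    rewrite rho_S_Some_sqr in H2.
    assert (Py := nsq_pos y).
    assert (Q : 0 < (1 + nsq x) * (1 + nsq y)) by (apply Rmult_lt_0_compat; lra).
    apply (proj1 (Rle_div_l _ _ _ Q)) in H2.
    assert (T := Cmod_reverse_triangle y x). rewrite Cmod_minus_sym in T.
    assert (T2 : (Cmod y - 1) ^ 2 <= Cmod (x - y) ^ 2) by (apply pow_incr; lra).
    rewrite Cmod_nsq in T2.
    assert (Q2 : (1 + nsq x) * (1 + nsq y) <= 2 * (1 + nsq y)) by nra.
    assert (Z : 4 * (Cmod y - 1) ^ 2 <= 1 / 16 * (2 * (1 + nsq y))) by lra.
    rewrite <- (Cmod_nsq y) in Z. nra.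
  - rewrite rho_S_stereo in H2. simpl in H2.
    assert (E : (2 * fst x / (1 + nsq x) - 0) * ((2 * fst x / (1 + nsq x) - 0) * 1) +
      (2 * snd x / (1 + nsq x) - 0) * ((2 * snd x / (1 + nsq x) - 0) * 1) +
      ((nsq x - 1) / (1 + nsq x) - 1) * (((nsq x - 1) / (1 + nsq x) - 1) * 1) = 4 / (1 + nsq x)).
    { unfold nsq in *. field. lra. }
    rewrite E in H2. assert (Q : 0 < 1 + nsq x) by lra.
    apply (proj1 (Rle_div_l _ _ _ Q)) in H2. lra.
Qed.

(** * Holomorphic maps into the sphere *)

Definition loc_hol (f : Cplx -> option Cplx) (c : C) (r : R) (F : C -> C) : Prop :=
  forall z, Cmod (z - c) < r -> diff_at F z /\ f z = Some (F z).

(* Unlike [meromorphic], this notion is visibly invariant under [f -> 1/f];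
   it also admits the constant [None]. *)
Definition sphere_hol (f : Cplx -> option Cplx) : Prop :=
  forall z, exists r, r > 0 /\ exists h,
    loc_hol f z r h \/ loc_hol (fun w => inv_S (f w)) z r h.

Lemma meromorphic_sphere_hol (f : Cplx -> option Cplx) : meromorphic f -> sphere_hol f.
Proof.
  intros Hf z0. destruct (Hf z0) as [r [Hr [[h [Hh E]]|[E0 [g [Hg [g0 E]]]]]]].
  - exists r. split; auto. exists h. left. intros z Hz. split; [now apply Hh | now apply E].
  - exists r. split; auto. exists g. right. intros z Hz. split; [now apply Hg|].
    destruct (classic (z = z0)) as [->|N].
    + rewrite E0, g0. reflexivity.
    + assert (P : 0 < Cmod (z - z0)) by now apply Cmod_minus_gt_0.
      destruct (E z (conj P Hz)) as [N2 E2]. rewrite E2.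
      assert (X : inv_S (Some (g z)) = Some (Defs.Cinv (g z))).
      { simpl. destruct (Ceq_dec (g z) (RtoC 0)) as [X|X]; [contradiction | reflexivity]. }
      rewrite <- X. apply inv_S_involutive.
Qed.

Lemma sphere_hol_inv (f : Cplx -> option Cplx) :
  sphere_hol f -> sphere_hol (fun z => inv_S (f z)).
Proof.
  intros Hf z. destruct (Hf z) as [r [Hr [h [H|H]]]]; exists r; split; auto; exists h; [right|left; auto].
  intros w Hw. rewrite inv_S_involutive. now apply H.
Qed.

Definition AE_sphere (f : Cplx -> option Cplx) : Prop :=
  sphere_hol f /\ nonconstant f /\
  forall eps, eps > 0 -> relatively_dense (almost_period_f f eps).

Lemma AE_sphere_inv (f : Cplx -> option Cplx) :
  AE_sphere f -> AE_sphere (fun z => inv_S (f z)).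
Proof.
  intros (H1 & (z1 & z2 & N) & H3). split; [now apply sphere_hol_inv|]. split.
  - exists z1, z2. intro E. apply N.
    rewrite <- (inv_S_involutive (f z1)), E. apply inv_S_involutive.
  - intros e He. destruct (H3 e He) as [L [HL H]]. exists L. split; auto. intro c.
    destruct (H c) as [t [Ht Hc]]. exists t. split; auto. intro z. rewrite rho_S_inv. apply Ht.
Qed.

Lemma sphere_hol_cont (f : Cplx -> option Cplx) (z : C) (e : R) :
  sphere_hol f -> e > 0 -> exists d, d > 0 /\ forall w, Cmod (w - z) < d -> rho_S (f w) (f z) < e.
Proof.
  intros Hf He. destruct (Hf z) as [r [Hr [h H]]].
  assert (Zz : Cmod (z - z) < r) by (rewrite Cmod_minus_diag; lra).
  assert (Ch : cont_at h z).
  { destruct H as [H|H]; apply diff_at_cont; now apply H. }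
  destruct (Ch (e / 2)) as [d [Hd Hc]]; [lra|].
  exists (Rmin r d). split; [now apply Rmin_glb_lt|]. intros w Hw.
  assert (W1 := Rlt_le_trans _ _ _ Hw (Rmin_l _ _)).
  assert (W2 := Rlt_le_trans _ _ _ Hw (Rmin_r _ _)).
  assert (X := Hc w W2). assert (Y := rho_S_le (h w) (h z)).
  destruct H as [H|H]; destruct (H w W1) as [_ E1]; destruct (H z Zz) as [_ E2];
    [|rewrite <- rho_S_inv]; rewrite E1, E2; lra.
Qed.

(** * Uniform continuity and charts of a uniform radius *)

Lemma sphere_hol_unif_cont_square (f : Cplx -> option Cplx) (L e : R) :
  sphere_hol f -> 0 <= L -> e > 0 -> exists d, d > 0 /\ forall z w,
    - L <= fst z <= L -> - L <= snd z <= L -> Cmod (w - z) < d -> rho_S (f w) (f z) < e.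
Proof.
  intros Hf HL He.
  apply (rect_bisection (fun a b c d' => exists d, d > 0 /\ forall z w,
    a <= fst z <= b -> c <= snd z <= d' -> Cmod (w - z) < d -> rho_S (f w) (f z) < e)
    (- L) L (- L) L); try lra.
  - intros a b c d _ Hab _ _ Hcd _ [d1 [P1 H1]] [d2 [P2 H2]] [d3 [P3 H3]] [d4 [P4 H4]].
    exists (Rmin (Rmin d1 d2) (Rmin d3 d4)). split; [repeat apply Rmin_glb_lt; lra|].
    assert (M1 := Rmin_l (Rmin d1 d2) (Rmin d3 d4)). assert (M2 := Rmin_r (Rmin d1 d2) (Rmin d3 d4)).
    assert (M3 := Rmin_l d1 d2). assert (M4 := Rmin_r d1 d2).
    assert (M5 := Rmin_l d3 d4). assert (M6 := Rmin_r d3 d4).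
    intros z w Hx Hy Hw.
    destruct (Rle_dec (fst z) ((a + b) / 2)), (Rle_dec (snd z) ((c + d) / 2)).
    + apply H1; lra.
    + apply H3; lra.
    + apply H2; lra.
    + apply H4; lra.
  - intros x y Hx Hy.
    destruct (sphere_hol_cont f (x, y) (e / 4) Hf ltac:(lra)) as [d [Hd H]].
    (* Sides below [d / 4] keep [z] within [d / 2] of [(x, y)], which leaves [d / 2] for the
       distance from [z] to [w]. *)
    exists (d / 4). split; [lra|]. intros a b c d' _ _ _ _ Hx' Hy' L1 L2.
    exists (d / 2). split; [lra|]. intros z w Hzx Hzy Hw.
    assert (Z : Cmod (z - (x, y)) < d / 2).
    { eapply Rle_lt_trans; [apply Cmod_le_sum|]. simpl.
      assert (Rabs (fst z + - x) <= b - a) by (apply Rabs_le; lra).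
      assert (Rabs (snd z + - y) <= d' - c) by (apply Rabs_le; lra). lra. }
    assert (A := H z ltac:(lra)).
    assert (B : rho_S (f w) (f (x, y)) < e / 4).
    { apply H. assert (T := Cmod_minus_triangle w z (x, y)). lra. }
    assert (T := rho_S_quasi_triangle (f w) (f (x, y)) (f z)).
    rewrite (rho_S_sym (f (x, y)) (f z)) in T. lra.
Qed.

(** An almost period [t] within [L] of [- z] carries [z] into a fixed square about the origin, where
    uniform continuity is known. Two uses of the quasi-triangle inequality account for [e / 16]. *)
Lemma AE_sphere_unif_cont (f : Cplx -> option Cplx) (e : R) :
  AE_sphere f -> e > 0 ->
  exists d, d > 0 /\ forall z w, Cmod (w - z) < d -> rho_S (f w) (f z) < e.
Proof.
  intros (Hf & _ & Hap) He.
  destruct (Hap (e / 16)) as [L [HL H]]; [lra|].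
  destruct (sphere_hol_unif_cont_square f L (e / 16) Hf) as [d [Hd Hu]]; try lra.
  exists d. split; auto. intros z w Hw.
  destruct (H (- z)%C) as [t [Ht Htz]].
  change (Cmod (t - - z) < L) in Htz.
  assert (Hzt : Cmod (z + t) < L) by (replace (z + t)%C with (t - - z)%C by ring; exact Htz).
  assert (A := fst_le_Cmod (z + t)). assert (B := snd_le_Cmod (z + t)).
  apply Rabs_le_between in A. apply Rabs_le_between in B.
  assert (X : rho_S (f (w + t)%C) (f (z + t)%C) < e / 16).
  { apply Hu; try lra. replace (w + t - (z + t))%C with (w - z)%C by ring. exact Hw. }
  assert (Y1 : rho_S (f (w + t)%C) (f w) < e / 16) by apply Ht.
  assert (Y2 : rho_S (f (z + t)%C) (f z) < e / 16) by apply Ht.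
  assert (T1 := rho_S_quasi_triangle (f w) (f (w + t)%C) (f z)).
  assert (T2 := rho_S_quasi_triangle (f (w + t)%C) (f (z + t)%C) (f z)).
  rewrite (rho_S_sym (f w) (f (w + t)%C)) in T1. lra.
Qed.

Definition charts (f : Cplx -> option Cplx) (r : R) : Prop :=
  forall c, small (f c) -> exists F, loc_hol f c r F /\ forall z, Cmod (z - c) < r -> Cmod (F z) <= 2.

(** Where only [1 / f] is known to be holomorphic, finiteness of [f] says that this function has no
    zero, so it can be inverted back. *)
Lemma sphere_hol_loc_hol (f : Cplx -> option Cplx) (c : C) (r : R) (F : C -> C) :
  sphere_hol f -> (forall z, Cmod (z - c) < r -> f z = Some (F z)) -> loc_hol f c r F.
Proof.
  intros Hf E z Hz. split; auto.
  destruct (Hf z) as [r' [Hr' [h H]]].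
  set (s := Rmin r' (r - Cmod (z - c))).
  assert (Hs : s > 0) by (apply Rmin_glb_lt; lra).
  assert (S1 : s <= r') by apply Rmin_l. assert (S2 : s <= r - Cmod (z - c)) by apply Rmin_r.
  assert (In_r : forall w, Cmod (w - z) < s -> f w = Some (F w)).
  { intros w Hw. apply E. assert (T := Cmod_minus_triangle w z c). lra. }
  assert (Zz : Cmod (z - z) < s) by (rewrite Cmod_minus_diag; lra).
  destruct H as [H|H].
  - apply (diff_at_ext_loc h F z s); auto; [|apply H; lra].
    intros w Hw. destruct (H w ltac:(lra)) as [_ E1]. rewrite (In_r w Hw) in E1. congruence.
  - assert (K : forall w, Cmod (w - z) < s -> F w <> 0%C /\ h w = (/ F w)%C).
    { intros w Hw. destruct (H w ltac:(lra)) as [_ E1]. rewrite (In_r w Hw) in E1. simpl in E1.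
      destruct (Ceq_dec (F w) (RtoC 0)) as [X|X]; [discriminate|]. split; auto. congruence. }
    apply (diff_at_ext_loc (fun w => / h w)%C F z s); auto.
    + intros w Hw. destruct (K w Hw) as [N ->]. field. exact N.
    + apply diff_at_inv; [|apply H; lra]. destruct (K z Zz) as [N ->].
      now apply Cinv_neq_0.
Qed.

Lemma AE_sphere_charts (f : Cplx -> option Cplx) :
  AE_sphere f -> exists r, r > 0 /\ forall s, 0 < s <= r -> charts f s.
Proof.
  intro Hf. destruct (AE_sphere_unif_cont f (1 / 4) Hf) as [r [Hr H]]; [lra|].
  exists r. split; auto. intros s Hs c Hc.
  (* By [E] below, the default 0 is never taken on the disc. *)
  set (F := fun z => match f z with Some w => w | None => RtoC 0 end).
  assert (E : forall z, Cmod (z - c) < s -> f z = Some (F z) /\ Cmod (F z) <= 2).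
  { intros z Hz. destruct (near_small (f c) (f z) (1 / 4) Hc) as [y [Ey Hy]]; [lra| |].
    - rewrite rho_S_sym. apply H. lra.
    - unfold F. rewrite Ey. auto. }
  exists F. split; [|intros; now apply E].
  apply sphere_hol_loc_hol; [apply Hf | intros; now apply E].
Qed.

(** * Uniform nonconstancy and clusters of zeros *)

Definition osc_lt (f : Cplx -> option Cplx) (c : C) (s e : R) : Prop :=
  forall z, Cmod (z - c) < s -> rho_S (f z) (f c) < e.

(** A quantitative identity theorem. Small oscillation on the inner disc makes the first [N] Taylor
    coefficients small; the bound 4 on the large disc controls the remainder. Together they bound
    the oscillation on the doubled disc. *)
Lemma osc_propagate_small (f : Cplx -> option Cplx) (r e : R) :
  r > 0 -> charts f r -> e > 0 -> exists d, d > 0 /\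
    forall c, small (f c) -> osc_lt f c (r / 256) d -> osc_lt f c (r / 128) e.
Proof.
  intros Hr Hch He.
  destruct (div_pow2_small 4 (e / 8)) as [N' HN']; [lra|].
  set (N := S N').
  assert (HN : 4 / 2 ^ N < e / 8).
  { eapply Rle_lt_trans; [|exact HN']. apply Rmult_le_compat_l; [lra|].
    apply Rinv_le_contravar; [apply pow_lt; lra|]. unfold N. simpl.
    assert (0 < 2 ^ N') by (apply pow_lt; lra). lra. }
  assert (PN : 0 < INR N) by (apply lt_0_INR; unfold N; lia).
  assert (P128 : 0 < 128 ^ N) by (apply pow_lt; lra).
  (* Passing from the coefficient bound at radius [r / 256] to values at [r / 128] costs [128 ^ n];
     this [d] makes the partial sum at most [e / 8]. *)
  set (d := e / (20 * INR N * 128 ^ N)).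
  assert (Hd : 0 < d).
  { apply Rdiv_lt_0_compat; [lra|]. apply Rmult_lt_0_compat; [lra | exact P128]. }
  exists d. split; auto. intros c Hc Hosc z Hz.
  destruct (Hch c Hc) as [F [HF BF]].
  assert (Cc : Cmod (c - c) = 0) by apply Cmod_minus_diag.
  assert (Ec : f c = Some (F c)) by (apply HF; lra).
  set (E := fun z => (F z - F c)%C).
  assert (DE : forall z, Cmod (z - c) < r -> diff_at E z).
  { intros w Hw. apply (diff_at_minus F (fun _ => F c)); [now apply HF | apply diff_at_const]. }
  assert (BE : forall z, Cmod (z - c) < r -> Cmod (E z) <= 4).
  { intros w Hw. unfold E, Cminus. eapply Rle_trans; [apply Cmod_triangle|].
    rewrite Cmod_opp. assert (A := BF w Hw). assert (B := BF c ltac:(lra)). lra. }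
  assert (BE' : forall z, Cmod (z - c) < r / 256 -> Cmod (E z) <= 5 / 2 * d).
  { intros w Hw. unfold E. eapply Rle_trans; [apply rho_S_ge; apply BF; lra|].
    assert (O := Hosc w Hw). destruct (HF w ltac:(lra)) as [_ Ew].
    rewrite Ew, Ec in O. apply Rmult_le_compat_l; [lra|]. left. exact O. }
  destruct (Taylor E c r 4 Hr DE BE) as [a [Ha0 HT]].
  assert (A0 : a O = 0%C) by (rewrite Ha0; unfold E; ring).
  destruct (HT r 4 ltac:(lra) BE) as [_ T1].
  destruct (HT (r / 256) (5 / 2 * d) ltac:(lra) BE') as [T2 _].
  assert (T3 := T1 N z ltac:(lra)).
  assert (W : 4 * (64 / r * Cmod (z - c)) ^ N <= 4 / 2 ^ N).
  { unfold Rdiv at 2. rewrite <- pow_inv. apply Rmult_le_compat_l; [lra|]. apply pow_incr. split.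
    - apply Rmult_le_pos; [|apply Cmod_ge_0]. left. apply Rdiv_lt_0_compat; lra.
    - apply Rle_trans with (64 / r * (r / 128)).
      + apply Rmult_le_compat_l; [left; apply Rdiv_lt_0_compat; lra | lra].
      + right. field. lra. }
  assert (S : Cmod (psum a (z - c) N - a O * (z - c) ^ 0) <= INR N * (5 / 2 * d * 128 ^ N)).
  { apply psum_minus_term; [apply Rmult_le_pos; lra| |unfold N; lia].
    intros n Hn _.
    apply Rle_trans with (5 / 2 * d * (64 / (r / 256)) ^ n * (r / 128) ^ n).
    - apply Rmult_le_compat; [apply Cmod_ge_0 | apply pow_le, Cmod_ge_0 | apply T2 |].
      apply pow_incr. split; [apply Cmod_ge_0 | lra].
    - rewrite Rmult_assoc, <- Rpow_mult_distr.
      replace (64 / (r / 256) * (r / 128)) with 128 by (field; lra).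
      apply Rmult_le_compat_l; [lra|]. apply Rle_pow; [lra | lia]. }
  rewrite A0 in S. replace (psum a (z - c) N - 0 * (z - c) ^ 0)%C with (psum a (z - c) N) in S by ring.
  replace (INR N * (5 / 2 * d * 128 ^ N)) with (e / 8) in S by (unfold d; field; lra).
  assert (X : Cmod (F z - F c) < e / 4).
  { change (Cmod (E z) < e / 4).
    replace (E z) with ((E z - psum a (z - c) N) + psum a (z - c) N)%C by ring.
    eapply Rle_lt_trans; [apply Cmod_triangle|]. lra. }
  destruct (HF z ltac:(lra)) as [_ Ez]. rewrite Ez, Ec.
  eapply Rle_lt_trans; [apply rho_S_le|]. lra.
Qed.

Lemma osc_propagate (f : Cplx -> option Cplx) (r e : R) :
  r > 0 -> charts f r -> charts (fun z => inv_S (f z)) r -> e > 0 -> exists d, d > 0 /\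
    forall c, osc_lt f c (r / 256) d -> osc_lt f c (r / 128) e.
Proof.
  intros Hr H1 H2 He.
  destruct (osc_propagate_small f r e Hr H1 He) as [d1 [P1 D1]].
  destruct (osc_propagate_small _ r e Hr H2 He) as [d2 [P2 D2]].
  exists (Rmin d1 d2). split; [now apply Rmin_glb_lt|]. intros c Hc.
  destruct (small_or_inv_small (f c)) as [S|S].
  - apply D1; auto. intros z Hz. eapply Rlt_le_trans; [now apply Hc | apply Rmin_l].
  - intros z Hz. rewrite <- rho_S_inv. apply (D2 c S); auto.
    intros w Hw. rewrite rho_S_inv. eapply Rlt_le_trans; [now apply Hc | apply Rmin_r].
Qed.

(* Walk along radii from [c] in steps of length [r / 256]. *)
Lemma osc_propagate_far (f : Cplx -> option Cplx) (r : R) :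
  r > 0 -> charts f r -> charts (fun z => inv_S (f z)) r -> forall n e, e > 0 ->
  exists d, d > 0 /\ forall c, osc_lt f c (r / 256) d -> osc_lt f c (INR (S n) * (r / 256)) e.
Proof.
  intros Hr H1 H2. induction n as [|n IH]; intros e He.
  - exists e. split; auto. intros c Hc. simpl INR. now rewrite Rmult_1_l.
  - destruct (osc_propagate f r (e / 4) Hr H1 H2) as [d1 [P1 D1]]; [lra|].
    destruct (IH (Rmin (d1 / 4) (e / 4))) as [d [Pd D]]; [apply Rmin_glb_lt; lra|].
    assert (M1 := Rmin_l (d1 / 4) (e / 4)). assert (M2 := Rmin_r (d1 / 4) (e / 4)).
    exists d. split; auto. intros c Hc z Hz. specialize (D c Hc).
    assert (Pn := pos_INR n). rewrite !S_INR in Hz. unfold osc_lt in D. rewrite S_INR in D.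
    set (x := INR n) in *.
    (* On the segment from [c] to [z], two steps of length [r / 256] short of the new radius: the
       disc of radius [r / 256] about [c'] lies in the disc already handled, and the doubled one
       contains [z]. *)
    set (c' := (c + RtoC (x / (x + 2)) * (z - c))%C).
    assert (Q : 0 <= x / (x + 2)).
    { unfold Rdiv. apply Rmult_le_pos; auto. left. apply Rinv_0_lt_compat. lra. }
    assert (Q' : 0 < 2 / (x + 2)) by (apply Rdiv_lt_0_compat; lra).
    assert (Hc' : Cmod (c' - c) <= x * (r / 256)).
    { unfold c'. replace (c + RtoC (x / (x + 2)) * (z - c) - c)%C
        with (RtoC (x / (x + 2)) * (z - c))%C by ring.
      rewrite Cmod_mult, Cmod_R, Rabs_pos_eq by auto.
      apply Rle_trans with (x / (x + 2) * ((x + 1 + 1) * (r / 256))).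
      - apply Rmult_le_compat_l; lra.
      - right. field. lra. }
    assert (Hz' : Cmod (z - c') < r / 128).
    { replace (z - c')%C with (RtoC (2 / (x + 2)) * (z - c))%C.
      - rewrite Cmod_mult, Cmod_R, Rabs_pos_eq by lra.
        apply Rlt_le_trans with (2 / (x + 2) * ((x + 1 + 1) * (r / 256))).
        + apply Rmult_lt_compat_l; lra.
        + right. field. lra.
      - unfold c'. replace (2 / (x + 2)) with (1 - x / (x + 2)) by (field; lra).
        rewrite RtoC_minus. ring. }
    assert (Bc' : rho_S (f c') (f c) < Rmin (d1 / 4) (e / 4)) by (apply D; lra).
    assert (O : osc_lt f c' (r / 256) d1).
    { intros w Hw. assert (T := Cmod_minus_triangle w c' c).
      assert (A := D w ltac:(lra)).
      assert (T2 := rho_S_quasi_triangle (f w) (f c) (f c')).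
      rewrite (rho_S_sym (f c) (f c')) in T2. lra. }
    assert (A := D1 c' O z Hz').
    assert (T := rho_S_quasi_triangle (f z) (f c') (f c)). lra.
Qed.

(** If [f] were nearly constant on one small disc, it would be so on a disc large enough to contain
    [z1 + t] and [z2 + t] for some almost period [t], and then [f z1] and [f z2] would be too
    close. *)
Lemma AE_sphere_uniformly_nonconstant (f : Cplx -> option Cplx) (r : R) :
  AE_sphere f -> r > 0 -> charts f r -> charts (fun z => inv_S (f z)) r ->
  exists kap, kap > 0 /\ forall c, exists z, Cmod (z - c) < r / 256 /\ kap <= rho_S (f z) (f c).
Proof.
  intros (_ & (z1 & z2 & N) & Hap) Hr H1 H2.
  set (d := rho_S (f z1) (f z2)). assert (Pd : 0 < d) by now apply rho_S_gt_0.
  destruct (Hap (d / 16)) as [L [HL Ht]]; [lra|].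
  set (R0 := L + Cmod (z2 - z1)).
  destruct (INR_unbounded (R0 / (r / 256))) as [n Hn].
  assert (HR : R0 < INR (S n) * (r / 256)).
  { apply Rlt_div_l in Hn; [|lra]. rewrite S_INR. nra. }
  destruct (osc_propagate_far f r Hr H1 H2 n (d / 32)) as [k [Pk Hk]]; [lra|].
  exists k. split; auto. intro c. apply NNPP. intro Nz.
  assert (O : osc_lt f c (r / 256) k).
  { intros z Hz. apply Rnot_le_lt. intro Le. apply Nz. now exists z. }
  specialize (Hk c O).
  destruct (Ht (c - z1)%C) as [t [Ap Hc]]. change (Cmod (t - (c - z1)) < L) in Hc.
  assert (X1 : rho_S (f (z1 + t)%C) (f c) < d / 32).
  { apply Hk. replace (z1 + t - c)%C with (t - (c - z1))%C by ring.
    assert (T := Cmod_ge_0 (z2 - z1)). unfold R0 in HR. lra. }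
  assert (X2 : rho_S (f (z2 + t)%C) (f c) < d / 32).
  { apply Hk. replace (z2 + t - c)%C with ((t - (c - z1)) + (z2 - z1))%C by ring.
    eapply Rle_lt_trans; [apply Cmod_triangle|]. unfold R0 in HR. lra. }
  assert (Y1 : rho_S (f (z1 + t)%C) (f z1) < d / 16) by apply Ap.
  assert (Y2 : rho_S (f (z2 + t)%C) (f z2) < d / 16) by apply Ap.
  (* From [Q3] up to [Q1] the distances are bounded by [d / 8], [3 * d / 8] and [7 * d / 8], which
     is less than [d]. *)
  assert (Q1 := rho_S_quasi_triangle (f z1) (f (z1 + t)%C) (f z2)).
  assert (Q2 := rho_S_quasi_triangle (f (z1 + t)%C) (f (z2 + t)%C) (f z2)).
  assert (Q3 := rho_S_quasi_triangle (f (z1 + t)%C) (f c) (f (z2 + t)%C)).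
  rewrite (rho_S_sym (f z1) (f (z1 + t)%C)) in Q1. rewrite (rho_S_sym (f c)) in Q3.
  fold d in Q1. lra.
Qed.

(** * Zeros of a translate and common clusters *)

Lemma diff_at_shift (F : C -> C) (t z : C) :
  diff_at F (z + t)%C -> diff_at (fun w => F (w + t)%C) z.
Proof.
  rewrite !diff_at_iff. intros [q [Hq E]]. exists (fun w => q (w + t)%C). split.
  - intros e He. destruct (Hq e He) as [d [Hd H]]. exists d. split; auto.
    intros w Hw. apply H. replace (w + t - (z + t))%C with (w - z)%C by ring. exact Hw.
  - intro w. rewrite (E (w + t)%C). ring.
Qed.

Lemma zero_order_shift_aux (f : Cplx -> option Cplx) (t a : C) (m : nat) :
  zero_order f (a + t)%C m -> zero_order (fun z => f (z + t)%C) a m.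
Proof.
  intros [Hm [r [Hr [h [Hh [Nh E]]]]]]. split; auto. exists r. split; auto.
  exists (fun z => h (z + t)%C). split; [|split; auto].
  - intros z Hz. apply (diff_at_shift h t z), Hh.
    change (Cmod (z + t - (a + t)) < r). replace (z + t - (a + t))%C with (z - a)%C by ring. exact Hz.
  - intros z Hz. change (f (z + t)%C = Some ((z - a) ^ m * h (z + t))%C).
    replace (z - a)%C with (z + t - (a + t))%C by ring. apply E.
    change (Cmod (z + t - (a + t)) < r). replace (z + t - (a + t))%C with (z - a)%C by ring. exact Hz.
Qed.

Lemma zero_order_shift (f : Cplx -> option Cplx) (t a : C) (m : nat) :
  zero_order (fun z => f (z + t)%C) a m <-> zero_order f (a + t)%C m.
Proof.
  split; [|apply zero_order_shift_aux]. intro H.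
  assert (H' := zero_order_shift_aux (fun z => f (z + t)%C) (- t)%C (a + t)%C m).
  simpl in H'. replace (a + t + - t)%C with a in H' by ring. specialize (H' H).
  replace f with (fun z : Cplx => f (z + - t + t)%C); auto.
  apply functional_extensionality. intro z. f_equal. change ((z + - t + t)%C = z). ring.
Qed.

Lemma zero_order_zero (f : Cplx -> option Cplx) (a : C) (m : nat) :
  zero_order f a m -> f a = Some (RtoC 0).
Proof.
  intros [Hm [r [Hr [h [_ [_ E]]]]]]. rewrite (E a).
  - apply (f_equal (@Some C)). change (((a - a) ^ m * h a)%C = 0%C).
    destruct m as [|m]; [lia|]. rewrite Cpow_S. ring.
  - change (Cmod (a - a) < r). rewrite Cmod_minus_diag. lra.
Qed.

(** In particular there is no zero with [s / 4 < Cmod (a - c) < s], since such a point has count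
    0. *)
Definition zeros_in_disc (f : Cplx -> option Cplx) (c : C) (s : R) (l : list C) : Prop :=
  (forall a, In a l -> Cmod (a - c) <= s / 4) /\
  forall a m, Cmod (a - c) < s -> (zero_order f a m <-> (1 <= m)%nat /\ m = count_occ Ceq_dec l a).

Lemma factors_on_zeros_in_disc (f : Cplx -> option Cplx) (F : C -> C) (c : C) (s : R) (k : nat) :
  factors_on F c s k -> (forall z, Cmod (z - c) < s -> f z = Some (F z)) ->
  exists l, length l = k /\ zeros_in_disc f c s l.
Proof.
  intros [l [u [Hl [Hin Hu]]]] E. exists l. split; auto. split; auto.
  apply (zero_order_of_factor f c s l u). intros z Hz.
  destruct (Hu z Hz) as (U1 & U2 & U3). rewrite (E z Hz), U3. auto.
Qed.

Lemma near_zero_small (u v : option Cplx) (d : R) :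
  u = Some (RtoC 0) -> d <= 1 / 4 -> rho_S u v < d -> small v.
Proof.
  intros -> Hd H.
  destruct (near_small (Some (RtoC 0)) v d) as [y [-> Hy]]; auto.
  - exists (RtoC 0). split; auto. rewrite Cmod_0. lra.
  - exists y. split; auto.
    assert (T := rho_S_ge (RtoC 0) y). rewrite Cmod_0 in T.
    specialize (T ltac:(lra) Hy). replace (0 - y)%C with (- y)%C in T by ring.
    rewrite Cmod_opp in T. change (rho_S (Some (RtoC 0)) (Some y) < d) in H. lra.
Qed.

(** Zeros of the translate are allowed as centres too, because every entry of either divisor has to
    lie in some cluster. If one of the two functions vanishes at [c], the other is small there, so
    both have bounded charts. *)
Lemma almost_period_clusters (f : Cplx -> option Cplx) (eta : R) :
  AE_sphere f -> eta > 0 ->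
  exists d s0 q, d > 0 /\ 0 < s0 <= eta /\ 0 < q < 1 /\
    forall t, almost_period_f f d t -> forall c,
      f c = Some (RtoC 0) \/ f (c + t)%C = Some (RtoC 0) ->
      exists j l1 l2, length l1 = length l2 /\ zeros_in_disc f c (s0 * q ^ j) l1 /\
        zeros_in_disc (fun z => f (z + t)%C) c (s0 * q ^ j) l2.
Proof.
  intros Hf He.
  destruct (AE_sphere_charts f Hf) as [r1 [Hr1 C1]].
  destruct (AE_sphere_charts _ (AE_sphere_inv f Hf)) as [r2 [Hr2 C2]].
  set (r := Rmin r1 r2). assert (Hr : r > 0) by now apply Rmin_glb_lt.
  specialize (C1 r (conj Hr (Rmin_l _ _))). specialize (C2 r (conj Hr (Rmin_r _ _))).
  destruct (AE_sphere_uniformly_nonconstant f r Hf Hr C1 C2) as [kap [Hk Hnc]].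
  destruct (uniform_cluster r 2 (kap / 2) eta Hr) as [m [s0 [q [J [Hm [Hs0 [Hsr [Hq Hcl]]]]]]]]; try lra.
  (* [1 / 4] is what [near_zero_small] asks for, and [5 / 2 * (m / 3) <= m] turns spherical into
     Euclidean closeness. *)
  exists (Rmin (1 / 4) (m / 3)), s0, q. split; [apply Rmin_glb_lt; lra|]. split; auto. split; auto.
  assert (D1 := Rmin_l (1 / 4) (m / 3)). assert (D2 := Rmin_r (1 / 4) (m / 3)).
  intros t Ht c Hc.
  assert (Ht' : forall z : C, rho_S (f (z + t)%C) (f z) < Rmin (1 / 4) (m / 3)) by exact Ht.
  assert (S0 : forall v, v = Some (RtoC 0) -> small v).
  { intros v ->. exists (RtoC 0). split; auto. rewrite Cmod_0. lra. }
  assert (Sc : small (f c) /\ small (f (c + t)%C)).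
  { destruct Hc as [E|E]; split; auto; eapply near_zero_small; try exact E; try exact D1.
    - rewrite rho_S_sym. apply Ht'.
    - apply Ht'. }
  destruct Sc as [Sf Sg].
  destruct (C1 c Sf) as [F [HF BF]]. destruct (C1 _ Sg) as [G0 [HG BG]].
  assert (Sh : forall z : C, (z + t - (c + t))%C = (z - c)%C) by (intro; ring).
  destruct (Hcl c F) as [j [k [_ Hj]]]; auto.
  { intros z Hz. now apply HF. }
  { destruct (Hnc c) as [z [Hz1 Hz2]]. exists z. split; [lra|].
    destruct (HF z ltac:(lra)) as [_ E1].
    destruct (HF c) as [_ E2]; [rewrite Cmod_minus_diag; lra|].
    rewrite E1, E2 in Hz2. assert (T := rho_S_le (F z) (F c)). lra. }
  set (s := s0 * q ^ j) in *.
  assert (Hs : s <= r).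
  { unfold s. assert (q ^ j <= 1). { rewrite <- (pow1 j). apply pow_incr. lra. }
    assert (0 < q ^ j) by (apply pow_lt; lra). nra. }
  (* The cluster statement is used twice with the same [j] and [k]: for [F] itself, then for the
     translate. *)
  destruct (factors_on_zeros_in_disc f F c s k) as [l1 [L1 Z1]].
  { apply Hj.
    - intros z Hz. apply HF. lra.
    - intros z Hz. rewrite Cmod_minus_diag. lra. }
  { intros z Hz. apply HF. lra. }
  destruct (factors_on_zeros_in_disc (fun z => f (z + t)%C) (fun z => G0 (z + t)%C) c s k)
    as [l2 [L2 Z2]].
  { apply Hj.
    - intros z Hz. apply diff_at_shift, HG. rewrite Sh. lra.
    - intros z Hz. destruct (HF z ltac:(lra)) as [_ E1].
      destruct (HG (z + t)%C) as [_ E2]; [rewrite Sh; lra|].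
      assert (X := Ht' z). rewrite E1, E2 in X.
      eapply Rle_trans; [apply rho_S_ge|].
      + apply BG. rewrite Sh. lra.
      + apply BF. lra.
      + lra. }
  { intros z Hz. apply HG. rewrite Sh. lra. }
  exists j, l1, l2. split; [congruence | auto].
Qed.

(** * Matching clusters *)

(** Labels the copies of a repeated point by 1, 2, ..., the same encoding of multiplicity as in
    [zero_list]. *)
Definition entry (l : list C) (p : C * nat) : Prop :=
  (1 <= snd p <= count_occ Ceq_dec l (fst p))%nat.

Lemma entry_cons (x : C) (l : list C) (p : C * nat) :
  entry (x :: l) p <-> entry l p \/ p = (x, S (count_occ Ceq_dec l x)).
Proof.
  unfold entry. destruct p as [a n]. simpl. destruct (Ceq_dec x a) as [->|N].
  - split.
    + intros [H1 H2]. destruct (Nat.eq_dec n (S (count_occ Ceq_dec l a))) as [->|E]; auto.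
      left. lia.
    + intros [H|H]; [lia|]. injection H as ->. lia.
  - split; [auto|]. intros [H|H]; auto. congruence.
Qed.

Lemma entry_fresh (x : C) (l : list C) : ~ entry l (x, S (count_occ Ceq_dec l x)).
Proof. unfold entry. simpl. lia. Qed.

(** By induction, the new topmost copy of [x] is matched with the new topmost copy of [y]. The maps
    are total but mutually inverse only on entries. *)
Lemma entries_bijection (l1 l2 : list C) :
  length l1 = length l2 -> exists g h : C * nat -> C * nat,
    (forall p, entry l1 p -> entry l2 (g p) /\ h (g p) = p) /\
    (forall p, entry l2 p -> entry l1 (h p) /\ g (h p) = p).
Proof.
  revert l2. induction l1 as [|x l1 IH]; intros [|y l2] E; try discriminate.
  - exists (fun p => p), (fun p => p). split; intros p Hp; unfold entry in Hp; simpl in Hp; lia.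
  - injection E as E. destruct (IH l2 E) as [g [h [Hg Hh]]].
    set (u := (x, S (count_occ Ceq_dec l1 x))). set (v := (y, S (count_occ Ceq_dec l2 y))).
    exists (fun p => if excluded_middle_informative (p = u) then v else g p),
           (fun p => if excluded_middle_informative (p = v) then u else h p).
    assert (Fu := entry_fresh x l1). assert (Fv := entry_fresh y l2). fold u in Fu. fold v in Fv.
    split; intros p Hp; apply entry_cons in Hp; fold u v in Hp; rewrite entry_cons; fold u v.
    + destruct (excluded_middle_informative (p = u)) as [->|N].
      * split; auto. now destruct (excluded_middle_informative (v = v)).
      * destruct Hp as [Hp|Hp]; [|contradiction]. destruct (Hg p Hp) as [A B]. split; auto.
        destruct (excluded_middle_informative (g p = v)) as [X|_]; auto.
        rewrite X in A. contradiction.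
    + destruct (excluded_middle_informative (p = v)) as [->|N].
      * split; auto. now destruct (excluded_middle_informative (u = u)).
      * destruct Hp as [Hp|Hp]; [|contradiction]. destruct (Hh p Hp) as [A B]. split; auto.
        destruct (excluded_middle_informative (h p = u)) as [X|_]; auto.
        rewrite X in A. contradiction.
Qed.

Definition near (c : C) (s : R) (p : C * nat) : Prop := Cmod (fst p - c) <= s / 4.

Definition cluster_maps (Z1 Z2 : C * nat -> Prop) (c : C) (s : R)
  (gh : (C * nat -> C * nat) * (C * nat -> C * nat)) : Prop :=
  (forall p, Z1 p -> near c s p -> Z2 (fst gh p) /\ near c s (fst gh p) /\ snd gh (fst gh p) = p) /\
  (forall p, Z2 p -> near c s p -> Z1 (snd gh p) /\ near c s (snd gh p) /\ fst gh (snd gh p) = p).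

(* The annulus between radii [s / 4] and [s] is empty, which makes the
   clusters a laminar family. *)
Definition cluster (Z1 Z2 : C * nat -> Prop) (c : C) (s : R) : Prop :=
  0 < s /\ (exists gh, cluster_maps Z1 Z2 c s gh) /\
  forall p, Z1 p \/ Z2 p -> Cmod (fst p - c) < s -> near c s p.

(** The point of [q] is within [s' / 2] of that of [p], hence within [3 * s / 4 < s] of [c]; the
    empty annulus then leaves only [near]. *)
Lemma cluster_absorb (Z1 Z2 : C * nat -> Prop) (c c' : C) (s s' : R) (p q : C * nat) :
  cluster Z1 Z2 c s -> s' <= s -> near c s p -> near c' s' p -> near c' s' q -> Z1 q \/ Z2 q ->
  near c s q.
Proof.
  intros (Hs & _ & Hann) Hss Hp Hp' Hq' Hq. apply Hann; auto. unfold near in *.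
  assert (T1 := Cmod_minus_triangle (fst q) c' c).
  assert (T2 := Cmod_minus_triangle c' (fst p) c). rewrite (Cmod_minus_sym c' (fst p)) in T2. lra.
Qed.

Lemma least_nat (P : nat -> Prop) (n : nat) :
  P n -> exists m, P m /\ forall k, P k -> (m <= k)%nat.
Proof.
  induction n as [n IH] using (well_founded_induction lt_wf). intro H.
  destruct (classic (exists k, (k < n)%nat /\ P k)) as [[k [L K]]|N]; [eauto|].
  exists n. split; auto. intros k K. apply Nat.nlt_ge. intro L. apply N. eauto.
Qed.

Definition in_cluster (Z1 Z2 : C * nat -> Prop) (s : nat -> R) (j : nat) (p : C * nat) (c : C) : Prop :=
  cluster Z1 Z2 c (s j) /\ near c (s j) p.

(** The radii decrease in [j], so the least index is the largest cluster. *)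
Definition top_scale (Z1 Z2 : C * nat -> Prop) (s : nat -> R) (p : C * nat) : nat :=
  epsilon (inhabits O) (fun j => (exists c, in_cluster Z1 Z2 s j p c) /\
    forall i c, in_cluster Z1 Z2 s i p c -> (j <= i)%nat).

(* The point [p] enters only through a predicate on centres that is the same
   for all points of the cluster, so the choice is constant on clusters. *)
Definition top_center (Z1 Z2 : C * nat -> Prop) (s : nat -> R) (p : C * nat) : C :=
  epsilon (inhabits (RtoC 0)) (in_cluster Z1 Z2 s (top_scale Z1 Z2 s p) p).

Definition top_maps (Z1 Z2 : C * nat -> Prop) (s : nat -> R) (p : C * nat) :
  (C * nat -> C * nat) * (C * nat -> C * nat) :=
  epsilon (inhabits (fun p => p, fun p => p))
    (cluster_maps Z1 Z2 (top_center Z1 Z2 s p) (s (top_scale Z1 Z2 s p))).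

Definition scaled_clusters (Z1 Z2 : C * nat -> Prop) (s : nat -> R) : Prop :=
  (forall i j, (i <= j)%nat -> s j <= s i) /\
  forall p, Z1 p \/ Z2 p -> exists j, cluster Z1 Z2 (fst p) (s j).

Lemma top_scale_spec (Z1 Z2 : C * nat -> Prop) (s : nat -> R) (p : C * nat) :
  scaled_clusters Z1 Z2 s -> Z1 p \/ Z2 p ->
  (exists c, in_cluster Z1 Z2 s (top_scale Z1 Z2 s p) p c) /\
  forall i c, in_cluster Z1 Z2 s i p c -> (top_scale Z1 Z2 s p <= i)%nat.
Proof.
  intros [_ Hcl] Hp.
  apply (epsilon_spec (inhabits O) (fun j => (exists c, in_cluster Z1 Z2 s j p c) /\
    forall i c, in_cluster Z1 Z2 s i p c -> (j <= i)%nat)).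
  destruct (Hcl p Hp) as [n Hn].
  destruct (least_nat (fun j => exists c, in_cluster Z1 Z2 s j p c) n) as [j [Hj Hmin]].
  - exists (fst p). split; auto. unfold near. rewrite Cmod_minus_diag. destruct Hn. lra.
  - exists j. split; auto. intros i c H. apply Hmin. now exists c.
Qed.

Lemma top_center_spec (Z1 Z2 : C * nat -> Prop) (s : nat -> R) (p : C * nat) :
  scaled_clusters Z1 Z2 s -> Z1 p \/ Z2 p ->
  in_cluster Z1 Z2 s (top_scale Z1 Z2 s p) p (top_center Z1 Z2 s p).
Proof. intros Hs Hp. unfold top_center. apply epsilon_spec. now apply top_scale_spec. Qed.

Lemma top_maps_spec (Z1 Z2 : C * nat -> Prop) (s : nat -> R) (p : C * nat) :
  scaled_clusters Z1 Z2 s -> Z1 p \/ Z2 p ->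
  cluster_maps Z1 Z2 (top_center Z1 Z2 s p) (s (top_scale Z1 Z2 s p)) (top_maps Z1 Z2 s p).
Proof.
  intros Hs Hp. unfold top_maps. apply epsilon_spec.
  destruct (top_center_spec Z1 Z2 s p Hs Hp) as [(_ & H & _) _]. exact H.
Qed.

(** A largest cluster of [q] absorbs [p], so the two scales agree. At a common scale, clusters that
    share an entry have the same entries; the predicates on centres are therefore equal, and
    [epsilon] makes the same choice. *)
Lemma top_maps_constant (Z1 Z2 : C * nat -> Prop) (s : nat -> R) (p q : C * nat) :
  scaled_clusters Z1 Z2 s -> Z1 p \/ Z2 p -> Z1 q \/ Z2 q ->
  near (top_center Z1 Z2 s p) (s (top_scale Z1 Z2 s p)) q ->
  top_maps Z1 Z2 s q = top_maps Z1 Z2 s p.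
Proof.
  intros Hs Hp Hq Hnear.
  destruct (top_scale_spec Z1 Z2 s p Hs Hp) as [_ Mp].
  destruct (top_scale_spec Z1 Z2 s q Hs Hq) as [[c Hc] Mq].
  destruct (top_center_spec Z1 Z2 s p Hs Hp) as [Gp Np].
  unfold top_maps. set (c0 := top_center Z1 Z2 s p) in *. set (j := top_scale Z1 Z2 s p) in *.
  assert (L : (top_scale Z1 Z2 s q <= j)%nat) by (apply (Mq _ c0); split; auto).
  assert (L' : (j <= top_scale Z1 Z2 s q)%nat).
  { apply (Mp _ c). split; [apply Hc|].
    apply (cluster_absorb Z1 Z2 c c0 (s (top_scale Z1 Z2 s q)) (s j) q p); auto;
      [apply Hc | now apply Hs | apply Hc]. }
  assert (Es : top_scale Z1 Z2 s q = j) by lia.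
  assert (Ec : top_center Z1 Z2 s q = c0).
  { unfold c0, top_center. rewrite Es. fold j. f_equal. apply functional_extensionality. intro c'.
    apply propositional_extensionality. split; intros [G N]; split; auto.
    - apply (cluster_absorb Z1 Z2 c' c0 (s j) (s j) q p); auto; lra.
    - apply (cluster_absorb Z1 Z2 c' c0 (s j) (s j) p q); auto; lra. }
  now rewrite Es, Ec.
Qed.

(** The local maps glue to mutually inverse ones because the image of [p] stays in the cluster of
    [p], where the same pair of maps is chosen. Both points are within a quarter radius of its
    centre, whence [s O / 2]. *)
Lemma laminar_matching (Z1 Z2 : C * nat -> Prop) (s : nat -> R) :
  scaled_clusters Z1 Z2 s -> exists g h : C * nat -> C * nat,
  (forall p, Z1 p -> Z2 (g p) /\ h (g p) = p /\ Cmod (fst p - fst (g p)) <= s O / 2) /\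
  (forall p, Z2 p -> Z1 (h p) /\ g (h p) = p).
Proof.
  intro Hs. set (maps := top_maps Z1 Z2 s).
  exists (fun p => fst (maps p) p), (fun p => snd (maps p) p).
  split; intros p Hp; assert (Hp' : Z1 p \/ Z2 p) by auto;
    destruct (top_center_spec Z1 Z2 s p Hs Hp') as [_ Np].
  - destruct (proj1 (top_maps_spec Z1 Z2 s p Hs Hp') p Hp Np) as (A & B & D).
    split; auto. unfold maps. rewrite (top_maps_constant Z1 Z2 s p (fst (top_maps Z1 Z2 s p) p)) by auto.
    split; auto.
    unfold near in *.
    assert (T := Cmod_minus_triangle (fst p) (top_center Z1 Z2 s p) (fst (fst (maps p) p))).
    rewrite (Cmod_minus_sym (top_center Z1 Z2 s p)) in T.
    assert (S := proj1 Hs O (top_scale Z1 Z2 s p) ltac:(lia)). unfold maps in T. lra.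
  - destruct (proj2 (top_maps_spec Z1 Z2 s p Hs Hp') p Hp Np) as (A & B & D).
    split; auto. unfold maps. rewrite (top_maps_constant Z1 Z2 s p (snd (top_maps Z1 Z2 s p) p)) by auto.
    exact D.
Qed.

(** * From matchings to bijections of the divisor *)

Definition listed (O : Cplx -> nat -> Prop) (p : Cplx * nat) : Prop :=
  exists m, O (fst p) m /\ (1 <= snd p)%nat /\ (snd p <= m)%nat.

Definition shift_bijection (O : Cplx -> nat -> Prop) (eps : R) (tau : Cplx) : Prop :=
  exists sigma : {p | listed O p} -> {p | listed O p}, bijective sigma /\
    forall n, Cnorm (Csub (Cadd (fst (proj1_sig n)) tau) (fst (proj1_sig (sigma n)))) < eps.

(** The entries of the translate are those of [f] moved by [- t], so [g] followed by the shift by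
    [t] permutes the entries of [f]; the distance to [p + t] equals that from [p] to [g p]. *)
Lemma shift_bijection_of_maps (O : Cplx -> nat -> Prop) (eps : R) (t : C)
  (g h : C * nat -> C * nat) :
  (forall p, listed O p -> listed (fun a => O (a + t)%C) (g p) /\ h (g p) = p /\
     Cmod (fst p - fst (g p)) < eps) ->
  (forall p, listed (fun a => O (a + t)%C) p -> listed O (h p) /\ g (h p) = p) ->
  shift_bijection O eps t.
Proof.
  intros Hg Hh.
  set (up := fun p : C * nat => ((fst p + t)%C, snd p)).
  set (dn := fun p : C * nat => ((fst p - t)%C, snd p)).
  assert (UD : forall p, up (dn p) = p).
  { intros [a n]. unfold up, dn. simpl. f_equal. change ((a - t + t)%C = a). ring. }
  assert (DU : forall p, dn (up p) = p).
  { intros [a n]. unfold up, dn. simpl. f_equal. change ((a + t - t)%C = a). ring. }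
  assert (Ldn : forall p, listed O p -> listed (fun a => O (a + t)%C) (dn p)).
  { intros p Hp. rewrite <- (UD p) in Hp. exact Hp. }
  assert (Lup : forall p, listed (fun a => O (a + t)%C) p -> listed O (up p)).
  { intros p Hp. exact Hp. }
  set (sg := fun x : {p | listed O p} =>
    exist (listed O) (up (g (proj1_sig x))) (Lup _ (proj1 (Hg _ (proj2_sig x))))).
  set (sh := fun x : {p | listed O p} =>
    exist (listed O) (h (dn (proj1_sig x))) (proj1 (Hh _ (Ldn _ (proj2_sig x))))).
  exists sg. split.
  - exists sh. split; intros [p Hp]; apply eq_sig_hprop; try (intros; apply proof_irrelevance); simpl.
    + rewrite DU. now apply Hg.
    + rewrite (proj2 (Hh _ (Ldn _ Hp))). apply UD.
  - intros [p Hp]. destruct (Hg p Hp) as (_ & _ & D).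
    change (Cmod (fst p + t - (fst (g p) + t)) < eps).
    replace (fst p + t - (fst (g p) + t))%C with (fst p - fst (g p))%C by ring. exact D.
Qed.

Lemma zeros_in_disc_entry (f : Cplx -> option Cplx) (c : C) (s : R) (l : list C) (p : C * nat) :
  zeros_in_disc f c s l -> Cmod (fst p - c) < s -> (listed (zero_order f) p <-> entry l p).
Proof.
  intros [_ H] Hp. unfold listed, entry. split.
  - intros [m [Hm [H1 H2]]]. apply (H _ _ Hp) in Hm. destruct Hm as [_ ->]. split; assumption.
  - intros H1. exists (count_occ Ceq_dec l (fst p)). split; [|exact H1].
    apply H; auto. split; auto. exact (Nat.le_trans _ _ _ (proj1 H1) (proj2 H1)).
Qed.

Lemma entry_near (f : Cplx -> option Cplx) (c : C) (s : R) (l : list C) (p : C * nat) :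
  zeros_in_disc f c s l -> entry l p -> near c s p.
Proof.
  intros [H _] Hp. apply H. apply (count_occ_In Ceq_dec). unfold entry in Hp. lia.
Qed.

Lemma zeros_in_disc_cluster (f g : Cplx -> option Cplx) (c : C) (s : R) (l1 l2 : list C) :
  0 < s -> length l1 = length l2 -> zeros_in_disc f c s l1 -> zeros_in_disc g c s l2 ->
  cluster (listed (zero_order f)) (listed (zero_order g)) c s.
Proof.
  intros Hs HL Z1 Z2. split; auto.
  assert (N : forall p, near c s p -> Cmod (fst p - c) < s) by (unfold near; intros; lra).
  destruct (entries_bijection l1 l2 HL) as [u [v [Hu Hv]]]. split.
  - exists (u, v). split; simpl; intros p Hp Hn.
    + apply (zeros_in_disc_entry f c s l1 p Z1 (N p Hn)) in Hp. destruct (Hu p Hp) as [A B].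
      assert (Hn' := entry_near g c s l2 _ Z2 A). split; auto.
      now apply (zeros_in_disc_entry g c s l2 _ Z2 (N _ Hn')).
    + apply (zeros_in_disc_entry g c s l2 p Z2 (N p Hn)) in Hp. destruct (Hv p Hp) as [A B].
      assert (Hn' := entry_near f c s l1 _ Z1 A). split; auto.
      now apply (zeros_in_disc_entry f c s l1 _ Z1 (N _ Hn')).
  - intros p [Hp|Hp] Hn.
    + apply (zeros_in_disc_entry f c s l1 p Z1 Hn) in Hp. now apply (entry_near f c s l1).
    + apply (zeros_in_disc_entry g c s l2 p Z2 Hn) in Hp. now apply (entry_near g c s l2).
Qed.

Lemma AE_sphere_zeros (f : Cplx -> option Cplx) (eps : R) :
  AE_sphere f -> eps > 0 -> exists d, d > 0 /\
    forall t, almost_period_f f d t -> shift_bijection (zero_order f) eps t.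
Proof.
  intros Hf He. destruct (almost_period_clusters f eps Hf He) as [d [s0 [q [Hd [Hs0 [Hq H]]]]]].
  exists d. split; auto. intros t Ht. specialize (H t Ht).
  set (g := fun z : C => f (z + t)%C).
  assert (Eg : zero_order g = fun a => zero_order f (a + t)%C).
  { apply functional_extensionality. intro a. apply functional_extensionality. intro m.
    apply propositional_extensionality. apply zero_order_shift. }
  destruct (laminar_matching (listed (zero_order f)) (listed (zero_order g)) (fun j => s0 * q ^ j))
    as [u [v [Hu Hv]]]; [split|].
  - intros i j Hij. apply Rmult_le_compat_l; [lra|].
    destruct (Nat.le_exists_sub i j Hij) as [k [-> _]]. rewrite pow_add.
    assert (q ^ k <= 1). { rewrite <- (pow1 k). apply pow_incr. lra. }
    assert (0 < q ^ i) by (apply pow_lt; lra). nra.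
  - intros p Hp. destruct (H (fst p)) as [j [l1 [l2 [HL [A B]]]]].
    + destruct Hp as [[m [Hm _]]|[m [Hm _]]]; [left|right]; exact (zero_order_zero _ _ _ Hm).
    + exists j. apply (zeros_in_disc_cluster f g (fst p) _ l1 l2); auto.
      apply Rmult_lt_0_compat; [lra|]. apply pow_lt; lra.
  - rewrite Eg in Hu, Hv. apply (shift_bijection_of_maps _ _ t u v); auto.
    intros p Hp. destruct (Hu p Hp) as (A & B & D). simpl in D.
    split; [exact A|]. split; [exact B|]. eapply Rle_lt_trans; [exact D|]. lra.
Qed.

(** * Poles as zeros of the inverse, and the conclusion *)

Lemma nonzero_nearby (h : C -> C) (z : C) (r : R) :
  r > 0 -> holomorphic_on_disc h z r -> h z <> 0%C ->
  exists d, 0 < d <= r /\ forall w, Cmod (w - z) < d -> h w <> 0%C.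
Proof.
  intros Hr Hh Nz.
  assert (Ch : cont_at h z).
  { apply diff_at_cont, Hh. change (Cmod (z - z) < r). rewrite Cmod_minus_diag. lra. }
  destruct (Ch (Cmod (h z))) as [d [Hd H]]; [now apply Cmod_gt_0|].
  exists (Rmin d r). split; [split; [now apply Rmin_glb_lt | apply Rmin_r]|].
  intros w Hw E. specialize (H w (Rlt_le_trans _ _ _ Hw (Rmin_l _ _))). rewrite E in H.
  replace (0 - h z)%C with (- h z)%C in H by ring. rewrite Cmod_opp in H. lra.
Qed.

Lemma inv_S_Some (w : C) : w <> 0%C -> inv_S (Some w) = Some (/ w)%C.
Proof. intro N. simpl. destruct (Ceq_dec w (RtoC 0)); [contradiction | reflexivity]. Qed.

(** The nonvanishing factor [h] is replaced by [1 / h] on a disc where [h] has no zero. An equality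
    of predicates, not an equivalence, is needed to rewrite inside the sigma type of listed
    poles. *)
Lemma pole_order_inv (f : Cplx -> option Cplx) :
  pole_order f = zero_order (fun z => inv_S (f z)).
Proof.
  apply functional_extensionality. intro z. apply functional_extensionality. intro m.
  apply propositional_extensionality.
  assert (Inv : forall h : C -> C, (forall d, (forall w, Cmod (w - z) < d -> h w <> 0%C) ->
     holomorphic_on_disc h z d -> holomorphic_on_disc (fun w => / h w)%C z d)).
  { intros h d N H w Hw. apply (diff_at_inv h w); [now apply N | now apply H]. }
  assert (Nm : forall w : C, w <> z -> ((w - z) ^ m)%C <> 0%C).
  { intros w Hw. apply Cpow_nz. now apply Cminus_neq_0. }
  split.
  - intros [Hm [E0 [r [Hr [h [Hh [Nh E]]]]]]].
    destruct (nonzero_nearby h z r Hr Hh Nh) as [d [[Hd Hdr] Hn]].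
    split; auto. exists d. split; auto. exists (fun w => / h w)%C. split; [|split].
    + apply Inv; auto. intros w Hw. apply Hh. eapply Rlt_le_trans; [exact Hw | auto].
    + exact (Cinv_neq_0 _ Nh).
    + intros w Hw. destruct (classic (w = z)) as [->|N].
      * rewrite E0. apply (f_equal (@Some C)). change (RtoC 0 = ((z - z) ^ m * / h z)%C).
        destruct m as [|m']; [lia|]. rewrite Cpow_S. ring.
      * assert (Nw := Nm w N). assert (Nhw := Hn w Hw).
        rewrite (E w). 2:{ split; [now apply Cmod_minus_gt_0 | eapply Rlt_le_trans; [exact Hw | auto]]. }
        change (inv_S (Some (h w / (w - z) ^ m)%C) = Some ((w - z) ^ m * / h w)%C).
        rewrite inv_S_Some.
        -- apply (f_equal (@Some C)). field. auto.
        -- apply Cmult_neq_0; auto. now apply Cinv_neq_0.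
  - intro Hz. assert (E0 := zero_order_zero _ _ _ Hz).
    destruct Hz as [Hm [r [Hr [h [Hh [Nh E]]]]]].
    destruct (nonzero_nearby h z r Hr Hh Nh) as [d [[Hd Hdr] Hn]].
    split; auto. split.
    + rewrite <- (inv_S_involutive (f z)), E0. simpl. now destruct (Ceq_dec 0 (RtoC 0)).
    + exists d. split; auto. exists (fun w => / h w)%C. split; [|split].
      * apply Inv; auto. intros w Hw. apply Hh. eapply Rlt_le_trans; [exact Hw | auto].
      * exact (Cinv_neq_0 _ Nh).
      * intros w [Hw1 Hw2]. assert (N : w <> z).
        { intros ->. change (0 < Cmod (z - z)) in Hw1. rewrite Cmod_minus_diag in Hw1. lra. }
        assert (Nw := Nm w N). assert (Nhw := Hn w Hw2).
        rewrite <- (inv_S_involutive (f w)), (E w) by (eapply Rlt_le_trans; [exact Hw2 | auto]).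
        change (inv_S (Some ((w - z) ^ m * h w)%C) = Some ((/ h w) / (w - z) ^ m)%C).
        rewrite inv_S_Some by (now apply Cmult_neq_0).
        apply (f_equal (@Some C)). field. auto.
Qed.

(** [listed] has the form of the predicates in [zero_list] and [pole_list], so once poles are
    rewritten as zeros both sides are convertible. *)
Lemma almost_period_div_iff (f : Cplx -> option Cplx) (eps : R) (t : Cplx) :
  almost_period_div f eps t <->
  shift_bijection (zero_order f) eps t /\ shift_bijection (zero_order (fun z => inv_S (f z))) eps t.
Proof. rewrite <- pole_order_inv. reflexivity. Qed.

Lemma AE_divisor (f : Cplx -> option Cplx) (eps : R) :
  in_AE f -> eps > 0 -> exists d, d > 0 /\
    forall t, almost_period_f f d t -> almost_period_div f eps t.
Proof.
  intros (Hm & Hn & Hap) He.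
  assert (Hf : AE_sphere f) by (split; [now apply meromorphic_sphere_hol | auto]).
  destruct (AE_sphere_zeros f eps Hf He) as [d1 [P1 D1]].
  destruct (AE_sphere_zeros _ eps (AE_sphere_inv f Hf) He) as [d2 [P2 D2]].
  exists (Rmin d1 d2). split; [now apply Rmin_glb_lt|]. intros t Ht.
  apply almost_period_div_iff. split.
  - apply D1. intro z. eapply Rlt_le_trans; [apply Ht | apply Rmin_l].
  - apply D2. intro z. rewrite rho_S_inv. eapply Rlt_le_trans; [apply Ht | apply Rmin_r].
Qed.

Theorem mainTheorem7 (f : Cplx -> option Cplx) (hf : in_AE f) :
  div_almost_periodic f /\
  forall eps : R, eps > 0 ->
    relatively_dense (fun tau => almost_period_f f eps tau /\
                                 almost_period_div f eps tau).
Proof.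
  assert (Main : forall eps, eps > 0 ->
    relatively_dense (fun tau => almost_period_f f eps tau /\ almost_period_div f eps tau)).
  { intros eps He. destruct (AE_divisor f eps hf He) as [d [Hd H]].
    destruct hf as (_ & _ & Hap).
    destruct (Hap (Rmin eps d)) as [L [HL HLt]]; [now apply Rmin_glb_lt|].
    exists L. split; auto. intro c. destruct (HLt c) as [t [Ht Hc]]. exists t.
    split; auto. split.
    - intro z. eapply Rlt_le_trans; [apply Ht | apply Rmin_l].
    - apply H. intro z. eapply Rlt_le_trans; [apply Ht | apply Rmin_r]. }
  split; auto. intros eps He. destruct (Main eps He) as [L [HL H]].
  exists L. split; auto. intro c. destruct (H c) as [t [[_ Ht] Hc]]. now exists t.
Qed.
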